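(* Let $n\ge 1$ be an integer, $\alpha\in(0,2)$, $\beta>0$, and let $-\pi<\varphi\le\pi$ satisfy $|\varphi|>\pi\alpha/2$. Then the Fourier transform of the function $\mathbb{R}^n\ni x\mapsto E_{\alpha,\beta}(e^{i\varphi}|x|^{\sigma})$ is in $L^{p}(\mathbb{R}^{n})$ for all $$2\le p\le\infty \quad\text{if } \sigma>n,$$ $$2\le p<\infty \quad\text{if } \sigma=n,$$ $$2\le p<\frac{n}{n-\sigma}\quad\text{if } \frac n2<\sigma<n.$$
   Context: $E_{\alpha,\beta}(z)=\sum_{k=0}^\infty \frac{z^k}{\Gamma(\alpha k+\beta)}$ is the two-parameter Mittag-Leffler function. The Fourier transform is taken in the sense of tempered distributions on $\mathbb{R}^n$, with the normalization $\mathcal{F}f(\xi)=\int_{\mathbb{R}^n}e^{-ix\cdot\xi}f(x)\,dx$ for integrable $f$. *)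

(* Defs.v *)
From HB Require Import structures.
From mathcomp Require Import all_boot all_order all_algebra.
From mathcomp Require Import complex.
From mathcomp Require Import all_classical all_reals all_analysis.

Set Implicit Arguments.
Unset Strict Implicit.
Unset Printing Implicit Defensive.
Import Order.TTheory GRing.Theory Num.Theory.
Import numFieldNormedType.Exports.

Local Open Scope classical_set_scope.
Local Open Scope ring_scope.
Local Open Scope complex_scope.

Definition measure_rV_display : measure_display -> measure_display.
Proof. exact. Qed.

(* R^n is 'rV[R]_n, with the sigma-algebra generated by the coordinates, that
   is, the Borel sigma-algebra when T is R. *)
Section measurable_rV.
Context {d} {T : measurableType d}.
Variable n : nat.

Let coors : 'I_n -> 'rV[T]_n -> T := fun i x => x ord0 i.

Let rV_set0 : g_sigma_preimage coors set0.
Proof. exact: sigma_algebra0. Qed.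

Let rV_setC A : g_sigma_preimage coors A -> g_sigma_preimage coors (~` A).
Proof. exact: sigma_algebraC. Qed.

Let rV_bigcup (F : _^nat) : (forall i, g_sigma_preimage coors (F i)) ->
  g_sigma_preimage coors (\bigcup_i (F i)).
Proof. exact: sigma_algebra_bigcup. Qed.

HB.instance Definition _ := @isMeasurable.Build (measure_rV_display d)
  'rV[T]_n (g_sigma_preimage coors) rV_set0 rV_setC rV_bigcup.

End measurable_rV.

Lemma measurable_rV_coord d (T : measurableType d) n (i : 'I_n) :
  measurable_fun [set: 'rV[T]_n] (fun x : 'rV[T]_n => x ord0 i).
Proof.
move=> _ Y mY; rewrite setTI; apply: sub_sigma_algebra => /=.
rewrite -bigcup_seq/=; exists i => /=; first by rewrite mem_index_enum.
by exists Y => //; rewrite setTI.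
Qed.

Lemma measurable_fun_rV d1 d2 (T1 : measurableType d1) (T2 : measurableType d2)
    n (f : T1 -> 'rV[T2]_n) :
  (forall i, measurable_fun [set: T1] (fun x => f x ord0 i)) ->
  measurable_fun [set: T1] f.
Proof.
move=> mf _ Y; rewrite setTI => mY.
have : g_sigma_preimage (fun i x => f x ord0 i) (f @^-1` Y).
  have -> : (fun i x => f x ord0 i) =
      (fun i => (fun v : 'rV[T2]_n => v ord0 i) \o f) by [].
  by rewrite g_sigma_preimage_comp; exists Y => //; rewrite setTI.
apply: smallest_sub; first exact: sigma_algebra_measurable.
elim/big_ind : _ => //; first by move=> A B; rewrite subUset; split.
by move=> i _ _ [B mB <-]; exact: mf.
Qed.

Definition rV_cons (T : Type) n (p : T * 'rV[T]_n) : 'rV[T]_n.+1 :=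
  \row_i (if unlift ord0 i is Some j then p.2 ord0 j else p.1).

Definition rV_uncons (T : Type) n (v : 'rV[T]_n.+1) : T * 'rV[T]_n :=
  (v ord0 ord0, \row_j v ord0 (lift ord0 j)).

Lemma rV_consK (T : Type) n : cancel (@rV_cons T n) (@rV_uncons T n).
Proof.
move=> [x v]; rewrite /rV_uncons mxE unlift_none; congr pair.
by apply/rowP => j; rewrite !mxE liftK.
Qed.

Lemma measurable_rV_cons d (T : measurableType d) n :
  measurable_fun [set: T * 'rV[T]_n] (@rV_cons T n).
Proof.
apply: measurable_fun_rV => i; rewrite /rV_cons.
under eq_fun do rewrite mxE.
case: unliftP => [j _|_]; last exact: measurable_fst.
by apply: (measurableT_comp (measurable_rV_coord j)); exact: measurable_snd.
Qed.

Lemma measurable_rV_uncons d (T : measurableType d) n :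
  measurable_fun [set: 'rV[T]_n.+1] (@rV_uncons T n).
Proof.
apply/measurable_fun_pair; first exact: measurable_rV_coord.
apply: measurable_fun_rV => i; under eq_fun do rewrite mxE.
exact: measurable_rV_coord.
Qed.

Section lebesgue_rV_step.
Context (R : realType) (n : nat).
Variable m : {sigma_finite_measure set 'rV[R]_n -> \bar R}.
Local Open Scope ereal_scope.

Definition lebesgue_rV_step : set 'rV[R]_n.+1 -> \bar R :=
  pushforward (@lebesgue_measure R \x m) (@rV_cons R n).

Let step0 : lebesgue_rV_step set0 = 0.
Proof. by rewrite /lebesgue_rV_step /pushforward preimage_set0 measure0. Qed.

Let step_ge0 A : 0 <= lebesgue_rV_step A.
Proof. by rewrite /lebesgue_rV_step /pushforward; exact: measure_ge0. Qed.

Let step_sigma_additive : semi_sigma_additive lebesgue_rV_step.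
Proof.
have mc := @measurable_rV_cons _ R n.
move=> F mF tF mUF; rewrite /lebesgue_rV_step /pushforward preimage_bigcup.
apply: measure_semi_sigma_additive.
- by move=> k; rewrite -[X in measurable X]setTI; exact: mc.
- apply/trivIsetP => /= i j _ _ ij; rewrite -preimage_setI.
  by move/trivIsetP : tF => /(_ _ _ _ _ ij) ->//; rewrite preimage_set0.
- by rewrite -preimage_bigcup -[X in measurable X]setTI; exact: mc.
Qed.

HB.instance Definition _ := isMeasure.Build _ _ _
  lebesgue_rV_step step0 step_ge0 step_sigma_additive.

Let step_sigma_finite : sigma_finite setT lebesgue_rV_step.
Proof.
have /sigma_finiteP[F [TF ndF Foo]] := sigma_finiteT (@lebesgue_measure R).
have /sigma_finiteP[G [TG ndG Goo]] := sigma_finiteT m.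
exists (fun k => @rV_uncons R n @^-1` (F k `*` G k)).
  rewrite -preimage_bigcup (_ : \bigcup_k _ = setT) ?preimage_setT//.
  apply/seteqP; split => // -[x v] _.
  have [i _ Fix] : (\bigcup_i F i) x by rewrite -TF.
  have [j _ Gjv] : (\bigcup_i G i) v by rewrite -TG.
  exists (maxn i j) => //; split => /=.
  - by move: x Fix; exact/subsetPset/ndF/leq_maxl.
  - by move: v Gjv; exact/subsetPset/ndG/leq_maxr.
move=> k; have [mF Fkoo] := Foo k; have [mG Gkoo] := Goo k; split.
  rewrite -[X in measurable X]setTI.
  by apply: measurable_rV_uncons => //; exact: measurableX.
rewrite /lebesgue_rV_step /pushforward -comp_preimage.
rewrite (_ : _ \o _ = id); last by apply/funext => p /=; rewrite rV_consK.
by rewrite preimage_id product_measure1E// lte_mul_pinfty// ge0_fin_numE.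
Qed.

HB.instance Definition _ := Measure_isSigmaFinite.Build _ _ _
  lebesgue_rV_step step_sigma_finite.

End lebesgue_rV_step.

Fixpoint lebesgue_rV (R : realType) (n : nat) :
    {sigma_finite_measure set 'rV[R]_n -> \bar R} :=
  match n with
  | 0 => \d_(0 : 'rV[R]_0)
  | n.+1 => lebesgue_rV_step (lebesgue_rV R n)
  end.

Lemma lebesgue_rV_box (R : realType) n (A : 'I_n -> set R) :
  (forall i, measurable (A i)) ->
  lebesgue_rV R n [set x | forall i, A i (x ord0 i)] =
  (\prod_(i < n) (lebesgue_measure (A i)))%E.
Proof.
elim: n A => [|n IHn] A mA.
  rewrite big_ord0 /= diracE (_ : _ \in _ = true)//.
  by apply/mem_set => -[].
rewrite big_ord_recl -IHn; last by [].
rewrite /= /lebesgue_rV_step /pushforward.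
rewrite -product_measure1E//; last first.
  rewrite [X in measurable X](_ : _ = \bigcap_(i in [set: 'I_n])
      ((fun v : 'rV[R]_n => v ord0 i) @^-1` A (lift ord0 i))); last first.
    by apply/seteqP; split => v Av i => [_|]; [exact: Av | exact: (Av i)].
  apply: fin_bigcap_measurable => [|i _]; first exact: finite_finset.
  by rewrite -[X in measurable X]setTI; exact: measurable_rV_coord.
  exact: mA.
congr (product_measure1 _ _ _); apply/seteqP; split => -[x v] /=.
  move=> Av; split => [|i] /=.
    by have := Av ord0; rewrite mxE unlift_none.
  by have := Av (lift ord0 i); rewrite mxE liftK.
by move=> [/= Ax Av] i; rewrite mxE; case: unliftP => [j|] ->.
Qed.

(* Measurability, integrability and integrals of C-valued functions are taken
   on the real and imaginary parts. *)
Section complex_integral.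
Context d (T : measurableType d) (R : realType).
Variable mu : {measure set T -> \bar R}.
Implicit Type f : T -> R[i].

Definition cmeasurable f :=
  measurable_fun [set: T] (fun x => complex.Re (f x)) /\
  measurable_fun [set: T] (fun x => complex.Im (f x)).

Definition cintegrable f :=
  mu.-integrable [set: T] (fun x => (complex.Re (f x))%:E) /\
  mu.-integrable [set: T] (fun x => (complex.Im (f x))%:E).

Definition cintegral f : R[i] :=
  (\int[mu]_x complex.Re (f x)) +i* (\int[mu]_x complex.Im (f x)).

Definition cabs (z : R[i]) : R := ComplexField.Normc.normc z.

Definition in_Lp (p : \bar R) f :=
  cmeasurable f /\ ('N[mu]_p[EFin \o (cabs \o f)] < +oo)%E.

End complex_integral.

Section mittag_leffler.
Context {R : realType}.
Implicit Types (s t alpha beta : R) (z : R[i]).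

Definition cexpi t : R[i] := cos t +i* sin t.

(* Euler's integral, meant for 0 < s *)
Definition Gamma s : R :=
  \int[lebesgue_measure]_(t in `]0, +oo[) (t `^ (s - 1) * expR (- t)).

Definition mittag_leffler_term alpha beta z (k : nat) : R[i] :=
  z ^+ k / (Gamma (alpha * k%:R + beta))%:C.

Definition mittag_leffler alpha beta z : R[i] :=
  limn (series (fun k => complex.Re (mittag_leffler_term alpha beta z k))) +i*
  limn (series (fun k => complex.Im (mittag_leffler_term alpha beta z k))).

End mittag_leffler.

Section tempered_distributions.
Context {R : realType} {n : nat}.
Implicit Types (x y xi : 'rV[R]_n) (f g psi : 'rV[R]_n -> R[i]).

Definition dotp x y : R := \sum_(i < n) x ord0 i * y ord0 i.

(* the library norm on 'rV[R]_n is the sup norm *)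
Definition enorm x : R := Num.sqrt (dotp x x).

(* Multi-indices of derivation are given as lists of coordinates:
   [partials [:: i; j] u] is D_i (D_j u). *)
Definition partials (s : seq 'I_n) (u : 'rV[R]_n -> R) : 'rV[R]_n -> R :=
  foldr (fun i v => 'D_(delta_mx ord0 i) v) u s.

Definition smooth (u : 'rV[R]_n -> R) := forall s : seq 'I_n,
  continuous (partials s u) /\
  forall x i, derivable (partials s u) x (delta_mx ord0 i).

Definition cpartials (s : seq 'I_n) f x : R[i] :=
  partials s (fun y => complex.Re (f y)) x +i*
  partials s (fun y => complex.Im (f y)) x.

Definition monomial (a : {ffun 'I_n -> nat}) x : R :=
  \prod_(i < n) x ord0 i ^+ a i.

Definition weighted_values (a : {ffun 'I_n -> nat}) (s : seq 'I_n) f : set R :=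
  range (fun x => `|monomial a x| * cabs (cpartials s f x)).

Definition schwartz f :=
  [/\ smooth (fun x => complex.Re (f x)), smooth (fun x => complex.Im (f x)) &
      forall a s, has_ubound (weighted_values a s f)].

Definition schwartz_seminorm a s f : R := sup (weighted_values a s f).

(* A distribution is a functional on all functions R^n -> C; only its values on
   Schwartz functions are ever constrained. Continuity for the Schwartz topology
   is domination by finitely many of the defining seminorms. *)
Definition tempered (T : ('rV[R]_n -> R[i]) -> R[i]) :=
  (forall (c : R[i]) f g, schwartz f -> schwartz g ->
     T (fun x => c * f x + g x) = c * T f + T g) /\
  (exists (C : R) (L : seq ({ffun 'I_n -> nat} * seq 'I_n)),
     forall psi, schwartz psi ->
       cabs (T psi) <= C * \sum_(l <- L) schwartz_seminorm l.1 l.2 psi).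

Definition fourier f xi : R[i] :=
  cintegral (lebesgue_rV R n) (fun x => cexpi (- dotp x xi) * f x).

Definition fourier_distr (T : ('rV[R]_n -> R[i]) -> R[i]) psi : R[i] :=
  T (fourier psi).

Definition regular_distr f psi : R[i] :=
  cintegral (lebesgue_rV R n) (fun x => f x * psi x).

Definition tempered_function f :=
  [/\ cmeasurable f,
      forall psi, schwartz psi ->
        cintegrable (lebesgue_rV R n) (fun x => f x * psi x)
    & tempered (regular_distr f)].

Definition distr_in_Lp (p : \bar R) (T : ('rV[R]_n -> R[i]) -> R[i]) :=
  exists2 g, in_Lp (lebesgue_rV R n) p g &
    forall psi, schwartz psi -> T psi = regular_distr g psi.

(* [tempered_function f] is what gives f a Fourier transform; without it the
   pairing [regular_distr f] could be made of meaningless integrals. *)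
Definition fourier_in_Lp (p : \bar R) f :=
  tempered_function f /\ distr_in_Lp p (fourier_distr (regular_distr f)).

End tempered_distributions.

(* Main.v *)
(* Inserting the Laplace inversion formula for 1 / Gamma in the series and
   summing under the integral represents E(lam e^(i phi)) as an integral over
   the line Re s = 1 of e^s s^(-beta - 4) times a rational function of
   q = lam e^(i phi) s^(-alpha). Since |phi| > pi alpha / 2, the values of q
   avoid a sector around the positive axis, so |1 - q| is bounded below by a
   multiple of 1 + |q| and |E(lam e^(i phi))| <= K min(1, 1 / lam).
   The function f of the theorem is thus O(min(1, |x|^(-sigma))), and is split
   into dyadic shells f_j with transforms F_j. With r = 2^sigma, integrating the
   absolute value gives |F_j| <= C (2^n / r)^j, and Plancherel gives
   int |F_j|^2 <= C (2^n / r^2)^j. By interpolation int |F_j|^p is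
   O((2^((n - sigma) p) / 2^n)^j), which decays geometrically exactly when
   (n - sigma) p < n. Slightly larger weights then control sum_j |F_j| in L^p
   pointwise almost everywhere, so the sum is a function of L^p, and it
   represents the distributional transform of f. *)

Require Import Defs.
From mathcomp Require Import all_boot all_order all_algebra.
From mathcomp Require Import complex.
From mathcomp Require Import all_classical all_reals all_analysis.
From mathcomp Require Import measurable_realfun ess_sup_inf.
From mathcomp Require Import ring lra.

Import Order.TTheory GRing.Theory Num.Theory.
Import numFieldNormedType.Exports.

Local Open Scope classical_set_scope.
Local Open Scope ring_scope.
Local Open Scope complex_scope.

Set Implicit Arguments.
Unset Strict Implicit.
Unset Printing Implicit Defensive.

(** The inversion integral for 1 / Gamma(w) converges absolutely only for w > 1, so 1 / Gamma(w) is
    written as w (w + 1) (w + 2) (w + 3) / Gamma(w + 4). The series thereby gets coefficients of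
    degree 4 in k, and repeated summation by parts gives the rational function of q, whose only pole
    is q = 1. On Re s = 1 the series itself may diverge, since |q| is large for large lam. It is
    summed on a line far to the right, where |q| is small, and only the closed form, holomorphic
    between the lines, is moved back. No contour leaves the half-plane Re s > 0: there |arg s| < pi
    / 2, so the sector condition keeps q away from 1. Laplace inversion and the Plancherel
    inequality are both obtained by damping with exp(- eps |om|), whose transform is an explicit
    Poisson kernel. Constants lost on the way, such as a factor 2 in each bound of a complex
    integral, do not affect the geometric rates. Of the transform of a Schwartz function only square
    integrability is used. Since sigma > n / 2 puts f in L^2 as well, the truncations of f can pass
    to the limit in the pairing. *)

Local Notation Re := complex.Re.
Local Notation Im := complex.Im.

(** * Complex-valued integrals *)

Section cabs.
Context {R : realType}.
Implicit Types (x y : R) (z w : R[i]).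

Lemma cabs_ge0 z : 0 <= cabs z.
Proof. by case: z => a b; rewrite /cabs/= sqrtr_ge0. Qed.

Lemma cabsM z w : cabs (z * w) = cabs z * cabs w.
Proof. exact: ComplexField.Normc.normcM. Qed.

Lemma cabsV z : cabs z^-1 = (cabs z)^-1.
Proof. exact: ComplexField.Normc.normcV. Qed.

Lemma cabsD z w : cabs (z + w) <= cabs z + cabs w.
Proof. exact: le_normcD. Qed.

Lemma cabsN z : cabs (- z) = cabs z.
Proof. exact: normcN. Qed.

Lemma cabsB z w : cabs (z - w) <= cabs z + cabs w.
Proof. by rewrite -(cabsN w); exact: cabsD. Qed.

Lemma cabs0 : cabs 0 = 0 :> R.
Proof. exact: ComplexField.Normc.normc0. Qed.

Lemma cabs1 : cabs 1 = 1 :> R.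
Proof. exact: ComplexField.Normc.normc1. Qed.

Lemma cabsX z k : cabs (z ^+ k) = cabs z ^+ k.
Proof. by elim: k => [|k IH]; rewrite ?cabs1// !exprS cabsM IH. Qed.

Lemma cabs_sqr z : cabs z ^+ 2 = Re z ^+ 2 + Im z ^+ 2.
Proof. by case: z => a b; rewrite /cabs/= sqr_sqrtr// addr_ge0// sqr_ge0. Qed.

Lemma cabs_real x : cabs x%:C = `|x|.
Proof. by rewrite /cabs/= expr0n/= addr0 sqrtr_sqr. Qed.

Lemma cabs_eq0 z : cabs z = 0 -> z = 0.
Proof. exact: ComplexField.Normc.eq0_normc. Qed.

Lemma cabs_conj z : cabs z^* = cabs z.
Proof. by case: z => a b; rewrite /cabs/= sqrrN. Qed.

Lemma mulc_conj z : z * z^* = (cabs z ^+ 2)%:C.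
Proof.
rewrite cabs_sqr; case: z => a b; apply/eqP; rewrite eq_complex /=.
by apply/andP; split; apply/eqP; ring.
Qed.

Lemma normRe_le z : `|Re z| <= cabs z.
Proof.
by case: z => a b; rewrite /cabs/= -sqrtr_sqr ler_wsqrtr// lerDl sqr_ge0.
Qed.

Lemma normIm_le z : `|Im z| <= cabs z.
Proof.
by case: z => a b; rewrite /cabs/= -sqrtr_sqr ler_wsqrtr// lerDr sqr_ge0.
Qed.

Lemma cabs_leD z : cabs z <= `|Re z| + `|Im z|.
Proof.
rewrite -(ger0_norm (cabs_ge0 z)) -ler_sqr ?nnegrE ?addr_ge0//.
rewrite ger0_norm ?cabs_ge0// cabs_sqr sqrrD !real_normK ?num_real//.
by rewrite -addrA lerD2l lerDr mulrn_wge0// mulr_ge0.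
Qed.

Lemma cabs_expi x : cabs (cexpi x) = 1.
Proof. by rewrite /cabs/= cos2Dsin2 sqrtr1. Qed.

Lemma cexpiD x y : cexpi (x + y) = cexpi x * cexpi y.
Proof.
apply/eqP; rewrite eq_complex/= cosD sinD.
by apply/andP; split; apply/eqP; ring.
Qed.

Lemma cexpi0 : cexpi 0 = 1 :> R[i].
Proof. by rewrite /cexpi cos0 sin0. Qed.

Lemma cexpiN x : cexpi (- x) = (cexpi x)^*.
Proof. by rewrite /cexpi cosN sinN. Qed.

Lemma ReD z w : Re (z + w) = Re z + Re w. Proof. by case: z w => ? ? []. Qed.
Lemma ImD z w : Im (z + w) = Im z + Im w. Proof. by case: z w => ? ? []. Qed.
Lemma ReM z w : Re (z * w) = Re z * Re w - Im z * Im w.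
Proof. by case: z w => ? ? []. Qed.
Lemma ImM z w : Im (z * w) = Re z * Im w + Im z * Re w.
Proof. by case: z w => ? ? []. Qed.
Lemma ReN z : Re (- z) = - Re z. Proof. by case: z. Qed.
Lemma ImN z : Im (- z) = - Im z. Proof. by case: z. Qed.
Lemma Re_conj z : Re z^* = Re z. Proof. by case: z. Qed.
Lemma Im_conj z : Im z^* = - Im z. Proof. by case: z. Qed.

Lemma Re_realM x z : Re (x%:C * z) = x * Re z.
Proof. by rewrite ReM /= mul0r subr0. Qed.
Lemma Im_realM x z : Im (x%:C * z) = x * Im z.
Proof. by rewrite ImM /= mul0r addr0. Qed.

Lemma eq_c z w : Re z = Re w -> Im z = Im w -> z = w.
Proof. by case: z w => ? ? [? ?] /= -> ->. Qed.

Lemma Re_sum I (r : seq I) (P : pred I) (F : I -> R[i]) :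
  Re (\sum_(i <- r | P i) F i) = \sum_(i <- r | P i) Re (F i).
Proof. by elim/big_rec2 : _ => // i y1 y2 _ <-; rewrite ReD. Qed.

Lemma Im_sum I (r : seq I) (P : pred I) (F : I -> R[i]) :
  Im (\sum_(i <- r | P i) F i) = \sum_(i <- r | P i) Im (F i).
Proof. by elim/big_rec2 : _ => // i y1 y2 _ <-; rewrite ImD. Qed.

Lemma cabs_sum I (r : seq I) (P : pred I) (F : I -> R[i]) :
  cabs (\sum_(i <- r | P i) F i) <= \sum_(i <- r | P i) cabs (F i).
Proof.
elim/big_rec2 : _ => [|i y1 y2 _ H]; first by rewrite cabs0.
by rewrite (le_trans (cabsD _ _))// lerD2l.
Qed.

End cabs.

Section toolkit.
Context d (T : measurableType d) (R : realType).
Variable mu : {measure set T -> \bar R}.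
Implicit Types (f g : T -> R) (F G : T -> R[i]).

Lemma integrable_le f g : measurable_fun setT f ->
  (forall x, `|f x| <= g x) -> mu.-integrable setT (EFin \o g) ->
  mu.-integrable setT (EFin \o f).
Proof.
move=> mf fg; apply: le_integrable => //; first exact/measurable_EFinP.
move=> x _ /=; rewrite lee_fin (le_trans (fg x))//; exact: ler_norm.
Qed.

Lemma integrableP_lty f : measurable_fun setT f ->
  (\int[mu]_x `|f x|%:E < +oo)%E -> mu.-integrable setT (EFin \o f).
Proof. by move=> mf foo; apply/integrableP; split => //; exact/measurable_EFinP. Qed.

Lemma integrable_measurable f :
  mu.-integrable setT (EFin \o f) -> measurable_fun setT f.
Proof. by move/measurable_int/measurable_EFinP. Qed.

Lemma Rintegral_EFin f : mu.-integrable setT (EFin \o f) ->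
  (\int[mu]_x f x)%:E = (\int[mu]_x (f x)%:E)%E.
Proof. by move=> fi; rewrite /Rintegral fineK//; exact: integrable_fin_num. Qed.

Lemma Rintegral_dominated (f_ : nat -> T -> R) f g :
  (forall n, measurable_fun setT (f_ n)) ->
  (forall x, f_ ^~ x @ \oo --> f x) ->
  mu.-integrable setT (EFin \o g) ->
  (forall n x, `|f_ n x| <= g x) ->
  mu.-integrable setT (EFin \o f) /\
  \int[mu]_x f_ n x @[n --> \oo] --> \int[mu]_x f x.
Proof.
move=> mf ff gi fg.
have mff : measurable_fun setT f by exact: (measurable_fun_cvg mf).
have mef n : measurable_fun setT (EFin \o f_ n) by exact/measurable_EFinP.
have H := @dominated_convergence _ _ _ mu setT measurableT
  (fun n => EFin \o f_ n) (EFin \o f) (EFin \o g) mef.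
have [||||fi _ fcvg] := H.
- by apply/measurable_EFinP.
- apply/nearW => x _ /=.
  by apply: cvg_EFin; [exact: nearW|exact: ff].
- exact: gi.
- apply/nearW => x n _ /=; by rewrite lee_fin.
split => //.
apply: fine_cvg; rewrite Rintegral_EFin//.
Qed.

Lemma cintegrable_le F g : cmeasurable F -> (forall x, cabs (F x) <= g x) ->
  mu.-integrable setT (EFin \o g) -> cintegrable mu F.
Proof.
move=> [mR mI] Fg gi; split.
  by apply: (integrable_le mR) gi => x; rewrite (le_trans (normRe_le _)).
by apply: (integrable_le mI) gi => x; rewrite (le_trans (normIm_le _)).
Qed.

Lemma cintegrable_measurable F : cintegrable mu F -> cmeasurable F.
Proof. by move=> [/integrable_measurable ? /integrable_measurable]. Qed.

Lemma cabs_measurable F : cmeasurable F -> measurable_fun setT (fun x => cabs (F x)).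
Proof.
move=> [mR mI].
have -> : (fun x => cabs (F x)) =
    (fun x => Num.sqrt (Re (F x) ^+ 2 + Im (F x) ^+ 2)).
  by apply/funext => x; rewrite -cabs_sqr sqrtr_sqr ger0_norm// cabs_ge0.
apply: (@measurableT_comp _ _ _ _ _ _ (@Num.sqrt R)).
  by apply: continuous_measurable_fun; exact: sqrt_continuous.
by apply: measurable_funD; apply: measurable_funX.
Qed.

Lemma cintegrable_abs F : cintegrable mu F ->
  mu.-integrable setT (EFin \o (fun x => cabs (F x))).
Proof.
move=> Fi; have mF := cintegrable_measurable Fi; case: Fi => Ri Ii.
apply: (@integrable_le _ (fun x => `|Re (F x)| + `|Im (F x)|)).
- exact: cabs_measurable.
- by move=> x; rewrite ger0_norm ?cabs_ge0// cabs_leD.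
- have -> : EFin \o (fun x => `|Re (F x)| + `|Im (F x)|) =
    (EFin \o (fun x => `|Re (F x)|)) \+ (EFin \o (fun x => `|Im (F x)|)) by [].
  by apply: integrableD => //; [exact: (integrable_norm Ri)|exact: (integrable_norm Ii)].
Qed.

Lemma cintegrableD F G : cintegrable mu F -> cintegrable mu G ->
  cintegrable mu (fun x => F x + G x).
Proof.
move=> [FR FI] [GR GI]; split.
  by under eq_fun do rewrite ReD EFinD; exact: integrableD.
by under eq_fun do rewrite ImD EFinD; exact: integrableD.
Qed.

Lemma cmeasurableM F G : cmeasurable F -> cmeasurable G ->
  cmeasurable (fun x => F x * G x).
Proof.
move=> [FR FI] [GR GI]; split.
  by under eq_fun do rewrite ReM; apply: measurable_funB; apply: measurable_funM.
by under eq_fun do rewrite ImM; apply: measurable_funD; apply: measurable_funM.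
Qed.

Lemma cmeasurable_cst (c : R[i]) : cmeasurable (fun _ : T => c).
Proof. by split; exact: measurable_cst. Qed.

Lemma cmeasurable_real f : measurable_fun setT f -> cmeasurable (fun x => (f x)%:C).
Proof. by move=> mf; split => //; exact: measurable_cst. Qed.

Lemma cmeasurable_conj F : cmeasurable F -> cmeasurable (fun x => (F x)^*).
Proof.
move=> [FR FI]; split; first by under eq_fun do rewrite Re_conj.
by under eq_fun do rewrite Im_conj; exact: measurableT_comp.
Qed.

Lemma cmeasurable_expi f : measurable_fun setT f -> cmeasurable (fun x => cexpi (f x)).
Proof.
move=> mf; split; apply: measurableT_comp => //; apply: continuous_measurable_fun.
  exact: continuous_cos.
exact: continuous_sin.
Qed.

Lemma cmeasurable_sum I (r : seq I) (F_ : I -> T -> R[i]) :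
  (forall i, cmeasurable (F_ i)) -> cmeasurable (fun x => \sum_(i <- r) F_ i x).
Proof.
move=> mF; split.
  by under eq_fun do rewrite Re_sum; apply: measurable_sum => i; case: (mF i).
by under eq_fun do rewrite Im_sum; apply: measurable_sum => i; case: (mF i).
Qed.

Lemma cintegrableMl F (G : T -> R[i]) (M : R) : cintegrable mu F -> cmeasurable G ->
  (forall x, cabs (G x) <= M) -> cintegrable mu (fun x => G x * F x).
Proof.
move=> Fi mG GM; apply: (@cintegrable_le _ (fun x => M * cabs (F x))).
- by apply: cmeasurableM => //; exact: (cintegrable_measurable Fi).
- by move=> x; rewrite cabsM ler_wpM2r// cabs_ge0.
- have -> : EFin \o (fun x => M * cabs (F x)) =
    (fun x => M%:E * (EFin \o (fun x => cabs (F x))) x)%E by [].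
  by apply: integrableZl => //; exact: cintegrable_abs.
Qed.

Lemma cintegrableZl (c : R[i]) F : cintegrable mu F ->
  cintegrable mu (fun x => c * F x).
Proof.
move=> Fi; apply: (@cintegrableMl F (fun _ => c) (cabs c)) => //.
Qed.

Lemma eq_cintegral F G : (forall x, F x = G x) -> cintegral mu F = cintegral mu G.
Proof. by move=> FG; congr cintegral; apply/funext. Qed.

Lemma cintegral_real f : cintegral mu (fun x => (f x)%:C) = (\int[mu]_x f x)%:C.
Proof.
by rewrite /cintegral; congr Complex; rewrite /= Rintegral_cst// mul0r.
Qed.

Lemma cintegralD F G : cintegrable mu F -> cintegrable mu G ->
  cintegral mu (fun x => F x + G x) = cintegral mu F + cintegral mu G.
Proof.
move=> [FR FI] [GR GI]; rewrite /cintegral; apply: eq_c => /=.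
  by rewrite -RintegralD//; apply: eq_Rintegral => x _; rewrite ReD.
by rewrite -RintegralD//; apply: eq_Rintegral => x _; rewrite ImD.
Qed.

Lemma cintegralZl (c : R[i]) F : cintegrable mu F ->
  cintegral mu (fun x => c * F x) = c * cintegral mu F.
Proof.
move=> [FR FI]; have Z (r : R) (f : T -> R) : mu.-integrable setT (EFin \o f) ->
    mu.-integrable setT (EFin \o (fun x => r * f x)).
  by move=> fi; exact: (integrableZl measurableT r fi).
rewrite /cintegral; apply: eq_c; rewrite ?ReM ?ImM/=.
  rewrite -!RintegralZl// -RintegralB//; [|exact: Z..].
  by apply: eq_Rintegral => x _; rewrite ReM.
rewrite -!RintegralZl// -RintegralD//; [|exact: Z..].
by apply: eq_Rintegral => x _; rewrite ImM.
Qed.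

Lemma cintegralZr (c : R[i]) F : cintegrable mu F ->
  cintegral mu (fun x => F x * c) = cintegral mu F * c.
Proof.
move=> Fi; rewrite mulrC -cintegralZl//; apply: eq_cintegral => x.
by rewrite mulrC.
Qed.

Lemma cintegral_conj F : cintegrable mu F ->
  cintegral mu (fun x => (F x)^*) = (cintegral mu F)^*.
Proof.
move=> [FR FI]; rewrite /cintegral; apply: eq_c => /=.
  by apply: eq_Rintegral => x _; rewrite Re_conj.
rewrite -mulN1r -RintegralZl//; apply: eq_Rintegral => x _.
by rewrite Im_conj mulN1r.
Qed.

Lemma cintegral_sum N (F_ : nat -> T -> R[i]) :
  (forall i, cintegrable mu (F_ i)) ->
  cintegrable mu (fun x => \sum_(0 <= i < N) F_ i x) /\
  cintegral mu (fun x => \sum_(0 <= i < N) F_ i x) = \sum_(0 <= i < N) cintegral mu (F_ i).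
Proof.
move=> Fi; elim: N => [|N [IH1 IH2]].
  split.
    by split; under eq_fun do rewrite big_geq//=; exact: integrable0.
  rewrite big_geq//; apply: eq_c => /=; under eq_Rintegral do rewrite big_geq//=.
    by rewrite Rintegral_cst//= mul0r.
  by rewrite Rintegral_cst//= mul0r.
have E x : \sum_(0 <= i < N.+1) F_ i x = \sum_(0 <= i < N) F_ i x + F_ N x.
  by rewrite big_nat_recr.
split; first by under eq_fun do rewrite E; exact: cintegrableD.
under eq_cintegral do rewrite E.
by rewrite cintegralD// IH2 big_nat_recr.
Qed.

(** The factor 2 comes from bounding the real and imaginary parts separately. *)
Lemma cabs_cintegral F g : cmeasurable F -> (forall x, cabs (F x) <= g x) ->
  mu.-integrable setT (EFin \o g) -> cabs (cintegral mu F) <= 2 * \int[mu]_x g x.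
Proof.
move=> mF Fg gi; have [FR FI] := cintegrable_le mF Fg gi.
rewrite (le_trans (cabs_leD _))//= mulr_natl mulr2n lerD//.
  rewrite (le_trans (le_normr_Rintegral _ FR))//; apply: le_Rintegral => //.
    exact: (integrable_norm FR).
  by move=> x _; rewrite (le_trans (normRe_le _)).
rewrite (le_trans (le_normr_Rintegral _ FI))//; apply: le_Rintegral => //.
  exact: (integrable_norm FI).
by move=> x _; rewrite (le_trans (normIm_le _)).
Qed.

End toolkit.

(** * Fubini's theorem under a product bound *)

Section fubini.
Context d1 d2 (T1 : measurableType d1) (T2 : measurableType d2) (R : realType).
Variables (m1 : {sigma_finite_measure set T1 -> \bar R})
  (m2 : {sigma_finite_measure set T2 -> \bar R}).

(** A majorant of product form makes every section integrable, not just almost every one, so the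
    Fubini statements below carry no exceptional null sets. *)
Lemma integrable_prod_le (f : T1 * T2 -> R) (a : T1 -> R) (b : T2 -> R) :
  measurable_fun setT f ->
  (forall x, 0 <= a x) -> (forall y, 0 <= b y) ->
  (forall x y, `|f (x, y)| <= a x * b y) ->
  m1.-integrable setT (EFin \o a) -> m2.-integrable setT (EFin \o b) ->
  [/\ forall x, m2.-integrable setT (EFin \o (fun y => f (x, y))),
      forall y, m1.-integrable setT (EFin \o (fun x => f (x, y))) &
      (m1 \x m2)%E.-integrable setT (EFin \o f)].
Proof.
move=> mf a0 b0 fab ai bi.
have i2 x : m2.-integrable setT (EFin \o (fun y => f (x, y))).
  apply: (@integrable_le _ _ _ _ _ (fun y => a x * b y)) => //.
    by apply: (measurableT_comp mf); exact: measurable_pair1.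
  exact: (integrableZl measurableT (a x) bi).
have i1 y : m1.-integrable setT (EFin \o (fun x => f (x, y))).
  apply: (@integrable_le _ _ _ _ _ (fun x => b y * a x)) => //.
  - by apply: (measurableT_comp mf); exact: measurable_pair2.
  - by move=> x; rewrite mulrC.
  - exact: (integrableZl measurableT (b y) ai).
split => //.
apply/integrable12ltyP; first exact/measurable_EFinP.
apply: (@le_lt_trans _ _ (\int[m1]_x ((a x)%:E * \int[m2]_y (b y)%:E)))%E.
  apply: ge0_le_integral => //.
  - by move=> x _; exact: integral_ge0.
  - apply: (@measurable_fun_fubini_tonelli_F _ _ _ _ _ m2 (fun z => `|(f z)%:E|)%E).
      by apply: measurableT_comp => //; exact/measurable_EFinP.
    by move=> x; exact: abse_ge0.
  - by apply: emeasurable_funM => //; exact: measurable_int ai.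
  - move=> x _; rewrite -ge0_integralZl//; last 2 first.
      by move=> y _; rewrite lee_fin.
      by rewrite lee_fin.
    apply: ge0_le_integral => //.
    + by apply: measurableT_comp => //; exact: measurable_int (i2 x).
    + by apply: emeasurable_funM => //; exact: measurable_int bi.
    + by move=> y _; rewrite /= lee_fin.
    + exact: measurable_int bi.
rewrite -(fineK (integrable_fin_num measurableT bi)) ge0_integralZr//; last 3 first.
  exact: measurable_int ai.
  by move=> x _; rewrite lee_fin.
  by rewrite lee_fin fine_ge0// integral_ge0// => y _; rewrite lee_fin.
rewrite -(fineK (integrable_fin_num measurableT ai)) -EFinM.
exact: ltry.
Qed.

Lemma rFubini (f : T1 * T2 -> R) (a : T1 -> R) (b : T2 -> R) :
  measurable_fun setT f ->
  (forall x, 0 <= a x) -> (forall y, 0 <= b y) ->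
  (forall x y, `|f (x, y)| <= a x * b y) ->
  m1.-integrable setT (EFin \o a) -> m2.-integrable setT (EFin \o b) ->
  [/\ forall x, m2.-integrable setT (fun y => (f (x, y))%:E),
      forall y, m1.-integrable setT (fun x => (f (x, y))%:E),
      m1.-integrable setT (fun x => (\int[m2]_y f (x, y))%:E),
      m2.-integrable setT (fun y => (\int[m1]_x f (x, y))%:E) &
      \int[m1]_x (\int[m2]_y f (x, y)) = \int[m2]_y (\int[m1]_x f (x, y))].
Proof.
move=> mf a0 b0 fab ai bi.
have [i2 i1 fi] := integrable_prod_le mf a0 b0 fab ai bi.
have E1 x : (\int[m2]_y f (x, y))%:E = (\int[m2]_y (f (x, y))%:E)%E.
  exact: Rintegral_EFin.
have E2 y : (\int[m1]_x f (x, y))%:E = (\int[m1]_x (f (x, y))%:E)%E.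
  exact: (Rintegral_EFin (i1 y)).
have F := Fubini fi.
split => //.
- under eq_fun do rewrite E1.
  exact: (integrable_fubini_F fi).
- apply: (@integrable_le _ _ _ _ _ (fun y => b y * \int[m1]_x a x)).
  + apply/measurable_EFinP.
    have -> : EFin \o (fun y => \int[m1]_x f (x, y)) = fubini_G m1 (EFin \o f).
      by apply/funext => y; rewrite /= E2.
    exact: measurable_fubini_G fi.
  + move=> y; rewrite (le_trans (le_normr_Rintegral _ (i1 y)))//.
    rewrite -RintegralZl//; apply: le_Rintegral => //.
    * exact: (integrable_norm (i1 y)).
    * exact: (integrableZl measurableT (b y) ai).
    * by move=> x _; rewrite mulrC.
  + exact: (integrableZr measurableT _ bi).
- rewrite /Rintegral; congr fine.
  under eq_integral do rewrite E1.
  under [RHS]eq_integral do rewrite E2.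
  exact: F.
Qed.

Lemma cFubini (F : T1 * T2 -> R[i]) (a : T1 -> R) (b : T2 -> R) :
  cmeasurable F ->
  (forall x, 0 <= a x) -> (forall y, 0 <= b y) ->
  (forall x y, cabs (F (x, y)) <= a x * b y) ->
  m1.-integrable setT (EFin \o a) -> m2.-integrable setT (EFin \o b) ->
  [/\ forall x, cintegrable m2 (fun y => F (x, y)),
      forall y, cintegrable m1 (fun x => F (x, y)),
      cintegrable m1 (fun x => cintegral m2 (fun y => F (x, y))),
      cintegrable m2 (fun y => cintegral m1 (fun x => F (x, y))) &
      cintegral m1 (fun x => cintegral m2 (fun y => F (x, y))) =
      cintegral m2 (fun y => cintegral m1 (fun x => F (x, y)))].
Proof.
move=> [mR mI] a0 b0 Fab ai bi.
have [R1 R2 R3 R4 R5] := @rFubini (fun z => Re (F z)) a b mR a0 b0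
  (fun x y => le_trans (normRe_le _) (Fab x y)) ai bi.
have [I1 I2 I3 I4 I5] := @rFubini (fun z => Im (F z)) a b mI a0 b0
  (fun x y => le_trans (normIm_le _) (Fab x y)) ai bi.
split => //.
by rewrite /cintegral; apply: eq_c => /=; [exact: R5|exact: I5].
Qed.

Lemma cintegral_prod (F : T1 * T2 -> R[i]) (a : T1 -> R) (b : T2 -> R) :
  cmeasurable F ->
  (forall x, 0 <= a x) -> (forall y, 0 <= b y) ->
  (forall x y, cabs (F (x, y)) <= a x * b y) ->
  m1.-integrable setT (EFin \o a) -> m2.-integrable setT (EFin \o b) ->
  cintegrable (m1 \x m2)%E F /\
  cintegral (m1 \x m2)%E F = cintegral m1 (fun x => cintegral m2 (fun y => F (x, y))).
Proof.
have key (f : T1 * T2 -> R) :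
    (forall x, m2.-integrable setT (EFin \o (fun y => f (x, y)))) ->
    (m1 \x m2)%E.-integrable setT (EFin \o f) ->
    \int[(m1 \x m2)%E]_z f z = \int[m1]_x (\int[m2]_y f (x, y)).
  move=> i2 fi; rewrite /Rintegral; congr fine.
  rewrite -(integral12_prod_meas1 fi); apply: eq_integral => x _.
  by rewrite /fubini_F -(Rintegral_EFin (i2 x)).
move=> [mR mI] a0 b0 Fab ai bi.
have [R1 _ R3] := @integrable_prod_le (fun z => Re (F z)) a b mR a0 b0
  (fun x y => le_trans (normRe_le _) (Fab x y)) ai bi.
have [I1 _ I3] := @integrable_prod_le (fun z => Im (F z)) a b mI a0 b0
  (fun x y => le_trans (normIm_le _) (Fab x y)) ai bi.
split => //; apply: eq_c => /=; [exact: (key (fun z => Re (F z)))|exact: (key (fun z => Im (F z)))].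
Qed.

End fubini.

(** * Calculus for complex functions of a real variable *)

Section cderiv.
Context {R : realType}.
Implicit Types (F G : R -> R[i]) (x : R).

(** Taken componentwise, so that the mean value theorem and differentiation under the integral sign
    for real functions apply. *)
Definition cderiv F x (d : R[i]) :=
  is_derive x (1 : R) (fun t => Re (F t)) (Re d) /\
  is_derive x (1 : R) (fun t => Im (F t)) (Im d).

Lemma cderiv_eq F x (d d' : R[i]) : cderiv F x d -> d = d' -> cderiv F x d'.
Proof. by move=> H <-. Qed.

Lemma cderiv_cst (c : R[i]) x : cderiv (fun _ => c) x 0.
Proof. by split; exact: is_derive_cst. Qed.

Lemma is_derive_const (c x : R) : is_derive x (1 : R) (fun _ : R => c) 0.
Proof. exact: is_derive_cst. Qed.

Lemma is_derive_idfun x : is_derive x (1 : R) (fun t : R => t) 1.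
Proof. exact: is_derive_id. Qed.

Lemma is_derive_eqd (f : R -> R) x (d d' : R) :
  is_derive x (1 : R) f d -> d = d' -> is_derive x (1 : R) f d'.
Proof. by move=> H <-. Qed.

Lemma is_derive_funM (f g : R -> R) x (df dg : R) : is_derive x (1 : R) f df ->
  is_derive x (1 : R) g dg ->
  is_derive x (1 : R) (fun t => f t * g t) (f x * dg + g x * df).
Proof. by move=> Hf Hg; exact: (@is_deriveM R R f g x 1 df dg Hf Hg). Qed.

Lemma is_derive_funD (f g : R -> R) x (df dg : R) : is_derive x (1 : R) f df ->
  is_derive x (1 : R) g dg ->
  is_derive x (1 : R) (fun t => f t + g t) (df + dg).
Proof. by move=> Hf Hg; exact: (is_deriveD Hf Hg). Qed.

Lemma is_derive_funN (f : R -> R) x (df : R) : is_derive x (1 : R) f df ->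
  is_derive x (1 : R) (fun t => - f t) (- df).
Proof. by move=> Hf; exact: (is_deriveN Hf). Qed.

Lemma is_derive_funB (f g : R -> R) x (df dg : R) : is_derive x (1 : R) f df ->
  is_derive x (1 : R) g dg ->
  is_derive x (1 : R) (fun t => f t - g t) (df - dg).
Proof. by move=> Hf Hg; exact: (is_deriveB Hf Hg). Qed.

Lemma is_derive_chain (f g : R -> R) x (df dg : R) : is_derive (g x) (1 : R) f df ->
  is_derive x (1 : R) g dg -> is_derive x (1 : R) (fun t => f (g t)) (df * dg).
Proof.
by move=> Hf Hg; exact: (@is_derive1_comp R f g x df dg Hf Hg).
Qed.

Lemma cderivD F G x (d e : R[i]) : cderiv F x d -> cderiv G x e ->
  cderiv (fun t => F t + G t) x (d + e).
Proof.
move=> [FR FI] [GR GI]; split.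
  by under eq_fun do rewrite ReD; rewrite ReD; exact: is_derive_funD.
by under eq_fun do rewrite ImD; rewrite ImD; exact: is_derive_funD.
Qed.

Lemma cderivM F G x (d e : R[i]) : cderiv F x d -> cderiv G x e ->
  cderiv (fun t => F t * G t) x (F x * e + G x * d).
Proof.
move=> [FR FI] [GR GI]; split.
  under eq_fun do rewrite ReM.
  apply: (is_derive_eqd (is_derive_funB (is_derive_funM FR GR) (is_derive_funM FI GI))).
  by rewrite ReD !ReM; ring.
under eq_fun do rewrite ImM.
apply: (is_derive_eqd (is_derive_funD (is_derive_funM FR GI) (is_derive_funM FI GR))).
by rewrite ImD !ImM; ring.
Qed.

Lemma cderiv_real (f : R -> R) x (df : R) : is_derive x (1 : R) f df ->
  cderiv (fun t => (f t)%:C) x df%:C.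
Proof. by move=> Hf; split => //=; exact: is_derive_cst. Qed.

Lemma cderiv_pair (f g : R -> R) x (df dg : R) : is_derive x (1 : R) f df ->
  is_derive x (1 : R) g dg -> cderiv (fun t => f t +i* g t) x (df +i* dg).
Proof. by []. Qed.

Definition cexp (z : R[i]) : R[i] := (expR (Re z))%:C * cexpi (Im z).

Lemma cexpD (z w : R[i]) : cexp (z + w) = cexp z * cexp w.
Proof.
rewrite /cexp ReD ImD expRD cexpiD rmorphM /=.
by rewrite mulrACA.
Qed.

Lemma cexp0 : cexp 0 = 1.
Proof. by rewrite /cexp /= expR0 cexpi0 mulr1. Qed.

Lemma cabs_cexp (z : R[i]) : cabs (cexp z) = expR (Re z).
Proof. by rewrite cabsM cabs_expi mulr1 cabs_real ger0_norm// expR_ge0. Qed.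

Lemma cexp_neq0 (z : R[i]) : cexp z != 0.
Proof.
apply/eqP => /(congr1 (@cabs R)); rewrite cabs_cexp cabs0.
by move/eqP; rewrite gt_eqF// expR_gt0.
Qed.

Lemma cexpN (z : R[i]) : cexp (- z) = (cexp z)^-1.
Proof.
apply: (mulfI (cexp_neq0 z)); rewrite -cexpD subrr cexp0 mulfV//.
exact: cexp_neq0.
Qed.

Lemma cexpX (z : R[i]) k : cexp (k%:R * z) = cexp z ^+ k.
Proof.
elim: k => [|k IH]; first by rewrite mul0r cexp0.
by rewrite -natr1 mulrDl mul1r cexpD IH exprSr.
Qed.

Lemma cderiv_expi (f : R -> R) x (df : R) : is_derive x (1 : R) f df ->
  cderiv (fun t => cexpi (f t)) x ('i * df%:C * cexpi (f x)).
Proof.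
move=> Hf; apply: (@cderiv_eq _ _ ((- sin (f x) * df) +i* (cos (f x) * df))).
  exact: (cderiv_pair (is_derive_chain (is_derive_cos (f x)) Hf)
    (is_derive_chain (is_derive_sin (f x)) Hf)).
by apply: eq_c; rewrite !(ReM, ImM)/=; ring.
Qed.

Lemma cderiv_exp F x (d : R[i]) : cderiv F x d ->
  cderiv (fun t => cexp (F t)) x (d * cexp (F x)).
Proof.
move=> [FR FI].
apply: (cderiv_eq (cderivM (cderiv_real (is_derive_chain (is_derive_expR _) FR))
  (cderiv_expi FI))).
rewrite /cexp; apply: eq_c; rewrite !(ReD, ImD, ReM, ImM)/=; ring.
Qed.

Lemma cderivV F x (d : R[i]) : F x != 0 -> cderiv F x d ->
  cderiv (fun t => (F t)^-1) x (- d * (F x)^-1 ^+ 2).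
Proof.
move=> Fx0 [FR FI].
have n0 : Re (F x) ^+ 2 + Im (F x) ^+ 2 != 0.
  rewrite -cabs_sqr sqrf_eq0; apply: contra Fx0 => /eqP/cabs_eq0 ->//.
have E t : (F t)^-1 = (Re (F t) * (Re (F t) ^+ 2 + Im (F t) ^+ 2)^-1) +i*
     (- Im (F t) * (Re (F t) ^+ 2 + Im (F t) ^+ 2)^-1).
  by case: (F t) => a b; apply: eq_c => //=; rewrite mulNr.
under eq_fun do rewrite E.
have HN : is_derive x (1 : R) (fun t => (Re (F t) ^+ 2 + Im (F t) ^+ 2)^-1)
    (- (Re (F x) ^+ 2 + Im (F x) ^+ 2)^-1 ^+ 2 *
     (2 * Re (F x) * Re d + 2 * Im (F x) * Im d)).
  have HH : is_derive x (1:R) (fun t => Re (F t) ^+ 2 + Im (F t) ^+ 2)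
     (2 * Re (F x) * Re d + 2 * Im (F x) * Im d).
    apply: (is_derive_eqd (is_derive_funD (is_derive_funM FR FR) (is_derive_funM FI FI))).
    by ring.
  apply: (is_derive_eqd (@is_deriveV R (fun t => Re (F t) ^+ 2 + Im (F t) ^+ 2) x _ 1 n0 HH)).
  by rewrite exprVn.
apply: (cderiv_eq (cderiv_pair (is_derive_funM FR HN) (is_derive_funM (is_derive_funN FI) HN))).
rewrite E expr2; apply: eq_c; rewrite !(ReM, ImM, ReN, ImN)/= ?(ReM, ImM, ReN, ImN)/=; by field.
Qed.

Lemma cderiv_continuous F : (forall x, exists d, cderiv F x d) ->
  continuous (fun x => Re (F x)) /\ continuous (fun x => Im (F x)).
Proof.
move=> H; split => x; have [d [HR HI]] := H x.
  exact: (@differentiable_continuous _ _ _ x _ ((derivable1_diffP _ _).1 (@ex_derive _ _ _ _ _ _ _ HR))).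
exact: (@differentiable_continuous _ _ _ x _ ((derivable1_diffP _ _).1 (@ex_derive _ _ _ _ _ _ _ HI))).
Qed.

Lemma cderiv0_cst F : (forall x, cderiv F x 0) -> forall x y, F x = F y.
Proof.
move=> H x y; apply: eq_c.
  by apply: (@is_derive_0_is_cst R (fun t => Re (F t))) => t; case: (H t).
by apply: (@is_derive_0_is_cst R (fun t => Im (F t))) => t; case: (H t).
Qed.

End cderiv.

Section under_integral.
Context d (Y : measurableType d) (R : realType) (mu : {measure set Y -> \bar R}).

Lemma cderiv_under_integral (F F' : R -> Y -> R[i]) (a u v : R) (G : Y -> R) :
  u < a < v ->
  (forall x, u < x < v -> cintegrable mu (F x)) ->
  (forall x y, u < x < v -> cderiv (F ^~ y) x (F' x y)) ->
  (forall x y, u < x < v -> cabs (F' x y) <= G y) ->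
  mu.-integrable setT (EFin \o G) ->
  cderiv (fun x => cintegral mu (F x)) a (cintegral mu (F' a)).
Proof.
move=> auv Fi FF' F'G Gi.
have key (f f' : R -> Y -> R) :
    (forall x, u < x < v -> mu.-integrable setT (EFin \o f x)) ->
    (forall x y, u < x < v -> is_derive x (1 : R) (f ^~ y) (f' x y)) ->
    (forall x y, u < x < v -> `|f' x y| <= G y) ->
    is_derive a (1 : R) (fun x => \int[mu]_y f x y) (\int[mu]_y f' a y).
  move=> fi ff' f'G.
  have I x : `]u, v[%classic x -> u < x < v by rewrite /= in_itv.
  have E x y : u < x < v -> partial1of2 f x y = f' x y.
    by move=> xuv; rewrite partial1of2E; have [_ ->] := ff' x y xuv.
  have Ia : `]u, v[%classic a by rewrite /= in_itv.
  have A1 := fun x (Ix : `]u, v[%classic x) => fi x (I x Ix).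
  have A2 x y : `]u, v[%classic x -> setT y -> derivable (f ^~ y) x 1.
    by move=> /I xuv _; have [] := ff' x y xuv.
  have A3 y : 0 <= G y by apply: le_trans (f'G a y auv).
  have A4 x y : `]u, v[%classic x -> setT y -> `|partial1of2 f x y| <= G y.
    by move=> /I xuv _; rewrite E//; exact: f'G.
  apply: DeriveDef.
    exact: (@derivable_under_integral _ _ _ mu f setT measurableT a u v Ia A1 A2 G A3 Gi A4).
  rewrite -derive1E.
  rewrite (@differentiation_under_integral _ _ _ mu f setT measurableT a u v Ia A1 A2 G A3 Gi A4).
  by apply: eq_Rintegral => y _; exact: E.
split => /=.
  apply: (key (fun x y => Re (F x y)) (fun x y => Re (F' x y))).
  - by move=> x /Fi[].
  - by move=> x y /(FF' _ y)[].
  - by move=> x y xuv; rewrite (le_trans (normRe_le _))// F'G.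
apply: (key (fun x y => Im (F x y)) (fun x y => Im (F' x y))).
- by move=> x /Fi[].
- by move=> x y /(FF' _ y)[].
- by move=> x y xuv; rewrite (le_trans (normIm_le _))// F'G.
Qed.

End under_integral.

(** * The transform of the exponential of the absolute value *)

Section FTC_exhaustion.
Context {R : realType}.
Local Notation mu := (@lebesgue_measure R).
Variables (f F : R -> R) (D : set R) (a_ b_ : nat -> R) (la lb : R).
Hypothesis openD : open D.
Hypothesis ab : forall n, a_ n < b_ n.
Hypothesis nia : forall m n, (m <= n)%N -> a_ n <= a_ m.
Hypothesis ndb : forall m n, (m <= n)%N -> b_ m <= b_ n.
Hypothesis DE : D = \bigcup_n `[a_ n, b_ n]%classic.
Hypothesis cf : forall x, D x -> {for x, continuous f}.
Hypothesis dF : forall x, D x -> is_derive x (1 : R) F (f x).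
Hypothesis Fa : F (a_ n) @[n --> \oo] --> la.
Hypothesis Fb : F (b_ n) @[n --> \oo] --> lb.

Let mD : measurable D. Proof. exact: open_measurable. Qed.

Let mf : measurable_fun D f.
Proof.
apply: open_continuous_measurable_fun => // x; rewrite inE; exact: cf.
Qed.

Let sub n : `[a_ n, b_ n]%classic `<=` D.
Proof. by rewrite DE => x xab; exists n. Qed.

Let FTCn n : (\int[mu]_(x in `[a_ n, b_ n]) (f x)%:E = (F (b_ n))%:E - (F (a_ n))%:E)%E.
Proof.
have cF x : D x -> {for x, continuous F}.
  by move=> Dx; apply/differentiable_continuous/derivable1_diffP; have [] := dF Dx.
apply: continuous_FTC2 => //.
- by apply: continuous_in_subspaceT => x; rewrite inE => /sub; exact: cf.
- split.
  + move=> x xab; have Dx : D x by apply: (sub (n := n)); exact: subset_itv_oo_cc.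
    by have [] := dF Dx.
  + apply: cvg_at_right_filter; apply: cF; apply: (sub (n := n)).
    by rewrite /= in_itv/= lexx/= ltW.
  + apply: cvg_at_left_filter; apply: cF; apply: (sub (n := n)).
    by rewrite /= in_itv/= lexx/= ltW.
- move=> x xab; have Dx : D x by apply: (sub (n := n)); exact: subset_itv_oo_cc.
  by rewrite derive1E; have [_ ->] := dF Dx.
Qed.

Let cvgF : F (b_ n) - F (a_ n) @[n --> \oo] --> lb - la.
Proof. exact: cvgB. Qed.

(** Positivity yields integrability as well, by monotone convergence along the compact intervals.
    The signed version below assumes integrability and uses dominated convergence. *)
Lemma ge0_FTC_exhaustion : (forall x, D x -> 0 <= f x) ->
  mu.-integrable D (EFin \o f) /\ \int[mu]_(x in D) f x = lb - la.
Proof.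
move=> f0.
have ndab : nondecreasing_seq (fun n => `[a_ n, b_ n]%classic).
  move=> m n mn; apply/subsetPset => x /=; rewrite !in_itv/= => /andP[ax xb].
  by rewrite (le_trans (nia mn))//= (le_trans xb)// ndb.
have H : (\int[mu]_(x in D) (f x)%:E = (lb - la)%:E)%E.
  have {}H : (\int[mu]_(x in `[a_ n, b_ n]) (f x)%:E @[n --> \oo] -->
      \int[mu]_(x in D) (f x)%:E)%E.
    rewrite DE; apply: (@ge0_nondecreasing_set_cvg_integral _ _ R) => //.
      move=> n; apply/measurable_EFinP; apply: measurable_funS mf => //.
    by move=> n x /sub Dx; rewrite lee_fin f0.
  rewrite -(cvg_lim _ H)//; apply/cvg_lim => //.
  under eq_fun do rewrite FTCn -EFinB.
  by apply: cvg_EFin; [exact: nearW|exact: cvgF].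
split; last by rewrite /Rintegral H.
apply/integrableP; split; first exact/measurable_EFinP.
under eq_integral => x xD.
  rewrite /= ger0_norm; last by apply: f0; move: xD; rewrite inE.
  over.
by rewrite H ltry.
Qed.

Lemma FTC_exhaustion : mu.-integrable D (EFin \o f) -> \int[mu]_(x in D) f x = lb - la.
Proof.
move=> fi; rewrite Rintegral_mkcond.
have fi' : mu.-integrable setT (EFin \o (f \_ D)).
  by rewrite -restrict_EFin; apply/(@integrable_mkcond _ (measurableTypeR R) _ _ _ _ mD).
have [||||_] := @Rintegral_dominated _ (measurableTypeR R) R mu (fun n => f \_ `[a_ n, b_ n]) (f \_ D)
  (fun x => `|(f \_ D) x|).
- move=> n; apply/measurable_restrict => //.
  by rewrite setTI; apply: measurable_funS mf => //; exact: sub.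
- move=> x; rewrite !patchE; case: ifPn; rewrite ?notin_setE ?inE => Dx.
    move: (Dx); rewrite {1}DE => -[N _ xN].
    apply: cvg_near_cst; exists N => // n /= Nn; rewrite patchE mem_set//=.
    move: xN; rewrite /= !in_itv/= => /andP[ax xb].
    by rewrite (le_trans (nia Nn))//= (le_trans xb)// ndb.
  apply: cvg_near_cst; apply: nearW => n; rewrite patchE memNset//.
  by move/sub.
- exact: (integrable_norm fi').
- move=> n x /=; rewrite !patchE; case: ifPn; rewrite ?inE.
    by move/sub => Dx; rewrite mem_set.
  by rewrite normr0.
move=> H; rewrite -(cvg_lim _ H)//; apply/cvg_lim => //.
apply: cvg_trans cvgF; apply: near_eq_cvg; apply: nearW => n.
by rewrite -Rintegral_mkcond /Rintegral FTCn -EFinB.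
Qed.

End FTC_exhaustion.

Section half_lines.
Context {R : realType}.
Local Notation mu := (@lebesgue_measure R).
Implicit Types (f F : R -> R) (x : R).

Definition invS (n : nat) : R := n.+1%:R^-1.

Lemma invS_gt0 n : 0 < invS n. Proof. by rewrite invr_gt0. Qed.

(** The right endpoints are [n.+2] rather than [n.+1] because [invS 0 = 1]: already the first
    interval has to be nondegenerate. *)
Lemma invS_lt n : invS n < n.+2%:R.
Proof.
by rewrite (@le_lt_trans _ _ 1)// ?ltr1n// invf_le1// ler1n.
Qed.

Lemma invS_decr m n : (m <= n)%N -> invS n <= invS m.
Proof. by move=> mn; rewrite lef_pV2 ?posrE// ler_nat. Qed.

Lemma cvg_invS : invS n @[n --> \oo] --> 0.
Proof. exact: cvg_harmonic. Qed.

Lemma bigcup_pos : `]0, +oo[%classic = \bigcup_n `[invS n, n.+2%:R]%classic :> set R.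
Proof.
apply/seteqP; split => x /=; rewrite in_itv/= ?andbT; last first.
  by move=> [n _] /=; rewrite in_itv/= => /andP[+ _]; apply: lt_le_trans; exact: invS_gt0.
move=> x0; exists (maxn (Num.bound x) (Num.bound x^-1)) => //=.
rewrite in_itv/=; apply/andP; split.
  rewrite /invS -[leRHS]invrK lef_pV2 ?posrE ?invr_gt0//.
  have := archi_boundP (ltW (_ : 0 < x^-1)).
  rewrite invr_gt0 => /(_ x0)/ltW/le_trans; apply.
  by rewrite ler_nat ltnW// ltnS leq_maxr.
rewrite (le_trans (ltW (archi_boundP (ltW x0))))// ler_nat.
by rewrite -addn2 (leq_trans (leq_maxl _ (Num.bound x^-1)))// leq_addr.
Qed.

Lemma bigcup_neg :
  `]-oo, 0[%classic = \bigcup_n `[- n.+2%:R, - invS n]%classic :> set R.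
Proof.
have E := bigcup_pos.
apply/seteqP; split => x /= xx.
  have : `]0, +oo[%classic (- x) by move: xx; rewrite /= !in_itv/= andbT oppr_gt0.
  rewrite E => -[n _]; rewrite /= in_itv/= => /andP[a b]; exists n => //=.
  by rewrite in_itv/= lerNl b/= lerNr.
move: xx => [n _]; rewrite /= !in_itv/= => /andP[_ /le_lt_trans]; apply.
by rewrite oppr_lt0 invS_gt0.
Qed.

Lemma bigcup_T : setT = \bigcup_n `[- n.+2%:R, n.+2%:R]%classic :> set R.
Proof.
apply/seteqP; split => // x _; exists (Num.bound `|x|) => //=.
rewrite in_itv/= -ler_norml (le_trans (ltW (archi_boundP _)))// ler_nat.
by rewrite -addn2 leq_addr.
Qed.

Lemma open_pos : open (`]0, +oo[%classic : set R).
Proof. by rewrite set_itvE; exact: open_gt. Qed.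

Lemma open_neg : open (`]-oo, 0[%classic : set R).
Proof. by rewrite set_itvE; exact: open_lt. Qed.

Lemma FTC_pos f F la lb :
  (forall x, 0 < x -> {for x, continuous f}) ->
  (forall x, 0 < x -> is_derive x (1 : R) F (f x)) ->
  F (invS n) @[n --> \oo] --> la -> F n.+2%:R @[n --> \oo] --> lb ->
  ((forall x, 0 < x -> 0 <= f x) -> mu.-integrable `]0, +oo[ (EFin \o f)) /\
  (mu.-integrable `]0, +oo[ (EFin \o f) -> \int[mu]_(x in `]0, +oo[) f x = lb - la).
Proof.
have I x : `]0, +oo[%classic x -> 0 < x by rewrite /= in_itv/= andbT.
have ndb m n : (m <= n)%N -> m.+2%:R <= n.+2%:R :> R by rewrite ler_nat !ltnS.
move=> cf dF Fa Fb; split.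
  move=> f0; have [|? _] := ge0_FTC_exhaustion open_pos invS_lt invS_decr ndb
    bigcup_pos (fun x Dx => cf x (I x Dx)) (fun x Dx => dF x (I x Dx)) Fa Fb; last by [].
  by move=> x /I; exact: f0.
by move=> fi; apply: (FTC_exhaustion open_pos invS_lt invS_decr ndb
    bigcup_pos (fun x Dx => cf x (I x Dx)) (fun x Dx => dF x (I x Dx)) Fa Fb fi).
Qed.

Lemma FTC_neg f F la lb :
  (forall x, x < 0 -> {for x, continuous f}) ->
  (forall x, x < 0 -> is_derive x (1 : R) F (f x)) ->
  F (- invS n) @[n --> \oo] --> lb -> F (- n.+2%:R) @[n --> \oo] --> la ->
  ((forall x, x < 0 -> 0 <= f x) -> mu.-integrable `]-oo, 0[ (EFin \o f)) /\
  (mu.-integrable `]-oo, 0[ (EFin \o f) -> \int[mu]_(x in `]-oo, 0[) f x = lb - la).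
Proof.
have I x : `]-oo, 0[%classic x -> x < 0 by rewrite /= in_itv/=.
have ab n : - n.+2%:R < - invS n by rewrite ltrN2 invS_lt.
have ndb m n : (m <= n)%N -> - n.+2%:R <= - m.+2%:R :> R.
  by rewrite lerN2 ler_nat !ltnS.
have nda m n : (m <= n)%N -> - invS m <= - invS n.
  by rewrite lerN2; exact: invS_decr.
move=> cf dF Fa Fb; split.
  move=> f0; have [|? _] := ge0_FTC_exhaustion open_neg ab ndb nda
    bigcup_neg (fun x Dx => cf x (I x Dx)) (fun x Dx => dF x (I x Dx)) Fb Fa; last by [].
  by move=> x /I; exact: f0.
by move=> fi; apply: (FTC_exhaustion open_neg ab ndb nda
    bigcup_neg (fun x Dx => cf x (I x Dx)) (fun x Dx => dF x (I x Dx)) Fb Fa fi).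
Qed.

Lemma FTC_T f F la lb : continuous f -> (forall x, is_derive x (1 : R) F (f x)) ->
  F (- n.+2%:R) @[n --> \oo] --> la -> F n.+2%:R @[n --> \oo] --> lb ->
  ((forall x, 0 <= f x) -> mu.-integrable setT (EFin \o f)) /\
  (mu.-integrable setT (EFin \o f) -> \int[mu]_x f x = lb - la).
Proof.
have ab n : - n.+2%:R < n.+2%:R :> R by rewrite (@lt_trans _ _ 0)// oppr_lt0.
have ndb m n : (m <= n)%N -> - n.+2%:R <= - m.+2%:R :> R.
  by rewrite lerN2 ler_nat !ltnS.
have nda m n : (m <= n)%N -> m.+2%:R <= n.+2%:R :> R by rewrite ler_nat !ltnS.
move=> cf dF Fa Fb; split.
  by move=> f0; have [] := ge0_FTC_exhaustion openT ab ndb nda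
    bigcup_T (fun x _ => cf x) (fun x _ => dF x) Fa Fb.
by move=> fi; apply: (FTC_exhaustion openT ab ndb nda
    bigcup_T (fun x _ => cf x) (fun x _ => dF x) Fa Fb fi).
Qed.

Lemma setT_split : [set: R] = `]-oo, 0[%classic `|` `[0, +oo[%classic.
Proof.
apply/seteqP; split => // x _; rewrite /= !in_itv/= andbT.
by case: (ltP x 0) => ?; [left|right].
Qed.

Lemma disj_split : [disjoint (`]-oo, 0[%classic : set R) & `[0, +oo[%classic].
Proof.
apply/disj_setPS => x [] /=; rewrite !in_itv/= andbT => x0 /(lt_le_trans x0).
by rewrite ltxx.
Qed.

Lemma integrable_split f : measurable_fun setT f ->
  mu.-integrable `]-oo, 0[ (EFin \o f) -> mu.-integrable `]0, +oo[ (EFin \o f) ->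
  mu.-integrable setT (EFin \o f) /\
  \int[mu]_x f x = \int[mu]_(x in `]-oo, 0[) f x + \int[mu]_(x in `]0, +oo[) f x.
Proof.
move=> mf fN fP.
have mfn (A : set (measurableTypeR R)) :
    measurable_fun A (EFin \o (fun x : measurableTypeR R => `|f x|)).
  apply/measurable_EFinP; apply: measurableT_comp => //.
  exact: (@measurable_funTS _ _ (measurableTypeR R) _ _ _ mf).
have fi : mu.-integrable setT (EFin \o f).
  apply/integrableP; split; first exact/measurable_EFinP.
  rewrite setT_split ge0_integral_setU//=; last exact: disj_split.
  rewrite -(integral_itv_obnd_cbnd (mfn _)).
  by apply: lte_add_pinfty; [case/integrableP : fN|case/integrableP : fP].
split => //; rewrite setT_split Rintegral_setU//; last 2 first.
  by rewrite -setT_split.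
  exact: disj_split.
rewrite -[in X in _ + X = _]Rintegral_itv_obnd_cbnd//.
Qed.

End half_lines.

(** * The transform pair of exp(- delta |x|) and the Poisson kernel *)

Section exponential_kernel.
Context {R : realType}.
Local Notation mu := (@lebesgue_measure R).
Implicit Types (a p q z t x delta : R).

Lemma eq_integrable_itv (i : interval R) (f g : R -> R) :
  {in [set` i], f =1 g} -> mu.-integrable [set` i] (EFin \o g) ->
  mu.-integrable [set` i] (EFin \o f).
Proof.
move=> fg; apply: (@eq_integrable _ (measurableTypeR R)) => //.
by move=> x xi; rewrite /= fg.
Qed.

Lemma eq_Rintegral_itv (i : interval R) (f g : R -> R) :
  {in [set` i], f =1 g} ->
  \int[mu]_(x in [set` i]) f x = \int[mu]_(x in [set` i]) g x.
Proof. by move=> fg; exact: (@eq_Rintegral _ (measurableTypeR R)). Qed.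

Lemma cvg0_squeeze (u v : nat -> R) : (forall n, `|u n| <= v n) ->
  v n @[n --> \oo] --> 0 -> u n @[n --> \oo] --> 0.
Proof.
move=> uv v0; apply/norm_cvg0P.
apply: (squeeze_cvgr _ (cvg_cst _) v0).
by apply: nearW => n; rewrite normr_ge0 uv.
Qed.

Lemma cvg_expRN delta : 0 < delta -> expR (- (delta * n.+2%:R)) @[n --> \oo] --> 0.
Proof.
move=> d0; apply: (@cvg0_squeeze _ (fun n => expR (- delta) ^+ n)).
  move=> n; rewrite ger0_norm ?expR_ge0// -mulNr expRM_natr.
  rewrite -addn2 exprD ler_piMr ?exprn_ge0 ?expR_ge0// exprn_ile1 ?expR_ge0//.
  by rewrite -expR0 ler_expR oppr_le0 ltW.
apply: cvg_expr; rewrite ger0_norm ?expR_ge0//.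
by rewrite -expR0 ltr_expR oppr_lt0.
Qed.

Lemma is_derive_lin a x : is_derive x (1 : R) (fun t => a * t) a.
Proof.
apply: (is_derive_eqd (is_derive_funM (is_derive_const a x) (is_derive_idfun x))).
by rewrite mulr1 mulr0 addr0.
Qed.

Lemma is_derive_continuous (f : R -> R) x d : is_derive x (1 : R) f d ->
  {for x, continuous f}.
Proof. by move=> [df _]; exact/differentiable_continuous/derivable1_diffP. Qed.

(** For fixed [a] and [z] this family is closed under differentiation, so finding an antiderivative
    means solving a 2 x 2 linear system for [p] and [q]. *)
Definition trigexp a p q z t := expR (a * t) * (p * sin (z * t) + q * cos (z * t)).

Lemma is_derive_trigexp a p q z x : is_derive x (1 : R) (trigexp a p q z)
  (trigexp a (a * p - z * q) (a * q + z * p) z x).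
Proof.
have De := is_derive_chain (is_derive_expR (a * x)) (is_derive_lin a x).
have Ds := is_derive_chain (is_derive_sin (z * x)) (is_derive_lin z x).
have Dc := is_derive_chain (is_derive_cos (z * x)) (is_derive_lin z x).
apply: (is_derive_eqd (is_derive_funM De (is_derive_funD
  (is_derive_funM (is_derive_const p x) Ds) (is_derive_funM (is_derive_const q x) Dc)))).
by rewrite /trigexp /cst; ring.
Qed.

Lemma trigexp_continuous a p q z : continuous (trigexp a p q z).
Proof. by move=> x; apply: is_derive_continuous; exact: is_derive_trigexp. Qed.

Lemma trigexp_le a p q z t : `|trigexp a p q z t| <= (`|p| + `|q|) * expR (a * t).
Proof.
rewrite normrM ger0_norm ?expR_ge0// mulrC ler_wpM2r ?expR_ge0//.
rewrite (le_trans (ler_normD _ _))// lerD// normrM ler_piMr// ler_norml.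
  by rewrite sin_geN1 sin_le1.
by rewrite cos_geN1 cos_le1.
Qed.

Lemma trigexp0 a p q z : trigexp a p q z 0 = q.
Proof. by rewrite /trigexp !mulr0 expR0 sin0 cos0 mulr0 add0r mulr1 mul1r. Qed.

Lemma cvg_at0 (F : R -> R) : {for 0, continuous F} ->
  F (invS n) @[n --> \oo] --> F 0 /\ F (- invS n) @[n --> \oo] --> F 0.
Proof.
move=> cF; split; first exact: (cvg_comp _ _ cvg_invS cF).
have cN : - invS n @[n --> \oo] --> (0 : R).
  by rewrite -[X in _ --> X]oppr0; apply: cvgN; exact: cvg_invS.
exact: (cvg_comp _ _ cN cF).
Qed.

Lemma trigexp_pos delta p q z : 0 < delta ->
  let f := trigexp (- delta) (- delta * p - z * q) (- delta * q + z * p) z in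
  ((forall x, 0 < x -> 0 <= f x) -> mu.-integrable `]0, +oo[ (EFin \o f)) /\
  (mu.-integrable `]0, +oo[ (EFin \o f) -> \int[mu]_(x in `]0, +oo[) f x = - q).
Proof.
move=> d0 f; rewrite -[- q]add0r.
apply: (@FTC_pos _ _ (trigexp (- delta) p q z)).
- by move=> x _; exact: trigexp_continuous.
- by move=> x _; exact: is_derive_trigexp.
- have [+ _] := @cvg_at0 (trigexp (- delta) p q z) (@trigexp_continuous _ _ _ _ 0).
  by rewrite trigexp0.
- apply: (@cvg0_squeeze _ (fun n => (`|p| + `|q|) * expR (- (delta * n.+2%:R)))).
    by move=> n; rewrite (le_trans (trigexp_le _ _ _ _ _))// mulNr.
  by rewrite -[X in _ --> X](mulr0 (`|p| + `|q|)); apply: cvgMl_tmp => //; exact: cvg_expRN.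
Qed.

Lemma trigexp_neg delta p q z : 0 < delta ->
  let f := trigexp delta (delta * p - z * q) (delta * q + z * p) z in
  ((forall x, x < 0 -> 0 <= f x) -> mu.-integrable `]-oo, 0[ (EFin \o f)) /\
  (mu.-integrable `]-oo, 0[ (EFin \o f) -> \int[mu]_(x in `]-oo, 0[) f x = q).
Proof.
move=> d0 f; rewrite -[X in _ = X]subr0.
apply: (@FTC_neg _ _ (trigexp delta p q z)).
- by move=> x _; exact: trigexp_continuous.
- by move=> x _; exact: is_derive_trigexp.
- have [_ +] := @cvg_at0 (trigexp delta p q z) (@trigexp_continuous _ _ _ _ 0).
  by rewrite trigexp0.
- apply: (@cvg0_squeeze _ (fun n => (`|p| + `|q|) * expR (- (delta * n.+2%:R)))).
    by move=> n; rewrite (le_trans (trigexp_le _ _ _ _ _))// mulrN.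
  by rewrite -[X in _ --> X](mulr0 (`|p| + `|q|)); apply: cvgMl_tmp => //; exact: cvg_expRN.
Qed.

Definition kexp delta x : R := expR (- (delta * `|x|)).

Lemma kexp_ge0 delta x : 0 <= kexp delta x. Proof. exact: expR_ge0. Qed.

Lemma kexp_le1 delta x : 0 < delta -> kexp delta x <= 1.
Proof. by move=> d0; rewrite -expR0 ler_expR oppr_le0 mulr_ge0// ltW. Qed.

Lemma kexp_measurable delta : measurable_fun setT (kexp delta).
Proof.
apply: measurableT_comp => //; apply: measurableT_comp => //.
by apply: measurable_funM => //; exact: measurableT_comp.
Qed.

Lemma kexp_posE delta x : 0 < x -> kexp delta x = trigexp (- delta) 0 1 0 x.
Proof.
move=> x0; rewrite /kexp /trigexp gtr0_norm// !mul0r cos0 add0r !mulr1.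
by rewrite mulNr.
Qed.

Lemma kexp_negE delta x : x < 0 -> kexp delta x = trigexp delta 0 1 0 x.
Proof.
move=> x0; rewrite /kexp /trigexp ltr0_norm// !mul0r cos0 add0r !mulr1.
by rewrite mulrN opprK.
Qed.

Lemma kexp_integrable delta : 0 < delta -> mu.-integrable setT (EFin \o kexp delta).
Proof.
move=> d0; have dn0 : delta != 0 by rewrite gt_eqF.
apply: (@integrable_split _ _ (kexp_measurable delta) _ _).1.
- apply: (@eq_integrable_itv _ _ (trigexp delta 0 1 0)).
    by move=> x; rewrite inE/= in_itv/= => x0; rewrite kexp_negE.
  have [+ _] := @trigexp_neg delta 0 delta^-1 0 d0.
  rewrite mulr0 mul0r mulfV// subr0 mul0r addr0; apply.
  by move=> x x0; rewrite -kexp_negE// kexp_ge0.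
- apply: (@eq_integrable_itv _ _ (trigexp (- delta) 0 1 0)).
    by move=> x; rewrite inE/= in_itv/= andbT => x0; rewrite kexp_posE.
  have [+ _] := @trigexp_pos delta 0 (- delta^-1) 0 d0.
  rewrite mulr0 mul0r mulrNN mulfV// subr0 mul0r addr0; apply.
  by move=> x x0; rewrite -kexp_posE// kexp_ge0.
Qed.

(** This is 2 pi times the Poisson kernel of the half-plane, whence the total mass 2 pi. *)
Definition poisson delta x := 2 * delta / (delta ^+ 2 + x ^+ 2).

Lemma kexp_fourier delta z : 0 < delta ->
  cintegrable mu (fun x => (kexp delta x)%:C * cexpi (z * x)) /\
  cintegral mu (fun x => (kexp delta x)%:C * cexpi (z * x)) = (poisson delta z)%:C.
Proof.
move=> d0; have n0 : delta ^+ 2 + z ^+ 2 != 0.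
  by rewrite gt_eqF// ltr_pwDl ?sqr_ge0// exprn_gt0.
have mz : measurable_fun setT (fun x : measurableTypeR R => z * x).
  exact: measurable_funM.
have ci : cintegrable mu (fun x => (kexp delta x)%:C * cexpi (z * x)).
  apply: (@cintegrable_le _ (measurableTypeR R) R mu _ (kexp delta)); last exact: kexp_integrable.
    apply: cmeasurableM; last exact: cmeasurable_expi.
    exact: (cmeasurable_real (kexp_measurable delta)).
  by move=> x; rewrite cabsM cabs_expi mulr1 cabs_real ger0_norm ?kexp_ge0.
split => //; have [iR iI] := ci; rewrite /cintegral.
have mR := integrable_measurable iR; have mI := integrable_measurable iI.
have sub (D : set (measurableTypeR R)) (f : R -> R) : measurable D ->
    mu.-integrable setT (EFin \o f) -> mu.-integrable D (EFin \o f).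
  by move=> mD; exact: integrableS.
have mN : measurable (`]-oo, 0[%classic : set (measurableTypeR R)) by exact: measurable_itv.
have mP : measurable (`]0, +oo[%classic : set (measurableTypeR R)) by exact: measurable_itv.
(* Only the values at 0 survive: there the two antiderivatives equal [q] and [q'], and they vanish
   at infinity. *)
have E (f : R -> R) p q p' q' : mu.-integrable setT (EFin \o f) ->
    (forall x, x < 0 -> f x = trigexp delta (delta * p - z * q) (delta * q + z * p) z x) ->
    (forall x, 0 < x -> f x = trigexp (- delta) (- delta * p' - z * q') (- delta * q' + z * p') z x) ->
    \int[mu]_x f x = q - q'.
  move=> fi fN fP; have mf := integrable_measurable fi.
  have [_ ->] := integrable_split mf (sub _ _ mN fi) (sub _ _ mP fi).
  have EN : {in (`]-oo, 0[%classic : set R), f =1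
      trigexp delta (delta * p - z * q) (delta * q + z * p) z}.
    by move=> x; rewrite inE/= in_itv/=; exact: fN.
  have EP : {in (`]0, +oo[%classic : set R), f =1
      trigexp (- delta) (- delta * p' - z * q') (- delta * q' + z * p') z}.
    by move=> x; rewrite inE/= in_itv/= andbT; exact: fP.
  rewrite (eq_Rintegral_itv EN) (eq_Rintegral_itv EP).
  rewrite (trigexp_neg p q z d0).2 ?(trigexp_pos p' q' z d0).2//.
    by apply: eq_integrable_itv (sub _ _ mP fi) => x xD; rewrite EP.
  by apply: eq_integrable_itv (sub _ _ mN fi) => x xD; rewrite EN.
have posE x : 0 < x -> kexp delta x = expR (- delta * x).
  by move=> x0; rewrite /kexp gtr0_norm// mulNr.
have negE x : x < 0 -> kexp delta x = expR (delta * x).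
  by move=> x0; rewrite /kexp ltr0_norm// mulrN opprK.
apply: eq_c => /=.
(* The first two numbers solve [delta * p - z * q = 0] and [delta * q + z * p = 1], the last two the
   same system with [- delta]. For the imaginary part the right-hand sides are 1 and 0. *)
- rewrite (@E _ (z / (delta ^+ 2 + z ^+ 2)) (delta / (delta ^+ 2 + z ^+ 2))
     (z / (delta ^+ 2 + z ^+ 2)) (- delta / (delta ^+ 2 + z ^+ 2)) iR).
  + by rewrite /poisson; field.
  + move=> x x0; rewrite ReM/= negE// mul0r subr0 /trigexp; congr (_ * _).
    by field.
  + move=> x x0; rewrite ReM/= posE// mul0r subr0 /trigexp; congr (_ * _).
    by field.
- rewrite (@E _ (delta / (delta ^+ 2 + z ^+ 2)) (- z / (delta ^+ 2 + z ^+ 2))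
     (- delta / (delta ^+ 2 + z ^+ 2)) (- z / (delta ^+ 2 + z ^+ 2)) iI).
  + by rewrite subrr.
  + move=> x x0; rewrite ImM/= negE// mul0r addr0 /trigexp; congr (_ * _).
    by field.
  + move=> x x0; rewrite ImM/= posE// mul0r addr0 /trigexp; congr (_ * _).
    by field.
Qed.

Lemma poisson_ge0 delta x : 0 < delta -> 0 <= poisson delta x.
Proof.
by move=> d0; rewrite /poisson divr_ge0 ?mulr_ge0 ?addr_ge0 ?sqr_ge0 ?(ltW d0).
Qed.

Lemma poisson_le delta x : 0 < delta -> poisson delta x <= 2 / delta.
Proof.
move=> d0; rewrite /poisson ler_pdivrMr ?ltr_pwDl ?sqr_ge0 ?exprn_gt0//.
have -> : 2 / delta * (delta ^+ 2 + x ^+ 2) = 2 * delta + 2 * x ^+ 2 / delta.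
  by field; rewrite gt_eqF.
by rewrite lerDl; apply: divr_ge0; [apply: mulr_ge0 => //; exact: sqr_ge0|exact: ltW].
Qed.

Lemma poissonN delta x : poisson delta (- x) = poisson delta x.
Proof. by rewrite /poisson sqrrN. Qed.

Lemma poisson_integral delta a : 0 < delta ->
  mu.-integrable setT (EFin \o (fun y => poisson delta (a - y))) /\
  \int[mu]_y poisson delta (a - y) = 2 * pi.
Proof.
move=> d0; have dn0 : delta != 0 by rewrite gt_eqF.
have dF x : is_derive x (1 : R) (fun y => 2 * atan (delta^-1 * (y - a)))
    (poisson delta (a - x)).
  have D0 : is_derive x (1 : R) (fun y : R => delta^-1 * (y - a)) (delta^-1).
    apply: (is_derive_eqd (is_derive_chain (is_derive_lin _ _)
      (is_derive_funB (is_derive_idfun x) (is_derive_const a x)))).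
    by rewrite subr0 mulr1.
  apply: (is_derive_eqd (is_derive_chain (is_derive_lin 2 _)
    (is_derive_chain (is_derive1_atan _) D0))).
  have -> : 1 + (delta^-1 * (x - a)) ^+ 2 = (delta ^+ 2 + (a - x) ^+ 2) / delta ^+ 2 by field.
  by rewrite /poisson; field; rewrite dn0 gt_eqF// ltr_pwDl ?sqr_ge0// exprn_gt0.
have cp : continuous (fun y => poisson delta (a - y)).
  move=> y; rewrite /poisson; apply: cvgM; first exact: cvg_cst.
  apply: cvgV; first by rewrite gt_eqF// ltr_pwDl ?sqr_ge0// exprn_gt0.
  apply: cvgD; first exact: cvg_cst.
  apply: (@cvg_comp _ _ _ (fun y => a - y) (fun y => y ^+ 2)); last exact: exprn_continuous.
  by apply: cvgB; [exact: cvg_cst|exact: cvg_id].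
have lim b : 2 * atan (delta^-1 * (n.+2%:R - b)) @[n --> \oo] --> pi.
  have -> : pi = 2 * (pi / 2) :> R by field.
  have Hy : delta^-1 * (n.+2%:R - b) @[n --> \oo] --> +oo.
    apply/cvgryPge => A; near=> n.
    rewrite mulrC ler_pdivlMr// lerBrDr.
    rewrite (@le_trans _ _ n%:R)//; last by rewrite ler_nat -addn2 leq_addr.
    by near: n; exact: nbhs_infty_ger.
  by apply: cvgMl_tmp; exact: (cvg_comp _ _ Hy (@cvgy_atan R)).
have limN : 2 * atan (delta^-1 * (- n.+2%:R - a)) @[n --> \oo] --> - pi.
  have -> : (fun n => 2 * atan (delta^-1 * (- n.+2%:R - a))) =
      (fun n => - (2 * atan (delta^-1 * (n.+2%:R - (- a))))).
    by apply/funext => n; rewrite -mulrN -atanN -mulrN opprB addrC.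
  by apply: cvgN; exact: lim.
have [i1 i2] := FTC_T cp dF limN (lim a).
have {}i1 : mu.-integrable setT (EFin \o (fun y => poisson delta (a - y))).
  by apply: i1 => x; exact: poisson_ge0.
by split => //; rewrite i2//; ring.
Unshelve. all: by end_near. Qed.

End exponential_kernel.

(** * Laplace inversion of the Gamma integral *)

Section gamma_integral.
Context {R : realType}.
Local Notation mu := (@lebesgue_measure R).
Implicit Types (w t p q om : R).

Lemma powR_expln t w : 0 < t -> t `^ w = expR (w * ln t).
Proof. by move=> t0; rewrite /powR gt_eqF. Qed.

Lemma invS_at_right : invS n @[n --> \oo] --> (0 : R)^'+.
Proof.
move=> P [e /= e0 He]; have /cvgrPdist_lt/(_ _ e0) H := @cvg_invS R.
apply: (@filterS _ _ _ (fun n => `|0 - invS n : R| < e)) H => n Hn.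
by apply: He => //; exact: invS_gt0.
Qed.

Lemma cvg_invS_powR w : 0 < w -> (invS n : R) `^ w @[n --> \oo] --> 0.
Proof. by move=> w0; exact: (cvg_comp _ _ invS_at_right (powR_cvg0 w0)). Qed.

Definition gam w t : R := if 0 < t then t `^ (w - 1) * expR (- t) else 0.

Lemma gam_ge0 w t : 0 <= gam w t.
Proof. by rewrite /gam; case: ifP => // _; rewrite mulr_ge0 ?powR_ge0 ?expR_ge0. Qed.

Lemma gam_patch w : gam w = (fun t => t `^ (w - 1) * expR (- t)) \_ `]0, +oo[.
Proof.
apply/funext => t; rewrite patchE /gam; case: ifPn => t0.
  by rewrite mem_set//= in_itv/= t0.
by rewrite memNset//= in_itv/= andbT; exact/negP.
Qed.

Lemma gam_measurable w : measurable_fun setT (gam w).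
Proof.
rewrite gam_patch; apply/(measurable_restrict _ _ measurableT) => //.
rewrite setTI; apply: measurable_funTS; apply: measurable_funM.
  exact: measurable_powR.
by apply: measurableT_comp => //; exact: measurableT_comp.
Qed.

Lemma GammaE w : Gamma w = \int[mu]_t gam w t.
Proof. by rewrite gam_patch -Rintegral_mkcond. Qed.

Let h t := t / (1 + t).

(** The integrand is dominated by a multiple of the derivative of (t / (1 + t))^w. That derivative
    is nonnegative, and integrable because the power increases from 0 to 1. *)
Lemma gam_integrable w : 0 < w -> mu.-integrable setT (EFin \o gam w).
Proof.
move=> w0.
pose f t := w * h t `^ (w - 1) * (1 + t) ^- 2.
have h0 t : 0 < t -> 0 < h t by move=> t0; rewrite divr_gt0// addr_gt0.
have p0 t : 0 < t -> 0 < 1 + t by move=> t0; rewrite addr_gt0.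
have dh t : 0 < t -> is_derive t (1 : R) h ((1 + t) ^- 2).
  move=> t0; have n0 : 1 + t != 0 by rewrite gt_eqF// p0.
  have D1 := is_derive_funD (is_derive_const 1 t) (is_derive_idfun t).
  apply: (is_derive_eqd (is_derive_funM (is_derive_idfun t)
    (@is_deriveV R (fun t => 1 + t) t _ 1 n0 D1))).
  by rewrite /GRing.scale/=; field.
have dp a t : 0 < t -> is_derive t (1 : R) (fun t => h t `^ a)
    (a * h t `^ (a - 1) * (1 + t) ^- 2).
  by move=> t0; exact: (is_derive_chain (is_derive1_powR a (h0 _ t0)) (dh _ t0)).
have fi : mu.-integrable `]0, +oo[ (EFin \o f).
  apply: (@FTC_pos R f (fun t => h t `^ w) 0 1 _ (dp w) _ _).1.
  - move=> t t0; apply: is_derive_continuous.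
    have n0 : (1 + t) ^+ 2 != 0 by rewrite expf_neq0// gt_eqF// p0.
    have D1 := is_derive_funD (is_derive_const 1 t) (is_derive_idfun t).
    have D2 := is_derive_funM D1 D1.
    exact: (is_derive_funM (is_derive_funM (is_derive_const w t) (dp _ _ t0))
      (@is_deriveV R (fun t => (1 + t) ^+ 2) t _ 1 n0 D2)).
  - have -> : (fun n => h (invS n) `^ w) = (fun n => invS n.+1 `^ w).
      apply/funext => n; congr (_ `^ _); rewrite /h /invS -[n.+2%:R]nat1r.
      have : 0 < n.+1%:R :> R by []; move: (n.+1%:R : R) => b b0.
      by field; do ?[apply/andP; split]; apply: lt0r_neq0; lra.
    by have := cvg_invS_powR w0; rewrite -cvg_shiftS.
  - have -> : (fun n => h n.+2%:R `^ w) = (fun n => (1 - invS n.+2) `^ w).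
      apply/funext => n; congr (_ `^ _); rewrite /h /invS -[n.+3%:R]nat1r.
      have : 0 < n.+2%:R :> R by []; move: (n.+2%:R : R) => b b0.
      by field; do ?[apply/andP; split]; apply: lt0r_neq0; lra.
    have H1 : 1 - invS n.+2 @[n --> \oo] --> (1 : R).
      rewrite -[X in _ --> X]subr0; apply: cvgB; first exact: cvg_cst.
      have := @cvg_invS R; rewrite -cvg_shiftS => H.
      by rewrite -(cvg_shiftS (fun n => invS n.+1)) in H.
    have := is_derive_continuous (is_derive1_powR w (@ltr01 R)).
    move=> H2; have := cvg_comp _ _ H1 H2.
    by rewrite powR1.
  - move=> t t0; rewrite /f !mulr_ge0 ?powR_ge0 ?invr_ge0 ?exprn_ge0 ?(ltW w0)//.
    exact/ltW/p0.
(* From ln y <= y - 1 at y = (1 + t) / (w + 1), which bounds e^(-t) by a constant times (1 + t)^(- w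
   - 1). *)
pose C := w^-1 * expR ((w + 1) * ln (w + 1) + 1 - (w + 1)).
have Cfi : mu.-integrable `]0, +oo[ (EFin \o (fun t => C * f t)).
  exact: (@integrableZl _ (measurableTypeR R) _ mu _ _ C _ fi).
apply: (@integrable_le _ (measurableTypeR R) R mu _ ((fun t => C * f t) \_ `]0, +oo[)).
- exact: gam_measurable.
- move=> t; rewrite patchE /gam; case: ifPn => t0; last first.
    by rewrite memNset ?normr0//= in_itv/= andbT; exact/negP.
  rewrite mem_set/=; last by rewrite in_itv/= t0.
  rewrite ger0_norm ?mulr_ge0 ?powR_ge0 ?expR_ge0//.
  have wp : 0 < w + 1 by rewrite addr_gt0.
  have e2 : (1 + t) ^- 2 = expR (- (2 * ln (1 + t))).
    by rewrite expRN mulrC expRM_natr lnK// posrE p0.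
  have -> : C * f t = expR ((w + 1) * ln (w + 1) + 1 - (w + 1) +
      (w - 1) * (ln t - ln (1 + t)) - 2 * ln (1 + t)).
    rewrite /C /f e2 powR_expln ?h0// /h lnM ?posrE ?invr_gt0 ?p0// lnV ?posrE ?p0//.
    rewrite [in RHS]expRD [X in _ = X * _]expRD; field.
    by rewrite gt_eqF.
  rewrite powR_expln// -expRD ler_expR.
  have : ln ((1 + t) / (w + 1)) <= (1 + t) / (w + 1) - 1.
    have := @le_ln1Dx R ((1 + t) / (w + 1) - 1).
    rewrite subrKC; apply.
    by rewrite ltrBrDl subrr divr_gt0// p0.
  rewrite lnM ?posrE ?invr_gt0 ?p0// lnV ?posrE//.
  rewrite -(ler_pM2l wp) [X in _ <= X]mulrBr mulrCA mulfV ?gt_eqF// mulr1.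
  by lra.
- rewrite -restrict_EFin.
  by apply/(@integrable_mkcond _ (measurableTypeR R)
    R mu `]0, +oo[%classic (EFin \o (fun t => C * f t))) => //.
Qed.

Lemma gam_succ w t : 0 < w -> gam (w + 1) t = t * gam w t.
Proof.
move=> w0; rewrite /gam; case: ifPn => t0; last by rewrite mulr0.
by rewrite addrK mulrA mulr_powRB1// ltW.
Qed.

(** The Fourier transform of [gam w], which is also the Laplace transform of t^(w - 1) at 1 + i
    om. *)
Definition gamF w om : R[i] :=
  cintegral mu (fun t => (gam w t)%:C * cexpi (- (om * t))).

Lemma gamF_integrable w om : 0 < w ->
  cintegrable mu (fun t => (gam w t)%:C * cexpi (- (om * t))).
Proof.
move=> w0; apply: (@cintegrable_le _ (measurableTypeR R) R mu _ (gam w)).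
- apply: cmeasurableM; first exact: (cmeasurable_real (gam_measurable w)).
  have mz : measurable_fun setT (fun t : measurableTypeR R => - om * t).
    exact: measurable_funM.
  have -> : (fun t => cexpi (- (om * t))) = (fun t => cexpi (- om * t)).
    by apply/funext => t; rewrite mulNr.
  exact: cmeasurable_expi mz.
- by move=> t; rewrite cabsM cabs_expi mulr1 cabs_real ger0_norm// gam_ge0.
- exact: gam_integrable.
Qed.

Lemma gam_trig_integrable w p q om : 0 < w ->
  mu.-integrable setT (EFin \o (fun t => gam w t * (p * sin (om * t) + q * cos (om * t)))).
Proof.
move=> w0.
have [iR iI] := gamF_integrable om w0.
pose fR t := Re ((gam w t)%:C * cexpi (- (om * t))).
pose fI t := Im ((gam w t)%:C * cexpi (- (om * t))).
have -> : EFin \o (fun t => gam w t * (p * sin (om * t) + q * cos (om * t))) =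
    (fun t => (- p)%:E * (EFin \o fI) t)%E \+ (fun t => q%:E * (EFin \o fR) t)%E.
  apply/funext => t /=; rewrite -EFinD; congr EFin.
  by rewrite /fR /fI ReM ImM/= cosN sinN; ring.
apply: (@integrableD _ (measurableTypeR R)) => //;
  exact: (@integrableZl _ (measurableTypeR R)).
Qed.

(** The difference of the two sides is the integral over []0, +oo[] of the derivative of t^w e^(-t)
    (p sin (om t) + q cos (om t)), which vanishes at both ends. *)
Lemma gam_parts w p q om : 0 < w ->
  w * \int[mu]_t (gam w t * (p * sin (om * t) + q * cos (om * t))) =
  \int[mu]_t (gam (w + 1) t *
     ((p + om * q) * sin (om * t) + (q - om * p) * cos (om * t))).
Proof.
move=> w0; have w10 : 0 < w + 1 by rewrite addr_gt0.
pose g1 t := gam w t * (p * sin (om * t) + q * cos (om * t)).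
pose g2 t := gam (w + 1) t *
     ((p + om * q) * sin (om * t) + (q - om * p) * cos (om * t)).
have i1 : mu.-integrable setT (EFin \o g1) by exact: gam_trig_integrable.
have i2 : mu.-integrable setT (EFin \o g2) by exact: gam_trig_integrable.
have i1w : mu.-integrable setT (EFin \o (fun t => w * g1 t)).
  exact: (@integrableZl _ (measurableTypeR R) _ mu _ _ w _ i1).
apply/eqP; rewrite -subr_eq0 -(@RintegralZl _ (measurableTypeR R))//.
rewrite -(@RintegralB _ (measurableTypeR R))//; apply/eqP.
pose f t := w * t `^ (w - 1) * trigexp (-1) p q om t +
  t `^ w * trigexp (-1) (-1 * p - om * q) (-1 * q + om * p) om t.
have fE : (fun t => w * g1 t - g2 t) = f \_ `]0, +oo[.
  apply/funext => t; rewrite patchE /g1 /g2 /gam; case: ifPn => t0.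
    rewrite mem_set /=; last by rewrite in_itv/= t0.
    by rewrite /f /trigexp addrK (mulN1r t); ring.
  by rewrite memNset /=; [rewrite !mul0r mulr0 subr0|rewrite in_itv/= andbT; exact/negP].
rewrite fE -Rintegral_mkcond.
have Dw a t : 0 < t -> is_derive t (1 : R) (fun t => t `^ a) (a * t `^ (a - 1)).
  exact: is_derive1_powR.
have := @FTC_pos R f (fun t => t `^ w * trigexp (-1) p q om t) 0 0.
case.
- move=> t t0; apply: is_derive_continuous.
  exact: (is_derive_funD
   (is_derive_funM (is_derive_funM (is_derive_const w t) (Dw _ _ t0)) (is_derive_trigexp _ _ _ _ _))
   (is_derive_funM (Dw _ _ t0) (is_derive_trigexp _ _ _ _ _))).
- move=> t t0; apply: (is_derive_eqd (is_derive_funM (Dw _ _ t0) (is_derive_trigexp _ _ _ _ _))).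
  by rewrite /f addrC; congr (_ + _); rewrite mulrC.
- apply: (@cvg0_squeeze _ _ (fun n => (`|p| + `|q|) * invS n `^ w)).
    move=> n; rewrite normrM ger0_norm ?powR_ge0// mulrC ler_wpM2r ?powR_ge0//.
    rewrite (le_trans (trigexp_le _ _ _ _ _))// ler_piMr ?addr_ge0//.
    by rewrite -[leRHS]expR0 ler_expR mulN1r oppr_le0 ltW// invS_gt0.
  by rewrite -[X in _ --> X](mulr0 (`|p| + `|q|)); apply: cvgMl_tmp; exact: cvg_invS_powR.
(* By ln y <= y - 1 at y = t / (2 w), the power t^w is at most a constant times e^(t / 2), which
   leaves the decay e^(- t / 2). *)
- apply: (@cvg0_squeeze _ _ (fun n => (`|p| + `|q|) * expR (w * ln (w *+ 2) - w)
      * expR (- (2^-1 * n.+2%:R)))).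
    move=> n; rewrite normrM ger0_norm ?powR_ge0// powR_expln//.
    rewrite mulrC (le_trans (ler_wpM2r _ (trigexp_le _ _ _ _ _))) ?expR_ge0//.
    rewrite -!mulrA ler_wpM2l ?addr_ge0// -!expRD ler_expR.
    have w20 : 0 < w *+ 2 by rewrite pmulrn_lgt0.
    have : ln (n.+2%:R / (w *+ 2)) <= n.+2%:R / (w *+ 2) - 1.
      have := @le_ln1Dx R (n.+2%:R / (w *+ 2) - 1).
      rewrite subrKC; apply.
      by rewrite ltrBrDl subrr divr_gt0.
    rewrite lnM ?posrE ?invr_gt0// lnV ?posrE//.
    rewrite -(ler_pM2l w20) [X in _ <= X]mulrBr mulrCA mulfV ?gt_eqF// mulr1.
    by rewrite -mulr_natl; lra.
  rewrite -[X in _ --> X](mulr0 ((`|p| + `|q|) * expR (w * ln (w *+ 2) - w))).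
  by apply: cvgMl_tmp; apply: cvg_expRN; rewrite invr_gt0.
move=> _; rewrite subrr; apply.
apply/(@integrable_mkcond _ (measurableTypeR R)) => //.
rewrite restrict_EFin -fE.
exact: (@integrableB _ (measurableTypeR R) _ mu _ _ _ _ i1w i2).
Qed.

(** Integration by parts applied to (p, q) = (0, 1) and (-1, 0), the real and imaginary parts of
    e^(- i om t). *)
Lemma gamF_succ w om : 0 < w -> (1 +i* om) * gamF (w + 1) om = w%:C * gamF w om.
Proof.
move=> w0; have w10 : 0 < w + 1 by rewrite addr_gt0.
have RE v : Re (gamF v om) = \int[mu]_t (gam v t * (0 * sin (om * t) + 1 * cos (om * t))).
  by apply: eq_Rintegral => t _; rewrite ReM/= cosN; ring.
have IE v : Im (gamF v om) = \int[mu]_t (gam v t * (-1 * sin (om * t) + 0 * cos (om * t))).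
  by apply: eq_Rintegral => t _; rewrite ImM/= sinN; ring.
have i p q : mu.-integrable setT (EFin \o (fun t => gam (w + 1) t * (p * sin (om * t) + q * cos (om * t)))).
  exact: gam_trig_integrable.
have Z r p q : r * \int[mu]_t (gam (w + 1) t * (p * sin (om * t) + q * cos (om * t))) =
    \int[mu]_t (gam (w + 1) t * ((r * p) * sin (om * t) + (r * q) * cos (om * t))).
  rewrite -(@RintegralZl _ (measurableTypeR R))//; apply: eq_Rintegral => t _; ring.
have D p q p' q' : \int[mu]_t (gam (w + 1) t * (p * sin (om * t) + q * cos (om * t))) +
    \int[mu]_t (gam (w + 1) t * (p' * sin (om * t) + q' * cos (om * t))) =
    \int[mu]_t (gam (w + 1) t * ((p + p') * sin (om * t) + (q + q') * cos (om * t))).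
  rewrite -(@RintegralD _ (measurableTypeR R))//; apply: eq_Rintegral => t _; ring.
move: (RE (w + 1)) (IE (w + 1)) (RE w) (IE w).
move: (gamF (w + 1) om) (gamF w om) => [a b] [a' b'] Ea Eb Ea' Eb'.
rewrite /= in Ea Eb Ea' Eb'.
have Ra : 1 * a - om * b = w * a'.
  rewrite Ea Eb Ea' (gam_parts 0 1 om w0) mul1r -mulNr (Z (- om) (-1) 0)
    (D 0 1 (- om * -1) (- om * 0)).
  by apply: eq_Rintegral => t _; ring.
have Rb : 1 * b + om * a = w * b'.
  rewrite Ea Eb Eb' (gam_parts (-1) 0 om w0) mul1r (Z om 0 1)
    (D (-1) 0 (om * 0) (om * 1)).
  by apply: eq_Rintegral => t _; ring.
apply: eq_c; rewrite ?ReM ?ImM /=.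
  by rewrite Ra mul0r subr0.
by rewrite Rb mul0r addr0.
Qed.

Lemma gamF_deriv w om : 0 < w ->
  cderiv (gamF w) om (- 'i * gamF (w + 1) om).
Proof.
move=> w0; have w10 : 0 < w + 1 by rewrite addr_gt0.
pose F om t := (gam w t)%:C * cexpi (- (om * t)).
pose F' om t := - 'i * ((gam (w + 1) t)%:C * cexpi (- (om * t))).
have H : cderiv (fun om => cintegral mu (F om)) om (cintegral mu (F' om)).
  apply: (@cderiv_under_integral _ (measurableTypeR R) R mu F F' om (om - 1) (om + 1) (gam (w + 1))).
  - by rewrite ltrBlDr ltrDl ltr01.
  - by move=> x _; exact: gamF_integrable.
  - move=> x t _; rewrite /F /F'.
    have D : is_derive x (1 : R) (fun om => - (om * t)) (- t).
      have -> : (fun om => - (om * t)) = (fun om => - t * om).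
        by apply/funext => y; rewrite mulNr mulrC.
      exact: is_derive_lin.
    apply: (cderiv_eq (cderivM (cderiv_cst (gam w t)%:C x) (cderiv_expi D))).
    by rewrite gam_succ// !rmorphM rmorphN /=; ring.
  - move=> x t _; rewrite /F' !cabsM cabsN cabs_expi mulr1 cabs_real ger0_norm ?gam_ge0//.
    by rewrite /cabs/= expr0n/= expr1n add0r sqrtr1 mul1r.
  - exact: gam_integrable.
apply: (cderiv_eq H).
by rewrite /F' (@cintegralZl _ (measurableTypeR R))//; exact: gamF_integrable.
Qed.

End gamma_integral.

(** * Complex powers on the right half-plane *)

Section complex_power.
Context {R : realType}.
Implicit Types (c om w : R).

Lemma normsq_gt0 c om : 0 < c -> 0 < c ^+ 2 + om ^+ 2.
Proof. by move=> c0; rewrite ltr_pwDl ?sqr_ge0// exprn_gt0. Qed.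

(* principal branch of the logarithm of [c +i* om] on the half-plane [0 < c] *)
Definition clog c om : R[i] := (ln (c ^+ 2 + om ^+ 2) / 2) +i* atan (om / c).

Definition cpow c om w : R[i] := cexp (w%:C * clog c om).

Lemma sin_atan_cos (x : R) : sin (atan x) = x * cos (atan x).
Proof.
have n0 : cos (atan x) != 0.
  by rewrite cos_atan invr_eq0 sqrtr_eq0 -ltNge ltr_pwDl// sqr_ge0.
by apply: (mulIf (_ : (cos (atan x))^-1 != 0)); rewrite ?invr_eq0// mulfK// -/(tan _) atanK.
Qed.

Lemma cexp_clog c om : 0 < c -> cexp (clog c om) = c +i* om.
Proof.
move=> c0; have N0 := normsq_gt0 om c0.
have cn0 : c != 0 by rewrite gt_eqF.
have E : expR (ln (c ^+ 2 + om ^+ 2) / 2) = Num.sqrt (c ^+ 2 + om ^+ 2).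
  rewrite -powR12_sqrt ?(ltW N0)// powR_expln// mulrC; congr (expR (_ * _)).
have C : expR (ln (c ^+ 2 + om ^+ 2) / 2) * cos (atan (om / c)) = c.
  rewrite E cos_atan.
  have -> : 1 + (om / c) ^+ 2 = (c ^+ 2 + om ^+ 2) / c ^+ 2 by field.
  rewrite sqrtrM ?(ltW N0)// sqrtrV ?sqr_ge0// sqrtr_sqr gtr0_norm//.
  rewrite invfM invrK mulrA mulfV ?mul1r// sqrtr_eq0 -ltNge//.
apply: eq_c; rewrite /cexp ?ReM ?ImM/= ?mul0r ?subr0 ?addr0//.
by rewrite sin_atan_cos mulrCA C divfK.
Qed.

Lemma clog_deriv_om c om : 0 < c -> cderiv (clog c) om ('i / (c +i* om)).
Proof.
move=> c0; have N0 := normsq_gt0 om c0.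
have cn0 : c != 0 by rewrite gt_eqF.
have D1 : is_derive om (1 : R) (fun om => c ^+ 2 + om ^+ 2) (om + om).
  apply: (is_derive_eqd (is_derive_funD (is_derive_const (c ^+ 2) om)
    (is_derive_funM (is_derive_idfun om) (is_derive_idfun om)))).
  by rewrite add0r mulr1.
have D2 := is_derive_funM (@is_derive_chain _ (@ln R) (fun om => c ^+ 2 + om ^+ 2) om _ _
  (is_derive1_ln N0) D1) (is_derive_const (2^-1) om).
have D3 : is_derive om (1 : R) (fun om => om / c) (c^-1).
  apply: (is_derive_eqd (is_derive_funM (is_derive_idfun om) (is_derive_const c^-1 om))).
  by rewrite mulr0 add0r mulr1.
have D4 := is_derive_chain (is_derive1_atan _) D3.
apply: (cderiv_eq (cderiv_pair D2 D4)).
have n0 : c ^+ 2 + om ^+ 2 != 0 by rewrite gt_eqF.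
have -> : 1 + (om / c) ^+ 2 = (c ^+ 2 + om ^+ 2) / c ^+ 2 by field.
by apply: eq_c; rewrite ?ReM ?ImM/=; field; rewrite ?n0 ?cn0.
Qed.

Lemma clog_deriv_c c om : 0 < c -> cderiv (clog ^~ om) c (c +i* om)^-1.
Proof.
move=> c0; have N0 := normsq_gt0 om c0.
have cn0 : c != 0 by rewrite gt_eqF.
have D1 : is_derive c (1 : R) (fun c => c ^+ 2 + om ^+ 2) (c + c).
  apply: (is_derive_eqd (is_derive_funD (is_derive_funM (is_derive_idfun c) (is_derive_idfun c))
   (is_derive_const (om ^+ 2) c))).
  by rewrite addr0 mulr1.
have D2 := is_derive_funM (@is_derive_chain _ (@ln R) (fun c => c ^+ 2 + om ^+ 2) c _ _
  (is_derive1_ln N0) D1) (is_derive_const (2^-1) c).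
have D3 := is_derive_funM (is_derive_const om c)
  (@is_deriveV R (fun c => c) c _ 1 cn0 (is_derive_idfun c)).
have D4 := is_derive_chain (is_derive1_atan _) D3.
apply: (cderiv_eq (cderiv_pair D2 D4)).
have n0 : c ^+ 2 + om ^+ 2 != 0 by rewrite gt_eqF.
have -> : 1 + (om / c) ^+ 2 = (c ^+ 2 + om ^+ 2) / c ^+ 2 by field.
by apply: eq_c; rewrite ?ReM ?ImM/= /GRing.scale/=; field; rewrite ?n0 ?cn0.
Qed.

Lemma cpowD c om w v : cpow c om (w + v) = cpow c om w * cpow c om v.
Proof. by rewrite /cpow rmorphD/= mulrDl cexpD. Qed.

Lemma cpowN c om w : cpow c om (- w) = (cpow c om w)^-1.
Proof. by rewrite /cpow rmorphN/= mulNr cexpN. Qed.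

Lemma cpow1 c om : 0 < c -> cpow c om 1 = c +i* om.
Proof. by move=> c0; rewrite /cpow mul1r cexp_clog. Qed.

Lemma cpowMn c om w k : cpow c om (w * k%:R) = cpow c om w ^+ k.
Proof.
rewrite /cpow rmorphM/= -cexpX; congr cexp.
by rewrite mulrAC mulrC rmorph_nat.
Qed.

Lemma cabs_cpow c om w : cabs (cpow c om w) = expR (w * (ln (c ^+ 2 + om ^+ 2) / 2)).
Proof. by rewrite cabs_cexp ReM/= mul0r subr0. Qed.

Lemma cabs_cpow_gt0 c om w : 0 < cabs (cpow c om w).
Proof. by rewrite cabs_cpow expR_gt0. Qed.

Lemma cpow_neq0 c om w : cpow c om w != 0. Proof. exact: cexp_neq0. Qed.

Lemma cabs_cpow_le c om w v : 1 <= c -> w <= v ->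
  cabs (cpow c om w) <= cabs (cpow c om v).
Proof.
move=> c1 wv; rewrite !cabs_cpow ler_expR ler_wpM2r// divr_ge0// ln_ge0//.
by rewrite (le_trans (_ : 1 <= c ^+ 2)) ?lerDl ?sqr_ge0// expr_ge1// (le_trans _ c1).
Qed.

Lemma cabs_cpowN2 c om : 0 < c -> cabs (cpow c om (- 2)) = (c ^+ 2 + om ^+ 2)^-1.
Proof.
move=> c0; rewrite cabs_cpow mulrC mulrN mulfVK ?pnatr_eq0// expRN lnK//.
by rewrite posrE normsq_gt0.
Qed.

Lemma cpow10 w : cpow 1 0 w = 1.
Proof.
by rewrite /cpow /clog expr1n expr0n/= addr0 ln1 !mul0r atan0 (_ : _ +i* _ = 0)// mulr0 cexp0.
Qed.

Lemma cpow_deriv_om c om w : 0 < c ->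
  cderiv (fun om => cpow c om w) om (w%:C * ('i / (c +i* om)) * cpow c om w).
Proof.
move=> c0; apply: (cderiv_eq (cderiv_exp (cderivM (cderiv_cst w%:C om) (clog_deriv_om om c0)))).
by rewrite mulr0 addr0.
Qed.

Lemma cpow_deriv_c c om w : 0 < c ->
  cderiv (fun c => cpow c om w) c (w%:C * (c +i* om)^-1 * cpow c om w).
Proof.
move=> c0; apply: (cderiv_eq (cderiv_exp (cderivM (cderiv_cst w%:C c) (clog_deriv_c om c0)))).
by rewrite mulr0 addr0.
Qed.

Lemma cplx_neq0 c om : 0 < c -> c +i* om != 0 :> R[i].
Proof. by move=> c0; rewrite eq_complex/= gt_eqF. Qed.

End complex_power.

(** * The inversion formula by Poisson means *)

Section inversion.
Context {R : realType}.
Local Notation mu := (@lebesgue_measure R).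
Implicit Types (w t om : R).

(** By [gamF_deriv] and [gamF_succ], the derivative of [gamF w] is - i w / (1 + i om) times itself,
    so its product with (1 + i om)^w is constant; at om = 0 the product is [Gamma w]. *)
Lemma gamF_cpow w om : 0 < w -> gamF w om = (Gamma w)%:C * cpow 1 om (- w).
Proof.
move=> w0.
have H om1 om2 : gamF w om1 * cpow 1 om1 w = gamF w om2 * cpow 1 om2 w.
  apply: (cderiv0_cst (F := fun om => gamF w om * cpow 1 om w)) => x.
  apply: (cderiv_eq (cderivM (gamF_deriv x w0) (cpow_deriv_om x w (@ltr01 R)))).
  have s0 := cplx_neq0 x (@ltr01 R).
  have E := gamF_succ x w0.
  have -> : gamF (w + 1) x = w%:C * gamF w x / (1 +i* x).
    by rewrite -E (mulrC (1 +i* x)) mulfK.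
  move: (gamF w x) (cpow 1 x w) (w%:C) (1 +i* x)^-1 ('i : R[i]) => a b e f i.
  ring.
have /(congr1 (fun z => z * (cpow 1 om w)^-1)) := H om 0.
rewrite mulfK ?cpow_neq0// cpow10 mulr1 => ->; rewrite cpowN; congr (_ * _).
have E t : (gam w t)%:C * cexpi (- (0 * t)) = (gam w t)%:C by rewrite mul0r oppr0 cexpi0 mulr1.
rewrite GammaE /gamF (@eq_cintegral _ (measurableTypeR R) R mu _ _ E); apply: eq_c => //=.
by rewrite (@Rintegral_cst _ (measurableTypeR R))// mul0r.
Qed.

Lemma invnormsq_integrable c : 0 < c ->
  mu.-integrable setT (EFin \o (fun x => (c ^+ 2 + x ^+ 2)^-1)).
Proof.
move=> c0; have [H _] := poisson_integral (0 : R) c0.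
have -> : EFin \o (fun x => (c ^+ 2 + x ^+ 2)^-1) =
    (fun x => ((2 * c)^-1)%:E * (EFin \o (fun y => poisson c (0 - y))) x)%E.
  apply/funext => x /=; rewrite -EFinM; congr EFin.
  by rewrite /poisson sub0r sqrrN mulrA mulVf ?mul1r// mulf_neq0// gt_eqF.
exact: (@integrableZl _ (measurableTypeR R)).
Qed.

(** The maximum is at t = w - 1, whence ln y <= y - 1 is used at y = t / (w - 1). *)
Lemma gam_le w t : 1 < w -> gam w t <= expR ((w - 1) * ln (w - 1)).
Proof.
move=> w1; rewrite /gam; case: ifPn => [t0|_]; last exact: expR_ge0.
have w0 : 0 < w - 1 by rewrite subr_gt0.
rewrite powR_expln// -expRD ler_expR.
have : ln (t / (w - 1)) <= t / (w - 1) - 1.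
  have := @le_ln1Dx R (t / (w - 1) - 1).
  rewrite subrKC; apply.
  by rewrite ltrBrDl subrr divr_gt0.
rewrite lnM ?posrE ?invr_gt0// lnV ?posrE//.
rewrite -(ler_pM2l w0) [X in _ <= X]mulrBr mulrCA mulfV ?gt_eqF// mulr1.
by lra.
Qed.

(** Within distance [e'] of 1 the difference quotient stays within 1 of the derivative [d]; farther
    away the crude bound 2 M on the difference suffices. The choice [e' <= 1] keeps t positive in
    the first case. *)
Lemma gam_lipschitz1 w : 1 < w ->
  exists2 L, 0 <= L & forall t, `|gam w t - gam w 1| <= L * `|t - 1|.
Proof.
move=> w1.
pose g t := t `^ (w - 1) * expR (- t).
have De := @is_derive_chain _ expR (fun t => - t) 1 _ _ (is_derive_expR _)
  (is_derive_funN (is_derive_idfun 1)).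
have Dg := is_derive_funM (is_derive1_powR (w - 1) (@ltr01 R)) De.
move: Dg; set d := (X in is_derive _ _ _ X) => -[dg gd].
pose M := expR ((w - 1) * ln (w - 1)).
have /cvgrPdist_lt/(_ _ (@ltr01 R)) [e /= e0 He] := dg.
pose e' := Num.min e 1.
have e'0 : 0 < e' by rewrite lt_min e0 ltr01.
have M0 : 0 < M by exact: expR_gt0.
exists (`|d| + 1 + 2 * M / e').
  by rewrite !addr_ge0// divr_ge0 ?mulr_ge0// ltW.
move=> t; have [te|te] := ltP `|t - 1| e'; last first.
  rewrite (@le_trans _ _ (2 * M))//.
    rewrite (le_trans (ler_normB _ _))// mulr_natl mulr2n lerD//.
      by rewrite ger0_norm ?gam_ge0// gam_le.
    by rewrite ger0_norm ?gam_ge0// gam_le.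
  rewrite [leRHS]mulrDl ler_wpDl ?mulr_ge0 ?addr_ge0//.
  by rewrite mulrAC ler_pdivlMr// ler_wpM2l ?mulr_ge0 ?(ltW M0).
have [->|t1] := eqVneq t 1; first by rewrite !subrr normr0 mulr0.
have t0 : 0 < t.
  move: te; rewrite lt_min => /andP[_]; rewrite ltr_norml => /andP[+ _].
  by rewrite ltrBrDr addNr.
have := He (t - 1); rewrite /ball/= sub0r normrN.
move: te; rewrite lt_min => /andP[te _]; move=> /(_ te).
rewrite subr_eq0 => /(_ t1).
move: gd; rewrite /derive => ->.
rewrite /GRing.scale/= mulr1 subrK -/(g t) -/(g 1) => H.
have gE x : 0 < x -> gam w x = g x by rewrite /gam => ->.
rewrite !gE// ?ltr01//.
have tn : t - 1 != 0 by rewrite subr_eq0.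
have tp : 0 < `|t - 1| by rewrite normr_gt0.
rewrite -ler_pdivrMr// -normfV -normrM mulrC.
rewrite (@le_trans _ _ (`|d| + 1))//; last by rewrite lerDl divr_ge0 ?mulr_ge0 ?(ltW M0) ?(ltW e'0).
have -> : (t - 1)^-1 * (g t - g 1) = d - (d - (t - 1)^-1 * (g t - g 1)).
  by ring.
by rewrite (le_trans (ler_normB _ _))// lerD2l ltW.
Qed.

(** The Poisson kernels are an approximate identity. The constant [gam w 1] contributes exactly the
    limit, and the remainder [h] tends to 0 by dominated convergence. *)
Lemma cvg_poisson_gam w : 1 < w ->
  \int[mu]_t (gam w t * poisson (invS n) (1 - t)) @[n --> \oo] --> 2 * pi * expR (- 1).
Proof.
move=> w1; have w0 : 0 < w by rewrite (lt_trans _ w1).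
have [L L0 HL] := gam_lipschitz1 w1.
pose M := expR ((w - 1) * ln (w - 1)).
have M0 : 0 < M by exact: expR_gt0.
have g1 : gam w 1 = expR (- 1) by rewrite /gam ltr01 powR1 mul1r.
pose h n t := (gam w t - gam w 1) * poisson (invS n) (1 - t).
have n0 n : 0 < invS n :> R by exact: invS_gt0.
have mgam : measurable_fun setT (fun t : measurableTypeR R => gam w t) by exact: gam_measurable.
have ip n := (poisson_integral 1 (n0 n)).1.
have mp n := @integrable_measurable _ (measurableTypeR R) R mu _ (ip n).
have mh n : measurable_fun setT (fun t : measurableTypeR R => h n t).
  apply: measurable_funM; last exact: mp.
  by apply: measurable_funB => //; exact: measurable_cst.
(* With y = |1 - t| and e = [invS n]: for y <= 1 the Lipschitz factor cancels the peak, since 2 e y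
   <= e^2 + y^2. For y > 1 the kernel is at most 2 / y^2, hence at most twice [poisson 1], and the
   difference is at most 2 M. *)
have hb n t : `|h n t| <= (L + 4 * M) * poisson 1 (1 - t).
  rewrite /h normrM (ger0_norm (poisson_ge0 _ (n0 n))).
  have n1 : invS n <= 1 :> R by rewrite invf_le1// ler1n.
  have b1 : `|gam w t - gam w 1| <= 2 * M.
    rewrite (le_trans (ler_normB _ _))// mulr_natl mulr2n lerD//.
      by rewrite ger0_norm ?gam_ge0// gam_le.
    by rewrite ger0_norm ?gam_ge0// gam_le.
  have b2 : `|gam w t - gam w 1| <= L * `|1 - t| by rewrite (distrC 1); exact: HL.
  have A0 := normr_ge0 (gam w t - gam w 1).
  move: b1 b2 A0 (n0 n) n1; move: `|gam w t - gam w 1| (1 - t) (invS n : R) => A x e.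
  move=> b1 b2 A0 e0 e1.
  have X0 := normr_ge0 x.
  have xx : x ^+ 2 = `|x| ^+ 2 by rewrite real_normK// num_real.
  rewrite /poisson xx expr1n; move: X0 b2; move: (`|x|) => y y0 b2.
  have d1 : 0 < e ^+ 2 + y ^+ 2 by rewrite ltr_pwDl ?sqr_ge0// exprn_gt0.
  have d2 : 0 < 1 + y ^+ 2 by rewrite ltr_pwDl ?sqr_ge0.
  have [y1|y1] := leP y 1.
    rewrite (@le_trans _ _ L)//.
      have hq : 0 <= 2 * e / (e ^+ 2 + y ^+ 2).
        by rewrite divr_ge0 ?mulr_ge0 ?(ltW e0) ?(ltW d1).
      rewrite (le_trans (ler_wpM2r hq b2))//.
      rewrite -(mulrA L); apply: ler_piMr => //; rewrite mulrA ler_pdivrMr// mul1r.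
      by have := sqr_ge0 (e - y); rewrite sqrrB; lra.
    have g1' : 1 <= 2 * 1 / (1 + y ^+ 2).
      by rewrite ler_pdivlMr// mul1r mulr1 (_ : 2 = 1 + 1)// lerD2l expr_le1.
    apply: (@le_trans _ _ (L + 4 * M)); first by rewrite lerDl mulr_ge0// ltW.
    by apply: ler_peMr => //; rewrite addr_ge0// mulr_ge0// ltW.
  have y20 : 0 < y ^+ 2 by rewrite exprn_gt0// (lt_trans _ y1).
  have q1 : 2 * e / (e ^+ 2 + y ^+ 2) <= 2 * (y ^+ 2)^-1.
    rewrite ler_pdivrMr// mulrAC ler_pdivlMr// -mulrA ler_pM2l//.
    have e1' : 0 <= 1 - e by rewrite subr_ge0.
    by have := mulr_ge0 e1' (ltW y20); have := sqr_ge0 e; lra.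
  have q2 : (y ^+ 2)^-1 <= 2 * 1 / (1 + y ^+ 2).
    rewrite mulr1 ler_pdivlMr// ler_pdivrMl//.
    have : 1 <= y ^+ 2 by rewrite expr_ge1// ltW// (lt_trans _ y1).
    by lra.
  have q0 : 0 <= 2 * e / (e ^+ 2 + y ^+ 2).
    by rewrite divr_ge0 ?mulr_ge0 ?(ltW e0) ?(ltW d1).
  apply: (@le_trans _ _ (2 * M * (2 * (2 * 1 / (1 + y ^+ 2))))).
    apply: ler_pM => //.
    by rewrite (le_trans q1)// ler_pM2l.
  have -> : 2 * M * (2 * (2 * 1 / (1 + y ^+ 2))) = (4 * M) * (2 * 1 / (1 + y ^+ 2)) by ring.
  by rewrite ler_wpM2r ?lerDr// divr_ge0 ?mulr_ge0 ?(ltW d2).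
have hc t : h n t @[n --> \oo] --> 0.
  have [->|t1] := eqVneq t 1.
    by rewrite /h; under eq_fun do rewrite subrr mul0r; exact: cvg_cst.
  have x0 : 0 < (1 - t) ^+ 2 by rewrite exprn_even_gt0//= subr_eq0 eq_sym.
  apply: (@cvg0_squeeze _ _ (fun n => `|gam w t - gam w 1| * (2 / (1 - t) ^+ 2) * invS n)).
    move=> n; rewrite /h normrM -mulrA ler_wpM2l// ger0_norm ?poisson_ge0//.
    rewrite /poisson ler_pdivrMr ?ltr_pwDl ?exprn_gt0 ?sqr_ge0//.
    have -> : 2 / (1 - t) ^+ 2 * invS n * (invS n ^+ 2 + (1 - t) ^+ 2) =
       2 * invS n + 2 / (1 - t) ^+ 2 * invS n * invS n ^+ 2.
      by field; rewrite subr_eq0 eq_sym.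
    by rewrite lerDl !mulr_ge0 ?invr_ge0 ?(ltW x0) ?sqr_ge0 ?(ltW (n0 n)).
  rewrite -[X in _ --> X](mulr0 (`|gam w t - gam w 1| * (2 / (1 - t) ^+ 2))).
  by apply: cvgMl_tmp; exact: cvg_invS.
have iK : mu.-integrable setT (EFin \o (fun t => (L + 4 * M) * poisson 1 (1 - t))).
  exact: (@integrableZl _ (measurableTypeR R) _ mu _ _ _ _ (poisson_integral 1 (@ltr01 R)).1).
have [_ H] := @Rintegral_dominated _ (measurableTypeR R) R mu h (fun _ => 0) _ mh hc iK hb.
rewrite (@Rintegral_cst _ (measurableTypeR R)) ?mul0r// in H.
have ih n : mu.-integrable setT (EFin \o h n).
  exact: (@integrable_le _ (measurableTypeR R) R mu _ _ (mh n) (hb n)).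
have E n : \int[mu]_t (gam w t * poisson (invS n) (1 - t)) =
    \int[mu]_t h n t + 2 * pi * expR (-1).
  rewrite -g1 -(poisson_integral 1 (n0 n)).2 mulrC -(@RintegralZl _ (measurableTypeR R))//.
  rewrite -(@RintegralD _ (measurableTypeR R))//; last first.
    exact: (@integrableZl _ (measurableTypeR R) _ mu _ _ _ _ (ip n)).
  by apply: eq_Rintegral => t _; rewrite /h; ring.
have -> : (fun n => \int[mu]_t (gam w t * poisson (invS n) (1 - t))) =
    (fun n => \int[mu]_t h n t + 2 * pi * expR (-1)) by apply/funext => n; exact: E.
have H2 : (cst (2 * pi * expR (-1)) : nat -> R) @ \oo --> 2 * pi * expR (-1) by exact: cvg_cst.
by have := cvgD H H2; rewrite add0r => /(_ _); apply.
Qed.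

(* Laplace inversion of t^(w-1) e^(-t) at t = 1 *)
Lemma Gamma_inversion w : 3 <= w ->
  cintegrable mu (fun om => cexp (1 +i* om) * cpow 1 om (- w)) /\
  (Gamma w)%:C * cintegral mu (fun om => cexp (1 +i* om) * cpow 1 om (- w)) = (2 * pi)%:C.
Proof.
move=> w3; have w0 : 0 < w by lra. have w1 : 1 < w by lra.
pose G om := cexpi om * gamF w om.
have ci (z : R) : cmeasurable (fun t : measurableTypeR R => cexpi (z * t)).
  apply: cmeasurable_expi; exact: measurable_funM.
have n0 n : 0 < invS n :> R by exact: invS_gt0.
(* Damping in om makes the double integral of the transform absolutely convergent. Integrating first
   in om then gives a Poisson mean of [gam w] at the point 1. *)
have key n := @cFubini _ _ (measurableTypeR R) (measurableTypeR R) R mu mu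
  (fun z => (kexp (invS n) z.1)%:C * ((gam w z.2)%:C * cexpi ((1 - z.2) * z.1)))
  (kexp (invS n)) (gam w).
have {}key n : cintegral mu (fun om => (kexp (invS n) om)%:C * G om) =
   (\int[mu]_t (gam w t * poisson (invS n) (1 - t)))%:C.
  have [|||||| K1 K2 K3 K4 K5] := key n.
  - apply: cmeasurableM.
      apply: cmeasurable_real; apply: (measurableT_comp (kexp_measurable _)); exact: measurable_fst.
    apply: cmeasurableM.
      apply: cmeasurable_real; apply: (measurableT_comp (gam_measurable _)); exact: measurable_snd.
    apply: cmeasurable_expi; apply: measurable_funM; last exact: measurable_fst.
    by apply: measurable_funB => //; exact: measurable_snd.
  - by move=> x; exact: kexp_ge0.
  - by move=> x; exact: gam_ge0.
  - move=> x y; rewrite !cabsM cabs_expi mulr1 !cabs_real.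
    by rewrite !ger0_norm ?kexp_ge0 ?gam_ge0.
  - exact: kexp_integrable.
  - exact: gam_integrable.
  have -> : cintegral mu (fun om => (kexp (invS n) om)%:C * G om) =
    cintegral mu (fun x => cintegral mu (fun y =>
      (kexp (invS n) x)%:C * ((gam w y)%:C * cexpi ((1 - y) * x)))).
    apply: (@eq_cintegral _ (measurableTypeR R)) => x; rewrite /G /gamF.
    rewrite -!(@cintegralZl _ (measurableTypeR R)).
    + apply: (@eq_cintegral _ (measurableTypeR R)) => y; congr (_ * _); rewrite mulrCA -cexpiD; congr (_ * cexpi _).
      by ring.
    + by apply: (@cintegrableZl _ (measurableTypeR R)); exact: gamF_integrable.
    + exact: gamF_integrable.
  rewrite K5.
  have E y : cintegral mu (fun x => (kexp (invS n) x)%:C * ((gam w y)%:C * cexpi ((1 - y) * x))) =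
     (gam w y * poisson (invS n) (1 - y))%:C.
    have [k1 k2] := kexp_fourier (1 - y) (n0 n).
    have -> : (fun x => (kexp (invS n) x)%:C * ((gam w y)%:C * cexpi ((1 - y) * x))) =
        (fun x => (gam w y)%:C * ((kexp (invS n) x)%:C * cexpi ((1 - y) * x))).
      by apply/funext => x; rewrite mulrCA.
    apply: (etrans (@cintegralZl _ (measurableTypeR R) R mu _ _ k1)).
    by rewrite rmorphM; congr (_ * _); exact: k2.
  apply: (etrans (@eq_cintegral _ (measurableTypeR R) R mu _ _ E)).
  exact: (@cintegral_real _ (measurableTypeR R)).
have GE om : G om = (Gamma w * expR (-1))%:C * (cexp (1 +i* om) * cpow 1 om (- w)).
  rewrite /G gamF_cpow// /cexp/= mulrCA rmorphM/= -!mulrA; congr (_ * _).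
  rewrite !mulrA -rmorphM/= -expRD addNr expR0 mul1r//.
pose B om := cexp (1 +i* om) * cpow 1 om (- w).
have mB : cmeasurable (B : measurableTypeR R -> R[i]).
  have [cR cI] : continuous (fun x => Re (B x)) /\ continuous (fun x => Im (B x)).
    apply: cderiv_continuous => x; eexists; apply: cderivM.
      exact: (cderiv_exp (cderiv_pair (is_derive_const 1 x) (is_derive_idfun x))).
    exact: cpow_deriv_om.
  by split; apply: continuous_measurable_fun.
have Bb om : cabs (B om) <= expR 1 * (1 ^+ 2 + om ^+ 2)^-1.
  rewrite /B cabsM cabs_cexp/= ler_wpM2l ?expR_ge0// -cabs_cpowN2//.
  by apply: cabs_cpow_le => //; lra.
have iB0 := @integrableZl _ (measurableTypeR R) _ mu _ measurableT (expR 1) _ (invnormsq_integrable (@ltr01 R)).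
have iB : cintegrable mu B by exact: (@cintegrable_le _ (measurableTypeR R) R mu _ _ mB Bb iB0).
split => //.
have GB : (Gamma w * expR (-1))%:C * cintegral mu B = cintegral mu G.
  rewrite -(@cintegralZl _ (measurableTypeR R))//; apply: (@eq_cintegral _ (measurableTypeR R)) => x; exact/esym/GE.
have iG : cintegrable mu G.
  have -> : G = (fun om => (Gamma w * expR (-1))%:C * B om) by apply/funext.
  exact: (@cintegrableZl _ (measurableTypeR R)).
(* The damping factor is at most 1 and tends to 1, so dominated convergence removes it; [P] stands
   for [Re] or [Im]. *)
have DCT (P : R[i] -> R) : (forall (r : R) z, P (r%:C * z) = r * P z) ->
    (forall z, `|P z| <= cabs z) ->
    measurable_fun setT (fun x : measurableTypeR R => P (G x)) ->
    \int[mu]_x (P ((kexp (invS n) x)%:C * G x)) @[n --> \oo] --> \int[mu]_x P (G x).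
  move=> PZ Pc mP.
  have [||||_ //] := @Rintegral_dominated _ (measurableTypeR R) R mu
    (fun n x => P ((kexp (invS n) x)%:C * G x)) (fun x => P (G x)) (fun x => cabs (G x)).
  - move=> n; under eq_fun do rewrite PZ; apply: measurable_funM => //; exact: kexp_measurable.
  - move=> x.
    have H : - (invS n * `|x|) @[n --> \oo] --> (0 : R).
      by rewrite -[X in _ --> X]oppr0 -(mul0r `|x|); apply: cvgN; apply: cvgMr_tmp; exact: cvg_invS.
    have K : kexp (invS n) x @[n --> \oo] --> (1 : R).
      by rewrite -(@expR0 R); apply: (cvg_comp _ _ H); exact: continuous_expR.
    have K2 : kexp (invS n) x * P (G x) @[n --> \oo] --> 1 * P (G x) by apply: cvgMr_tmp.
    rewrite mul1r in K2; apply: cvg_trans K2; apply: near_eq_cvg; apply: nearW => n.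
    by rewrite PZ.
  - exact: (@cintegrable_abs _ (measurableTypeR R)).
  - move=> n x; rewrite PZ normrM ger0_norm ?kexp_ge0//.
    by rewrite (le_trans _ (Pc _))// ler_piMl// kexp_le1.
have [mGR mGI] := cintegrable_measurable iG.
have HR := DCT (fun z => Re z) (@Re_realM R) (@normRe_le R) mGR.
have HI := DCT (fun z => Im z) (@Im_realM R) (@normIm_le R) mGI.
have {}HR : Re (cintegral mu G) = 2 * pi * expR (-1).
  apply: (cvg_unique _ HR) => //; have := cvg_poisson_gam w1.
  apply: cvg_trans; apply: near_eq_cvg; apply: nearW => n.
  exact: (esym (congr1 (@complex.Re R) (key n))).
have {}HI : Im (cintegral mu G) = 0.
  apply: (cvg_unique _ HI) => //; apply: cvg_near_cst; apply: nearW => n.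
  exact: (congr1 (@complex.Im R) (key n)).
have E1 : cintegral mu G = (2 * pi * expR (-1))%:C by apply: eq_c.
have en0 : expR (-1) != 0 :> R by rewrite gt_eqF// expR_gt0.
have en0' : (expR (-1))%:C != 0 :> R[i] by rewrite eq_complex/= eqxx andbT.
apply: (mulfI en0').
have -> : (expR (-1))%:C * ((Gamma w)%:C * cintegral mu B) =
    (Gamma w * expR (-1))%:C * cintegral mu B.
  by rewrite mulrA; congr (_ * _); rewrite mulrC -rmorphM.
apply: (etrans GB); apply: (etrans E1).
by rewrite mulrC rmorphM.
Qed.

End inversion.

(** * Decay of the Mittag-Leffler function *)

Section strip.
Context {R : realType}.
Local Notation mu := (@lebesgue_measure R).
Implicit Types (c om w : R) (f g : R -> R[i]) (F G : R -> R -> R[i]).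

Definition ccont f := continuous (fun x => Re (f x)) /\ continuous (fun x => Im (f x)).

Lemma ccontD f g : ccont f -> ccont g -> ccont (fun x => f x + g x).
Proof.
move=> [fR fI] [gR gI]; split.
  by under eq_fun do rewrite ReD; move=> x; apply: cvgD; [exact: fR|exact: gR].
by under eq_fun do rewrite ImD; move=> x; apply: cvgD; [exact: fI|exact: gI].
Qed.

Lemma ccontM f g : ccont f -> ccont g -> ccont (fun x => f x * g x).
Proof.
move=> [fR fI] [gR gI]; split.
  under eq_fun do rewrite ReM; move=> x.
  by apply: cvgB; apply: cvgM; [exact: fR|exact: gR|exact: fI|exact: gI].
under eq_fun do rewrite ImM; move=> x.
by apply: cvgD; apply: cvgM; [exact: fR|exact: gI|exact: fI|exact: gR].
Qed.

Lemma ccont_cst (z : R[i]) : ccont (fun _ => z).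
Proof. by split => x; exact: cvg_cst. Qed.

Lemma ccont_measurable f : ccont f -> cmeasurable (f : measurableTypeR R -> R[i]).
Proof. by move=> [fR fI]; split; exact: continuous_measurable_fun. Qed.

(* [F] (with derivative [F']) is holomorphic and bounded with its derivative on
   the strip [u < Re s < v], in the variable s = c +i* om. *)
Definition holb (u v : R) F F' := exists M : R,
  forall c, u < c < v -> ccont (F' c) /\
  forall om, [/\ cderiv (F ^~ om) c (F' c om),
    cderiv (F c) om ('i * F' c om), cabs (F c om) <= M & cabs (F' c om) <= M].

Variables u v : R.
Hypothesis u0 : 0 < u.

Lemma holb_ccont F F' c : holb u v F F' -> u < c < v -> ccont (F c).
Proof.
move=> [M H] cuv; apply: cderiv_continuous => x.
by exists ('i * F' c x); have [_ /(_ x)[]] := H c cuv.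
Qed.

Lemma holb_cst (z : R[i]) : holb u v (fun _ _ => z) (fun _ _ => 0).
Proof.
exists (cabs z) => c _; split; first exact: ccont_cst.
move=> om; split; [exact: cderiv_cst| |by []|by rewrite cabs0 cabs_ge0].
by rewrite mulr0; exact: cderiv_cst.
Qed.

Lemma holbD F F' G G' : holb u v F F' -> holb u v G G' ->
  holb u v (fun c om => F c om + G c om) (fun c om => F' c om + G' c om).
Proof.
move=> [M HF] [N HG]; exists (M + N) => c cuv.
have [cF HF'] := HF c cuv; have [cG HG'] := HG c cuv.
split; first exact: ccontD.
move=> om; have [F1 F2 F3 F4] := HF' om; have [G1 G2 G3 G4] := HG' om.
split; [exact: cderivD|by rewrite mulrDr; exact: cderivD| |].
  by rewrite (le_trans (cabsD _ _))// lerD.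
by rewrite (le_trans (cabsD _ _))// lerD.
Qed.

Lemma holbM F F' G G' : holb u v F F' -> holb u v G G' ->
  holb u v (fun c om => F c om * G c om)
    (fun c om => F c om * G' c om + G c om * F' c om).
Proof.
move=> hF hG; have [M HF] := hF; have [N HG] := hG.
exists (M * N + N * M) => c cuv.
have [cF HF'] := HF c cuv; have [cG HG'] := HG c cuv.
split.
  by apply: ccontD; apply: ccontM => //; [exact: (holb_ccont hF cuv)|exact: (holb_ccont hG cuv)].
move=> om; have [F1 F2 F3 F4] := HF' om; have [G1 G2 G3 G4] := HG' om.
have M0 : 0 <= M by rewrite (le_trans _ F3)// cabs_ge0.
have N0 : 0 <= N by rewrite (le_trans _ G3)// cabs_ge0.
split; [exact: cderivM| | |].
- apply: (cderiv_eq (cderivM F2 G2)); rewrite mulrDr; congr (_ + _); exact: mulrCA.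
- by rewrite cabsM ler_wpDr ?mulr_ge0// ler_pM ?cabs_ge0.
- by rewrite (le_trans (cabsD _ _))// !cabsM lerD// ler_pM ?cabs_ge0.
Qed.

Lemma holbV F F' (kap : R) : 0 < kap ->
  (forall c om, u < c < v -> kap <= cabs (F c om)) -> holb u v F F' ->
  holb u v (fun c om => (F c om)^-1) (fun c om => - F' c om * (F c om)^-1 ^+ 2).
Proof.
move=> k0 Fk hF; have [M HF] := hF.
have n0 c om : u < c < v -> F c om != 0.
  move=> cuv; apply/eqP => F0; have := Fk c om cuv; rewrite F0 cabs0.
  by rewrite leNgt k0.
have Vk c om : u < c < v -> cabs (F c om)^-1 <= kap^-1.
  move=> cuv; rewrite cabsV lef_pV2 ?posrE ?Fk//; exact: lt_le_trans (Fk _ _ cuv).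
exists (kap^-1 + M * kap^-1 ^+ 2) => c cuv; have [cF HF'] := HF c cuv.
have M0 : 0 <= M by have [_ _ + _] := HF' 0; apply: le_trans; exact: cabs_ge0.
have cV : ccont (fun om => (F c om)^-1).
  apply: cderiv_continuous => x; eexists; apply: cderivV; first exact: n0.
  by have [_ + _ _] := HF' x; apply.
split.
  apply: ccontM; last by under eq_fun do rewrite expr2; exact: ccontM.
  by under eq_fun do rewrite -mulN1r; apply: ccontM => //; exact: ccont_cst.
move=> om; have [F1 F2 F3 F4] := HF' om; split.
- by apply: cderivV => //; exact: n0.
- apply: (cderiv_eq (cderivV (n0 _ _ cuv) F2)); ring.
- by rewrite (le_trans (Vk _ _ cuv))// lerDl mulr_ge0// exprn_ge0// invr_ge0 ltW.
- rewrite cabsM cabsN cabsX ler_wpDl ?invr_ge0 ?(ltW k0)//.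
  by rewrite ler_pM ?exprn_ge0 ?cabs_ge0// lerXn2r ?nnegrE ?cabs_ge0 ?invr_ge0 ?(ltW k0) ?Vk.
Qed.

Lemma holb_cexp : holb u v (fun c om => cexp (c +i* om)) (fun c om => cexp (c +i* om)).
Proof.
have D1 c om : cderiv (fun c => cexp (c +i* om)) c (cexp (c +i* om)).
  apply: (cderiv_eq (cderiv_exp (cderiv_pair (is_derive_idfun c) (is_derive_const om c)))).
  by rewrite (_ : 1 +i* 0 = 1)// mul1r.
have D2 c om : cderiv (fun om => cexp (c +i* om)) om ('i * cexp (c +i* om)).
  exact: (cderiv_exp (cderiv_pair (is_derive_const c om) (is_derive_idfun om))).
exists (expR v) => c /andP[uc cv]; split.
  by apply: cderiv_continuous => x; exists ('i * cexp (c +i* x)); exact: D2.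
by move=> om; split => //; rewrite cabs_cexp/= ler_expR ltW.
Qed.

Lemma cabs_cpowN_le c om w : u < c -> 0 <= w ->
  cabs (cpow c om (- w)) <= expR (- w * ln u).
Proof.
move=> uc w0; have c0 : 0 < c by exact: lt_trans uc.
rewrite cabs_cpow ler_expR !mulNr lerN2 ler_wpM2l//.
rewrite ler_pdivlMr// mulrC.
have -> : 2 * ln u = ln (u ^+ 2) by rewrite lnXn// mulr_natl.
rewrite ler_ln ?posrE ?exprn_gt0 ?normsq_gt0//.
by rewrite ler_wpDr ?sqr_ge0// lerXn2r ?nnegrE ?(ltW u0) ?(ltW c0) ?(ltW uc).
Qed.

Lemma holb_cpow w : 0 <= w -> holb u v (fun c om => cpow c om (- w))
  (fun c om => (- w)%:C * cpow c om (- (w + 1))).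
Proof.
move=> w0.
exists (expR (- w * ln u) + w * expR (- (w + 1) * ln u)) => c /andP[uc cv].
have c0 : 0 < c by exact: lt_trans uc.
have E om : cpow c om (- (w + 1)) = (c +i* om)^-1 * cpow c om (- w).
  by rewrite opprD cpowD [X in _ * X]cpowN cpow1// mulrC.
split.
  apply: ccontM; first exact: ccont_cst.
  by apply: cderiv_continuous => x; eexists; exact: (cpow_deriv_om x _ c0).
move=> om; split.
- by apply: (cderiv_eq (cpow_deriv_c _ _ c0)); rewrite E; ring.
- by apply: (cderiv_eq (cpow_deriv_om _ _ c0)); rewrite E; ring.
- by rewrite ler_wpDr ?mulr_ge0 ?expR_ge0// cabs_cpowN_le.
- rewrite cabsM cabs_real normrN ger0_norm// ler_wpDl ?expR_ge0//.
  by rewrite ler_wpM2l// cabs_cpowN_le// addr_ge0.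
Qed.

Lemma holb_bound F F' : holb u v F F' -> exists2 M, 0 <= M &
  forall c om, u < c < v -> cabs (F c om) <= M /\ cabs (F' c om) <= M.
Proof.
move=> [M H]; exists `|M| => // c om /H[_ /(_ om)[_ _ H1 H2]].
by split; [exact: le_trans H1 (ler_norm _)|exact: le_trans H2 (ler_norm _)].
Qed.

(** The integrands are kept in the form s^(-2) times a bounded holomorphic function, because
    |s|^(-2) = 1 / (c^2 + om^2) is integrable along the line. *)
Lemma line_integrable H H' c : holb u v H H' -> u < c < v ->
  cintegrable mu (fun om => cpow c om (- 2) * H c om).
Proof.
move=> hH cuv; have [M M0 HM] := holb_bound hH; have /andP[uc _] := cuv.
have c0 : 0 < c by exact: lt_trans uc.
apply: (@cintegrable_le _ (measurableTypeR R) R mu _ (fun om => M * (c ^+ 2 + om ^+ 2)^-1)).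
- apply: ccont_measurable; apply: ccontM; last exact: (holb_ccont hH cuv).
  by apply: cderiv_continuous => x; eexists; exact: (cpow_deriv_om x _ c0).
- move=> x; rewrite cabsM cabs_cpowN2// mulrC ler_wpM2r ?invr_ge0 ?(ltW (normsq_gt0 _ _))//.
  by have [] := HM c x cuv.
- exact: (@integrableZl _ (measurableTypeR R) _ mu _ measurableT M _ (invnormsq_integrable c0)).
Qed.

(** Cauchy's theorem for the strip. The derivative of the integral in c is the integral of [F'], and
    by the Cauchy-Riemann equations [F'] is - i times the derivative of [F] along the line. As [F]
    vanishes at both ends of the line, that integral is 0. *)
Lemma line_shift H H' c1 c2 : holb u v H H' -> u < c1 < v -> u < c2 < v ->
  cintegral mu (fun om => cpow c1 om (- 2) * H c1 om) =
  cintegral mu (fun om => cpow c2 om (- 2) * H c2 om).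
Proof.
move=> hH.
pose F c om := cpow c om (- 2) * H c om.
pose F' c om := cpow c om (- 2) * (H' c om - 2 * (c +i* om)^-1 * H c om).
have [M M0 HM] := holb_bound hH.
have [N HN] := hH.
have DF c om : u < c < v -> cderiv (F ^~ om) c (F' c om).
  move=> cuv; have /andP[uc _] := cuv; have c0 : 0 < c by exact: lt_trans uc.
  have [_ /(_ om)[H1 _ _ _]] := HN c cuv.
  apply: (cderiv_eq (cderivM (cpow_deriv_c om (- 2) c0) H1)).
  by rewrite /F' rmorphN rmorph_nat; ring.
have DFo c om : u < c < v -> cderiv (F c) om ('i * F' c om).
  move=> cuv; have /andP[uc _] := cuv; have c0 : 0 < c by exact: lt_trans uc.
  have [_ /(_ om)[_ H1 _ _]] := HN c cuv.
  apply: (cderiv_eq (cderivM (cpow_deriv_om om (- 2) c0) H1)).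
  by rewrite /F' rmorphN rmorph_nat; ring.
have cF' c : u < c < v -> ccont (F' c).
  move=> cuv; have /andP[uc _] := cuv; have c0 : 0 < c by exact: lt_trans uc.
  have cp w : ccont (fun om => cpow c om w).
    by apply: cderiv_continuous => x; eexists; exact: (cpow_deriv_om x _ c0).
  have [cH' _] := HN c cuv.
  have -> : F' c = (fun om => cpow c om (-2) * (H' c om + (- 2) * (cpow c om (-1) * H c om))).
    by apply/funext => om; rewrite /F' (cpowN c om 1) cpow1// mulNr mulrA.
  apply: ccontM => //; apply: ccontD => //; apply: ccontM; first exact: ccont_cst.
  by apply: ccontM => //; exact: (holb_ccont hH cuv).
have two : cabs (2 : R[i]) = 2.
  by rewrite -(rmorph_nat (real_complex R)) cabs_real ger0_norm.
have bF' c om : u < c < v -> cabs (F' c om) <= (M + 2 * u^-1 * M) * (u ^+ 2 + om ^+ 2)^-1.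
  move=> cuv; have /andP[uc _] := cuv; have c0 : 0 < c by exact: lt_trans uc.
  have [H1 H2] := HM c om cuv.
  rewrite cabsM mulrC ler_pM ?cabs_ge0//.
    rewrite (le_trans (cabsB _ _))// lerD// !cabsM two ler_pM ?mulr_ge0 ?cabs_ge0//.
    rewrite ler_wpM2l// cabsV lef_pV2 ?posrE//.
      by rewrite (le_trans (ltW uc))// (le_trans _ (normRe_le _))//= ler_norm.
    by rewrite (lt_le_trans c0)// (le_trans _ (normRe_le _))//= ler_norm.
  rewrite cabs_cpowN2// lef_pV2 ?posrE ?normsq_gt0// lerD2r.
  by rewrite lerXn2r ?nnegrE ?(ltW u0) ?(ltW c0) ?(ltW uc).
have iG : mu.-integrable setT (EFin \o (fun om => (M + 2 * u^-1 * M) * (u ^+ 2 + om ^+ 2)^-1)).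
  exact: (@integrableZl _ (measurableTypeR R) _ mu _ measurableT _ _ (invnormsq_integrable u0)).
have I0 c : u < c < v -> cintegral mu (F' c) = 0.
  move=> cuv; have /andP[uc _] := cuv; have c0 : 0 < c by exact: lt_trans uc.
  have [iR iI] := @cintegrable_le _ (measurableTypeR R) R mu _ _
    (ccont_measurable (cF' c cuv)) (fun om => bF' c om cuv) iG.
  have [cR cI] := cF' c cuv.
  have lim (P : R[i] -> R) (e : nat -> R) : (forall z, `|P z| <= cabs z) ->
      (forall n, e n ^+ 2 = n.+2%:R ^+ 2) -> P (F c (e n)) @[n --> \oo] --> 0.
    move=> Pc e2; apply: (@cvg0_squeeze _ _ (fun n => M * invS n)).
      move=> n; rewrite (le_trans (Pc _))// /F cabsM mulrC ler_pM ?cabs_ge0//.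
        by have [] := HM c (e n) cuv.
      rewrite cabs_cpowN2// e2 lef_pV2 ?posrE ?ltr_pwDr ?sqr_ge0//.
      rewrite ler_wpDl ?sqr_ge0// -natrX ler_nat.
      by rewrite (@leq_trans n.+2)// -mulnn leq_pmulr.
    by rewrite -[X in _ --> X](mulr0 M); apply: cvgMl_tmp; exact: cvg_invS.
  have eN n : (- n.+2%:R : R) ^+ 2 = n.+2%:R ^+ 2 by rewrite sqrrN.
  apply: eq_c.
  - have DI x : is_derive x (1 : R) (fun x => Im (F c x)) (Re (F' c x)).
      have [_] := DFo c x cuv; rewrite ImM/= mul0r mul1r add0r; apply.
    have [_] := FTC_T cR DI (lim (fun z => Im z) _ (@normIm_le R) eN) (lim (fun z => Im z) _ (@normIm_le R) (fun n => erefl)).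
    by rewrite subr0; apply.
  - have cNI : continuous (fun x => - Im (F' c x)) by move=> x; apply: cvgN; exact: cI.
    have DR x : is_derive x (1 : R) (fun x => Re (F c x)) (- Im (F' c x)).
      have [+ _] := DFo c x cuv; rewrite ReM/= mul0r mul1r sub0r; apply.
    have [_] := FTC_T cNI DR (lim (fun z => Re z) _ (@normRe_le R) eN) (lim (fun z => Re z) _ (@normRe_le R) (fun n => erefl)).
    rewrite subr0 => /(_ _)E.
    have iNI : mu.-integrable setT (EFin \o (fun x => - Im (F' c x))).
      have -> : EFin \o (fun x => - Im (F' c x)) = (fun x => (-1)%:E * (EFin \o (fun x => Im (F' c x))) x)%E.
        by apply/funext => x /=; rewrite -EFinM mulN1r.
      exact: (@integrableZl _ (measurableTypeR R) _ mu _ measurableT (-1) _ iI).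
    have := E iNI; under eq_Rintegral do rewrite -mulN1r.
    rewrite (@RintegralZl _ (measurableTypeR R))// mulN1r => /eqP.
    by rewrite oppr_eq0 => /eqP.
have DJ c : u < c < v -> cderiv (fun c => cintegral mu (F c)) c 0.
  move=> cuv; rewrite -(I0 c cuv).
  apply: (@cderiv_under_integral _ (measurableTypeR R) R mu F F' c u v
     (fun om => (M + 2 * u^-1 * M) * (u ^+ 2 + om ^+ 2)^-1)) => //.
  by move=> x xuv; exact: line_integrable hH xuv.
have key (f : R -> R) a b : (forall c, u < c < v -> is_derive c (1 : R) f 0) ->
    u < a < v -> u < b < v -> a < b -> f a = f b.
  move=> Df /andP[ua av] /andP[ub bv] ab.
  have [||x _] := @MVT R f (fun _ => 0) a b ab.
  - move=> x; rewrite in_itv/= => /andP[ax xb]; apply: Df.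
    by rewrite (lt_trans ua ax) (lt_trans xb bv).
  - apply: continuous_in_subspaceT => x; rewrite inE/= in_itv/= => /andP[ax xb].
    apply: (@is_derive_continuous _ _ _ 0); apply: Df.
    by rewrite (lt_le_trans ua ax) (le_lt_trans xb bv).
  by rewrite mul0r => /eqP; rewrite subr_eq0 => /eqP.
have key2 (f : R -> R) : (forall c, u < c < v -> is_derive c (1 : R) f 0) ->
    forall a b, u < a < v -> u < b < v -> f a = f b.
  move=> Df a b ha hb; have [ab|ab|->//] := ltgtP a b.
    exact: key ab.
  by apply/esym; exact: key ab.
move=> h1 h2; apply: eq_c.
  by apply: (key2 (fun c => Re (cintegral mu (F c)))) => // c /DJ[].
by apply: (key2 (fun c => Im (cintegral mu (F c)))) => // c /DJ[].
Qed.

End strip.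

(** * The sector condition *)

Section sector.
Context {R : realType}.
Implicit Types (x phi alpha lam c om : R).

Lemma cos_le_away delta x : 0 < delta -> delta <= `|x| -> `|x| <= 2 * pi - delta ->
  cos x <= cos delta.
Proof.
move=> d0 dx xd; rewrite -cos_norm; move: dx xd; move: `|x| => y dy yd.
have anti a b : 0 <= a -> a <= b -> b <= pi -> cos b <= cos a :> R.
  move=> a0 ab bpi; have bI : b \in `[0, pi] by rewrite in_itv/= bpi (le_trans a0 ab).
  have aI : a \in `[0, pi] by rewrite in_itv/= a0 (le_trans ab bpi).
  by rewrite leNgt ltr_cos// -leNgt.
have [ypi|piy] := leP y pi; first exact: anti (ltW d0) dy ypi.
have -> : cos y = cos (2 * pi - y).
  by rewrite -[RHS]cosN opprB -[RHS]cosD2pi mulr_natl subrK.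
by apply: anti => //; lra.
Qed.

Lemma sector_gap alpha phi : 0 < alpha -> `|phi| <= pi -> pi * alpha / 2 < `|phi| ->
  exists2 gam, 0 <= gam < 1 & forall x, `|x| <= pi / 2 -> cos (phi - alpha * x) <= gam.
Proof.
move=> a0 phipi sec; pose delta := `|phi| - pi * alpha / 2.
have d0 : 0 < delta by rewrite subr_gt0.
have pi0 : 0 < pi :> R := pi_gt0 R.
have dpi : delta <= pi.
  have : 0 <= pi * alpha / 2 by rewrite divr_ge0 ?mulr_ge0 ?(ltW a0) ?(ltW pi0).
  by rewrite /delta; lra.
(* All attainable arguments have absolute value between [delta] and 2 pi - [delta]. The maximum with
   0 is taken because the bound of [cabs_1B_ge] multiplies 2 rho <= 1 + rho^2 by [gam]. *)
exists (Num.max 0 (cos delta)).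
  rewrite le_max lexx/= gt_max ltr01/= -(@cos0 R) ltr_cos// in_itv/= ?lexx ?(ltW pi0)//.
  by rewrite (ltW d0).
move=> x xpi; rewrite le_max; apply/orP; right.
have ax : `|alpha * x| <= pi * alpha / 2.
  rewrite normrM (gtr0_norm a0) (_ : pi * alpha / 2 = alpha * (pi / 2)); last by field.
  by rewrite ler_wpM2l// ltW.
apply: cos_le_away => //.
  have := ler_normD (phi - alpha * x) (alpha * x); rewrite subrK /delta; lra.
have := ler_normB phi (alpha * x); rewrite /delta; lra.
Qed.

(** Expanding, |1 - q|^2 >= 1 - 2 gam rho + rho^2 >= (1 - gam) (1 + rho^2), since 2 rho <= 1 +
    rho^2; this is where the square root of 1 - gam comes from. *)
Lemma cabs_1B_ge (rho chi gam : R) : 0 <= rho -> 0 <= gam < 1 -> cos chi <= gam ->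
  let kap := Num.sqrt (1 - gam) in let q := rho%:C * cexpi chi in
  kap <= cabs (1 - q) /\ kap * rho <= cabs (1 - q).
Proof.
move=> r0 /andP[g0 g1] cg kap q.
have k0 : 0 <= kap by rewrite sqrtr_ge0.
have k2 : kap ^+ 2 = 1 - gam by rewrite sqr_sqrtr// subr_ge0 ltW.
have q2 : cabs (1 - q) ^+ 2 = 1 - 2 * (rho * cos chi) + rho ^+ 2.
  rewrite cabs_sqr ReD ImD ReN ImN Re_realM Im_realM/=.
  have := cos2Dsin2 chi; move: (cos chi) (sin chi) => C S CS.
  have -> : rho ^+ 2 = rho ^+ 2 * (C ^+ 2 + S ^+ 2) by rewrite CS mulr1.
  ring.
have rc : rho * cos chi <= rho * gam by rewrite ler_wpM2l.
have rg : 2 * (rho * gam) <= gam * (1 + rho ^+ 2).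
  have := mulr_ge0 g0 (sqr_ge0 (1 - rho)); rewrite sqrrB expr1n mul1r; lra.
split.
  rewrite -ler_sqr ?nnegrE ?cabs_ge0// q2 k2.
  have : 0 <= (1 - gam) * rho ^+ 2 by rewrite mulr_ge0 ?sqr_ge0// subr_ge0 ltW.
  lra.
rewrite -ler_sqr ?nnegrE ?mulr_ge0 ?cabs_ge0// q2 exprMn k2; lra.
Qed.

(* arg q = phi - alpha atan (om / c) has absolute value in an interval
   [|phi| - pi alpha / 2, |phi| + pi alpha / 2] contained in ]0, 2 pi[. *)
Lemma sector_bound alpha phi : 0 < alpha -> `|phi| <= pi -> pi * alpha / 2 < `|phi| ->
  exists2 kap, 0 < kap <= 1 & forall lam c om, 0 <= lam -> 0 < c ->
    let q := cexpi phi * lam%:C * cpow c om (- alpha) in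
    kap <= cabs (1 - q) /\ kap * cabs q <= cabs (1 - q).
Proof.
move=> a0 phipi sec; have [gam g01 Hg] := sector_gap a0 phipi sec.
have /andP[g0 g1] := g01.
exists (Num.sqrt (1 - gam)).
  rewrite sqrtr_gt0 subr_gt0 g1/= -[leRHS]sqrtr1 ler_wsqrtr//.
  by rewrite lerBlDr lerDl.
move=> lam c om l0 c0 q.
pose rho := lam * expR (- alpha * (ln (c ^+ 2 + om ^+ 2) / 2)).
have r0 : 0 <= rho by rewrite mulr_ge0// expR_ge0.
have qE : q = rho%:C * cexpi (phi - alpha * atan (om / c)).
  have cE : cpow c om (- alpha) = (expR (- alpha * (ln (c ^+ 2 + om ^+ 2) / 2)))%:C
      * cexpi (- (alpha * atan (om / c))).
    by rewrite -mulNr /cpow /cexp Re_realM Im_realM.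
  by rewrite /q cE /rho rmorphM cexpiD; ring.
have cq : cabs q = rho by rewrite qE cabsM cabs_expi mulr1 cabs_real ger0_norm.
rewrite cq qE; apply: cabs_1B_ge => //; apply: Hg.
by rewrite ler_norml ltW ?atan_gtNpi2//= ltW// atan_ltpi2.
Qed.

End sector.

(** * Power series with polynomial coefficients *)

Section summation.
Context {R : realType}.
Implicit Types (P : nat -> R) (q : R[i]).

Definition dif P k := P k.+1 - P k.

(* closed form of the tail of a power series with polynomial coefficients,
   obtained by repeated summation by parts *)
Definition tail5 (a b c d e : R) q : R[i] :=
  a%:C * (1 - q)^-1 + b%:C * (q * (1 - q)^-1 ^+ 2) +
  c%:C * (q ^+ 2 * (1 - q)^-1 ^+ 3) + d%:C * (q ^+ 3 * (1 - q)^-1 ^+ 4) +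
  e%:C * (q ^+ 4 * (1 - q)^-1 ^+ 5).

Definition difs P k q := tail5 (P k) (dif P k) (dif (dif P) k)
  (dif (dif (dif P)) k) (dif (dif (dif (dif P))) k) q.

(** The telescoping step of [sum_difs]: from k to k + 1 each difference grows by the next one, and
    the last is constant. With r = (1 - q)^(-1) the identity holds modulo q r = r - 1. *)
Lemma tail5_step (F : fieldType) (a b c d e q r Q : F) : (1 - q) * r = 1 ->
  Q * a = Q * (a * r + b * (q * r ^+ 2) + c * (q ^+ 2 * r ^+ 3) + d * (q ^+ 3 * r ^+ 4) +
     e * (q ^+ 4 * r ^+ 5)) -
   Q * q * ((a + b) * r + (b + c) * (q * r ^+ 2) + (c + d) * (q ^+ 2 * r ^+ 3) +
     (d + e) * (q ^+ 3 * r ^+ 4) + e * (q ^+ 4 * r ^+ 5)).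
Proof.
move=> H.
have H' : q * r = r - 1 by rewrite -H; ring.
ring: H'.
Qed.

Lemma sum_difs P q N : (forall k, dif (dif (dif (dif (dif P)))) k = 0) -> 1 - q != 0 ->
  \sum_(0 <= k < N) (P k)%:C * q ^+ k = difs P 0 q - q ^+ N * difs P N q.
Proof.
move=> P5 q1; elim: N => [|N IH]; first by rewrite big_geq// expr0 mul1r subrr.
rewrite big_nat_recr//= IH.
have S A : A N.+1 = A N + dif A N by rewrite /dif addrC subrK.
have H : (1 - q) * (1 - q)^-1 = 1 by rewrite mulfV.
have e : dif (dif (dif (dif P))) N.+1 = dif (dif (dif (dif P))) N.
  by apply/eqP; rewrite -subr_eq0; exact/eqP/P5.
have E : (P N)%:C * q ^+ N = q ^+ N * difs P N q - q ^+ N.+1 * difs P N.+1 q.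
  rewrite /difs e (S P) (S (dif P)) (S (dif (dif P))) (S (dif (dif (dif P)))) /tail5.
  move: (P N) (dif P N) (dif (dif P) N) (dif (dif (dif P)) N)
    (dif (dif (dif (dif P))) N) => a b c d f.
  rewrite !rmorphD (exprSr q N) mulrC.
  exact: tail5_step.
by rewrite E addrA subrK.
Qed.

(** Each term is (1 - q)^(-1) times a power of q / (1 - q) of exponent at most 4, so bounds for
    these two quantities are enough; [1 <= y] reduces all exponents to 4. *)
Lemma cabs_tail5 (a b c d e : R) q (x y : R) :
  cabs (1 - q)^-1 <= x -> cabs (q * (1 - q)^-1) <= y -> 1 <= y ->
  cabs (tail5 a b c d e q) <= (`|a| + `|b| + `|c| + `|d| + `|e|) * (x * y ^+ 4).
Proof.
move=> hx hy y1.
have x0 : 0 <= x by rewrite (le_trans _ hx)// cabs_ge0.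
have y0 : 0 <= y by rewrite (le_trans _ y1).
have T j f : (j <= 4)%N -> cabs (f%:C * (q ^+ j * (1 - q)^-1 ^+ j.+1)) <= `|f| * (x * y ^+ 4).
  move=> j4; rewrite cabsM cabs_real ler_wpM2l//.
  have -> : q ^+ j * (1 - q)^-1 ^+ j.+1 = (1 - q)^-1 * (q * (1 - q)^-1) ^+ j.
    by rewrite exprMn exprS mulrCA.
  rewrite cabsM cabsX ler_pM ?cabs_ge0 ?exprn_ge0 ?cabs_ge0//.
  rewrite (le_trans (_ : _ <= y ^+ j))//.
    by rewrite lerXn2r ?nnegrE ?cabs_ge0.
  by rewrite ler_weXn2l.
rewrite !mulrDl /tail5.
have T0 := T 0%N a isT; rewrite expr0 mul1r expr1 in T0.
have T1 := T 1%N b isT; rewrite expr1 in T1.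
do 3 (rewrite (le_trans (cabsD _ _))// lerD//; last exact: T).
by rewrite (le_trans (cabsD _ _))// lerD.
Qed.

(** 17 = 2^4 + 1, because k + 2 <= 2 (k + 1). *)
Lemma dif_bound P (B : R) : 0 <= B -> (forall k, `|P k| <= B * k.+1%:R ^+ 4) ->
  forall k, `|dif P k| <= (17 * B) * k.+1%:R ^+ 4.
Proof.
move=> B0 HP k; rewrite (le_trans (ler_normB _ _))//.
rewrite (_ : 17 * B * k.+1%:R ^+ 4 = B * (2 * k.+1%:R) ^+ 4 + B * k.+1%:R ^+ 4); last by ring.
rewrite lerD// (le_trans (HP _))// ler_wpM2l// lerXn2r ?nnegrE ?mulr_ge0//.
by rewrite -natrM ler_nat mul2n -addnn addSn ltnS leq_addl.
Qed.

End summation.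

(** * Reciprocal values of Gamma *)

Section gamma_recurrence.
Context {R : realType}.
Local Notation mu := (@lebesgue_measure R).
Implicit Types (w : R).

Lemma Gamma_succ w : 0 < w -> Gamma (w + 1) = w * Gamma w.
Proof.
move=> w0; have H := gam_parts 0 1 0 w0.
have E v : \int[mu]_t gam v t = \int[mu]_t (gam v t * (0 * sin (0 * t) + 1 * cos (0 * t))).
  by apply: eq_Rintegral => t _; rewrite mul0r mul0r cos0 add0r mul1r mulr1.
rewrite !GammaE (E w); apply: (etrans _ (esym H)).
by apply: eq_Rintegral => t _; rewrite !mul0r addr0 mul0r cos0 subr0 add0r !mulr1.
Qed.

(* w (w + 1) (w + 2) (w + 3) shifts the argument of Gamma above 3, where the
   inversion integral converges absolutely. *)
Definition rise4 w : R := w * (w + 1) * (w + 2) * (w + 3).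

Lemma Gamma_rise4 w : 0 < w -> Gamma (w + 4) = rise4 w * Gamma w.
Proof.
move=> w0.
rewrite (_ : w + 4 = w + 1 + 1 + 1 + 1); last by ring.
rewrite !Gamma_succ ?addr_gt0// /rise4; ring.
Qed.

(** Read off from the inversion formula: a product with the factor Gamma(w + 4) equals 2 pi. *)
Lemma Gamma_neq0 w : 0 < w -> Gamma w != 0.
Proof.
move=> w0; have w3 : 3 <= w + 4 by lra.
have [_ H] := Gamma_inversion w3.
have H4 : Gamma (w + 4) != 0.
  apply/eqP => G0; have /eqP := H; rewrite G0 mul0r eq_sym eq_complex/= eqxx andbT.
  by rewrite mulf_eq0 pnatr_eq0/= gt_eqF// pi_gt0.
by move: H4; rewrite Gamma_rise4// mulf_eq0 negb_or => /andP[].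
Qed.

Lemma Gamma_inv w : 0 < w -> ((Gamma w)%:C)^-1 =
  ((2 * pi)^-1)%:C * ((rise4 w)%:C *
    cintegral mu (fun om => cexp (1 +i* om) * cpow 1 om (- (w + 4)))).
Proof.
move=> w0; have w3 : 3 <= w + 4 by lra.
have [_ H] := Gamma_inversion w3; have G0 := Gamma_neq0 w0.
move: H; rewrite Gamma_rise4// rmorphM.
move: (cintegral mu _) => J H.
have G0' : (Gamma w)%:C != 0 :> R[i] by rewrite eq_complex/= eqxx andbT.
have p0 : (2 * pi)%:C != 0 :> R[i].
  by rewrite eq_complex/= eqxx andbT mulf_eq0 pnatr_eq0/= gt_eqF// pi_gt0.
apply: (mulfI G0'); rewrite mulfV//.
have -> : (Gamma w)%:C * (((2 * pi)^-1)%:C * ((rise4 w)%:C * J)) =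
    ((2 * pi)^-1)%:C * ((rise4 w)%:C * (Gamma w)%:C * J) by ring.
rewrite H -rmorphM/= mulVf ?rmorph1//.
by rewrite mulf_eq0 pnatr_eq0/= gt_eqF// pi_gt0.
Qed.

(** The coefficients have degree 4 in k, which is why [tail5] has five terms. *)
Lemma dif5_rise4 (a b : R) k :
  dif (dif (dif (dif (dif (fun k => rise4 (a * k%:R + b)))))) k = 0.
Proof. by rewrite /dif /rise4; ring. Qed.

(** Each of the four factors is at most x + 3 <= (a + b + 3) (k + 1). *)
Lemma rise4_bound (a b : R) k : 0 < a -> 0 < b ->
  `|rise4 (a * k%:R + b)| <= (a + b + 3) ^+ 4 * k.+1%:R ^+ 4.
Proof.
move=> a0 b0; set x := a * k%:R + b.
have x0 : 0 <= x by rewrite addr_ge0 ?mulr_ge0// ltW.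
have k0 : 0 <= k%:R :> R by [].
have hx : x + 3 <= (a + b + 3) * k.+1%:R.
  rewrite -natr1 /x; have := mulr_ge0 (ltW b0) k0; nra.
rewrite -exprMn (le_trans (_ : _ <= (x + 3) ^+ 4))//.
  rewrite ger0_norm /rise4; last first.
    by apply: mulr_ge0; [apply: mulr_ge0; [apply: mulr_ge0|]|] => //; apply: addr_ge0.
  rewrite (_ : (x + 3) ^+ 4 = (x + 3) * (x + 3) * (x + 3) * (x + 3)); last by ring.
  have l0 : x <= x + 3 by lra.
  have l1 : x + 1 <= x + 3 by lra.
  have l2 : x + 2 <= x + 3 by lra.
  have h1 : 0 <= x + 1 by lra.
  have h2 : 0 <= x + 2 by lra.
  have h3 : 0 <= x + 3 by lra.
  exact: (ler_pM (mulr_ge0 (mulr_ge0 x0 h1) h2) h3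
    (ler_pM (mulr_ge0 x0 h1) h2 (ler_pM x0 h1 l0 l1) l2) (lexx _)).
have h3 : 0 <= x + 3 by lra.
by rewrite lerXn2r ?nnegrE ?(le_trans h3).
Qed.

End gamma_recurrence.

(** * Closure properties of bounded holomorphic functions on a strip *)

Section holomorphic.
Context {R : realType}.
Variables (u v : R).
Hypothesis u0 : 0 < u.

(** Hides the derivative, so that composite integrands can be treated without writing theirs out. *)
Definition hol (F : R -> R -> R[i]) := exists F', holb u v F F'.

Lemma hol_cst (z : R[i]) : hol (fun _ _ => z).
Proof. by eexists; exact: holb_cst. Qed.

Lemma holD F G : hol F -> hol G -> hol (fun c om => F c om + G c om).
Proof. by move=> [F' HF] [G' HG]; eexists; exact: holbD HF HG. Qed.

Lemma holM F G : hol F -> hol G -> hol (fun c om => F c om * G c om).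
Proof. by move=> [F' HF] [G' HG]; eexists; exact: holbM HF HG. Qed.

Lemma holX F k : hol F -> hol (fun c om => F c om ^+ k).
Proof.
move=> hF; elim: k => [|k IH]; first exact: hol_cst.
have -> : (fun c om => F c om ^+ k.+1) = (fun c om => F c om * F c om ^+ k).
  by apply/funext => c; apply/funext => om; rewrite exprS.
exact: holM.
Qed.

Lemma holV F (kap : R) : 0 < kap ->
  (forall c om, u < c < v -> kap <= cabs (F c om)) -> hol F ->
  hol (fun c om => (F c om)^-1).
Proof. by move=> k0 Fk [F' HF]; eexists; exact: holbV k0 Fk HF. Qed.

Lemma hol_cexp : hol (fun c om => cexp (c +i* om)).
Proof. by eexists; exact: holb_cexp. Qed.

Lemma hol_cpow w : 0 <= w -> hol (fun c om => cpow c om (- w)).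
Proof. by move=> w0; eexists; exact: holb_cpow. Qed.

Lemma hol_tail5 (a b c d e kap : R) q : 0 < kap -> hol q ->
  (forall x om, u < x < v -> kap <= cabs (1 - q x om)) ->
  hol (fun x om => tail5 a b c d e (q x om)).
Proof.
move=> k0 hq Hk.
have h1 : hol (fun x om => (1 - q x om)^-1).
  apply: (holV k0 Hk).
  have -> : (fun x om => 1 - q x om) = (fun x om => 1 + (-1) * q x om).
    by apply/funext => x; apply/funext => om; rewrite mulN1r.
  by apply: holD; [exact: hol_cst|apply: holM => //; exact: hol_cst].
have hc (f : R) F : hol F -> hol (fun x om => f%:C * F x om).
  by move=> hF; apply: holM => //; exact: hol_cst.
exact: (holD (holD (holD (holD (hc a _ h1) (hc b _ (holM hq (holX 2 h1))))
  (hc c _ (holM (holX 2 hq) (holX 3 h1)))) (hc d _ (holM (holX 3 hq) (holX 4 h1))))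
  (hc e _ (holM (holX 4 hq) (holX 5 h1)))).
Qed.

End holomorphic.

Section product_bounds.
Context {R : realType}.
Implicit Types (a b e l p x y : R).

(** Bookkeeping for [ml_decay]: [e] is |e^s|, [x] is |s^(- beta - 4)| and [y] is the modulus of the
    closed form. In the next lemma [l] is lam and [p] is |s|^alpha. *)
Lemma ler_pM_swap a b e x y : 0 <= e -> 0 <= x -> 0 <= y -> x <= b -> y <= a ->
  e * x * y <= e * a * b.
Proof.
move=> e0 x0 y0 xb ya; rewrite -!mulrA ler_wpM2l// mulrC.
exact: ler_pM.
Qed.

Lemma ler_pM_ratio a b e l p x y : 0 <= e -> 0 <= x -> 0 <= a -> l * y <= a * p -> p * x <= b ->
  l * (e * x * y) <= e * a * b.
Proof.
move=> e0 x0 a0 lya pxb.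
have -> : l * (e * x * y) = e * ((l * y) * x) by ring.
rewrite -[leRHS]mulrA ler_wpM2l// (le_trans (ler_wpM2r x0 lya))// -mulrA.
exact: ler_wpM2l.
Qed.

End product_bounds.

(** * The Mittag-Leffler function as an integral over a vertical line *)

Section representation.
Context {R : realType}.
Local Notation mu := (@lebesgue_measure R).
Variables (alpha beta phi : R).
Hypothesis a0 : 0 < alpha.
Hypothesis a2 : alpha < 2.
Hypothesis b0 : 0 < beta.
Hypothesis phi_le : `|phi| <= pi.
Hypothesis sec : pi * alpha / 2 < `|phi|.
Implicit Types (lam c om : R).

(** [P k] is the coefficient produced by the shift of Gamma by 4. [H] and [G] carry the exponent of
    s raised by 2 only, because [line_integrable] and [line_shift] supply the remaining s^(-2). *)
Let P k : R := rise4 (alpha * k%:R + beta).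
Let qq lam c om : R[i] := cexpi phi * lam%:C * cpow c om (- alpha).
Let H lam c om : R[i] :=
  cexp (c +i* om) * cpow c om (- (beta + 2)) * difs P 0 (qq lam c om).
Let G k c om : R[i] := cexp (c +i* om) * cpow c om (- (alpha * k%:R + beta + 2)).

(* [difs P 0 q] is the sum of the series of the [P k * q ^+ k]. *)
Definition ml_line lam : R[i] :=
  ((2 * pi)^-1)%:C * cintegral mu (fun om => cpow 1 om (- 2) * H lam 1 om).

Let arg_gt0 k : 0 < alpha * k%:R + beta.
Proof. by rewrite ltr_wpDl// mulr_ge0// ltW. Qed.

(** The strips start at Re s = 1 / 2, so that they contain the line Re s = 1. *)
Let half0 : 0 < 2^-1 :> R. Proof. by rewrite invr_gt0. Qed.

Let kap_ex := sector_bound a0 phi_le sec.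

Let holH lam v : 0 <= lam -> hol 2^-1 v (H lam).
Proof.
move=> l0; have [kap /andP[k0 _] Hk] := kap_ex.
apply: holM; first apply: holM.
- exact: hol_cexp.
- by apply: hol_cpow => //; rewrite addr_ge0// ltW.
- apply: (hol_tail5 _ _ _ _ _ k0).
    by apply: holM; [exact: hol_cst|apply: hol_cpow => //; exact: ltW].
  by move=> c om /andP[c0 _]; have [] := Hk lam c om l0 (lt_trans half0 c0).
Qed.

Let holG k v : hol 2^-1 v (G k).
Proof.
apply: holM; first exact: hol_cexp.
by apply: hol_cpow => //; rewrite addr_ge0// ltW// arg_gt0.
Qed.

Let decay c om lam : 0 <= lam -> 1 < c ->
  cabs (cexp (c +i* om) * cpow c om (- (beta + 4))) <= expR c * (c ^+ 2 + om ^+ 2)^-1.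
Proof.
move=> l0 c1; rewrite cabsM cabs_cexp/= ler_wpM2l ?expR_ge0//.
rewrite -cabs_cpowN2 ?(lt_trans _ c1)//.
by apply: cabs_cpow_le; [exact: ltW|have := b0; lra].
Qed.

(** Since C^alpha = 32 (lam + 1), one gets |q| <= lam / (32 (lam + 1)); using lam + 1 covers lam =
    0, and C + 1 exceeds 1. The number 32 = 2^5 lets |q|^N beat the growth (N + 1)^4 of the
    coefficients with a factor 1 / (N + 1) to spare. *)
Let big_c lam : 0 <= lam -> exists2 c, 1 < c & forall om, cabs (qq lam c om) <= 32^-1.
Proof.
move=> l0; pose C := (32 * (lam + 1)) `^ (alpha^-1).
have l1 : 0 < 32 * (lam + 1) by lra.
have C0 : 0 < C by rewrite powR_gt0.
exists (C + 1); first by rewrite ltrDr.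
move=> om; rewrite /qq cabsM cabsM cabs_expi mul1r cabs_real ger0_norm//.
have C1 : C < C + 1 by rewrite ltrDl.
apply: (le_trans (ler_wpM2l l0 (cabs_cpowN_le C0 om C1 (ltW a0)))).
have -> : expR (- alpha * ln C) = (32 * (lam + 1))^-1.
  rewrite /C ln_powR mulrA mulNr mulfV ?gt_eqF// mulN1r expRN lnK//.
rewrite ler_pdivrMr//; lra.
Qed.

(** [Gamma_inv] represents the term on Re s = 1, and each single term can be shifted to any line
    with c > 1, in particular to one where the series converges. The power z^k s^(- alpha k) is
    q^k. *)
Lemma ml_term_line lam c k : 0 <= lam -> 1 < c ->
  cintegrable mu (fun om => cexp (c +i* om) * cpow c om (- (beta + 4)) *
    ((P k)%:C * qq lam c om ^+ k)) /\
  mittag_leffler_term alpha beta (cexpi phi * lam%:C) k =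
  ((2 * pi)^-1)%:C * cintegral mu (fun om => cexp (c +i* om) * cpow c om (- (beta + 4)) *
    ((P k)%:C * qq lam c om ^+ k)).
Proof.
move=> l0 c1; set z := cexpi phi * lam%:C.
have [G' hG] := holG k (c + 1).
have cI : 2^-1 < c < c + 1 by rewrite ltrDl ltr01 andbT; lra.
have I1 : (2^-1 : R) < 1 < c + 1 by rewrite invf_lt1 ?ltr1n//=; lra.
have iG := line_integrable half0 hG cI.
have E : (fun om => cexp (c +i* om) * cpow c om (- (beta + 4)) *
    ((P k)%:C * qq lam c om ^+ k)) =
    (fun om => ((P k)%:C * z ^+ k) * (cpow c om (- 2) * G k c om)).
  apply/funext => om; rewrite /qq -/z exprMn -cpowMn /G.
  have -> : - (beta + 4) = - 2 - (beta + 2) by ring.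
  have -> : - (alpha * k%:R + beta + 2) = - alpha * k%:R + (- (beta + 2)) by ring.
  by rewrite !cpowD; ring.
split; first by rewrite E; exact: (@cintegrableZl _ (measurableTypeR R)).
rewrite E.
have -> : cintegral mu (fun om => (P k)%:C * z ^+ k * (cpow c om (-2) * G k c om)) =
    (P k)%:C * z ^+ k * cintegral mu (fun om => cpow c om (-2) * G k c om).
  exact: (@cintegralZl _ (measurableTypeR R)).
have -> : cintegral mu (fun om => cpow c om (-2) * G k c om) =
    cintegral mu (fun om => cpow 1 om (-2) * G k 1 om).
  exact: (line_shift half0 hG cI I1).
have J : cintegral mu (fun om => cpow 1 om (-2) * G k 1 om) =
   cintegral mu (fun om => cexp (1 +i* om) * cpow 1 om (- (alpha * k%:R + beta + 4))).
  apply: (@eq_cintegral _ (measurableTypeR R)) => om; rewrite /G.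
  have -> : - (alpha * k%:R + beta + 4) = - 2 + (- (alpha * k%:R + beta + 2)) by ring.
  by rewrite cpowD; ring.
rewrite J /mittag_leffler_term -/z Gamma_inv//.
by rewrite -/(P k); move: (cintegral mu _) => j; ring.
Qed.

(** On the far line the partial sum differs from the closed form by q^N times the tail [difs P N q],
    which is O(1 / (N + 1)) uniformly in om. The closed form, holomorphic on the whole strip, is
    then shifted back to Re s = 1. *)
Lemma ml_partial_cvg lam : 0 <= lam -> exists2 K : R, 0 <= K & forall N,
  cabs (\sum_(0 <= k < N) mittag_leffler_term alpha beta (cexpi phi * lam%:C) k
    - ml_line lam) <= K * invS N.
Proof.
move=> l0; have [c c1 Hc] := big_c l0.
have c0 : 0 < c by lra.
have cI : 2^-1 < c < c + 1 by rewrite ltrDl ltr01 andbT; lra.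
have I1 : (2^-1 : R) < 1 < c + 1 by rewrite invf_lt1 ?ltr1n//=; lra.
have [H' hH] := holH (c + 1) l0.
pose E om : R[i] := cexp (c +i* om) * cpow c om (- (beta + 4)).
pose F k om : R[i] := E om * ((P k)%:C * qq lam c om ^+ k).
have iF k : cintegrable mu (F k) by have [] := ml_term_line k l0 c1.
have iH := line_integrable half0 hH cI.
pose B := (alpha + beta + 3) ^+ 4.
have B0 : 0 <= B by rewrite exprn_ge0// !addr_ge0// ltW.
have b1 k : `|P k| <= B * k.+1%:R ^+ 4 by exact: rise4_bound.
have b2 := dif_bound B0 b1.
have b3 := dif_bound (mulr_ge0 (ler0n _ 17) B0) b2.
have b4 := dif_bound (mulr_ge0 (ler0n _ 17) (mulr_ge0 (ler0n _ 17) B0)) b3.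
have b5 := dif_bound (mulr_ge0 (ler0n _ 17) (mulr_ge0 (ler0n _ 17) (mulr_ge0 (ler0n _ 17) B0))) b4.
pose S := B + 17 * B + 17 * (17 * B) + 17 * (17 * (17 * B)) + 17 * (17 * (17 * (17 * B))).
have m17 (x : R) : 0 <= x -> 0 <= 17 * x by apply: mulr_ge0.
have S0 : 0 <= S by rewrite /S !addr_ge0 ?m17.
have q1 om : 2^-1 <= cabs (1 - qq lam c om).
  have := cabsD (1 - qq lam c om) (qq lam c om); rewrite subrK cabs1.
  by have := Hc om; lra.
have q1n om : 1 - qq lam c om != 0.
  by apply/eqP => q0; have := q1 om; rewrite q0 cabs0 leNgt half0.
have V om : cabs (1 - qq lam c om)^-1 <= 2.
  rewrite cabsV -[leRHS]invrK lef_pV2 ?posrE//; exact: lt_le_trans half0 (q1 om).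
have bound om N : cabs (qq lam c om ^+ N * difs P N (qq lam c om)) <= 2 * S * invS N.
  have V2 : cabs (qq lam c om * (1 - qq lam c om)^-1) <= 1.
    rewrite cabsM (le_trans (ler_pM (cabs_ge0 _) (cabs_ge0 _) (Hc om) (V om)))//; lra.
  have := cabs_tail5 (P N) (dif P N) (dif (dif P) N) (dif (dif (dif P)) N)
     (dif (dif (dif (dif P))) N) (V om) V2 (lexx 1).
  rewrite -/(difs P N _) expr1n mulr1 => T.
  have TS : cabs (difs P N (qq lam c om)) <= 2 * S * N.+1%:R ^+ 4.
    have sumS := lerD (lerD (lerD (lerD (b1 N) (b2 N)) (b3 N)) (b4 N)) (b5 N).
    rewrite -!mulrDl -/S in sumS.
    apply: (le_trans T); rewrite (_ : 2 * S * N.+1%:R ^+ 4 = S * N.+1%:R ^+ 4 * 2).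
      by apply: ler_wpM2r.
    by rewrite -mulrA mulrC.
  rewrite cabsM cabsX (_ : 2 * S * invS N = (32^-1) ^+ N * (2 * S * (32 ^+ N * invS N))); last first.
    rewrite exprVn; field.
    by rewrite expf_neq0.
  rewrite ler_pM ?exprn_ge0 ?cabs_ge0//.
    by rewrite lerXn2r ?nnegrE ?cabs_ge0.
  rewrite (le_trans TS)// ler_wpM2l ?mulr_ge0//.
  (* This is (N + 1)^5 <= (2^N)^5 = 32^N. *)
  rewrite /invS ler_pdivlMr// -exprSr -!natrX ler_nat.
  rewrite (_ : 32%N = (2 ^ 5)%N)// -expnM mulnC expnM.
  by rewrite leq_exp2r// ltn_expl.
have bE om : cabs (E om) <= expR c * (c ^+ 2 + om ^+ 2)^-1 by exact: (decay om l0 c1).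
have iC := @integrableZl _ (measurableTypeR R) _ mu _ measurableT (expR c) _ (invnormsq_integrable c0).
pose I := \int[mu]_om (expR c * (c ^+ 2 + om ^+ 2)^-1).
have I0 : 0 <= I.
  apply: Rintegral_ge0 => x _; rewrite mulr_ge0 ?expR_ge0// invr_ge0 ltW//.
  exact: normsq_gt0.
exists ((2 * pi)^-1 * (2 * (2 * S * I))).
  by rewrite !mulr_ge0// invr_ge0 mulr_ge0// pi_ge0.
move=> N.
have [iS SE] := @cintegral_sum _ (measurableTypeR R) R mu N F iF.
pose D om := \sum_(0 <= k < N) F k om + (-1) * (cpow c om (-2) * H lam c om).
have DE om : D om = - (E om * (qq lam c om ^+ N * difs P N (qq lam c om))).
  rewrite /D /F -mulr_sumr sum_difs//; last exact: dif5_rise4.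
  have -> : cpow c om (-2) * H lam c om = E om * difs P 0 (qq lam c om).
    rewrite /H /E; have -> : - (beta + 4) = - 2 + (- (beta + 2)) by ring.
    by rewrite cpowD; ring.
  by ring.
have iN : cintegrable mu (fun om => (-1) * (cpow c om (-2) * H lam c om)).
  exact: (@cintegrableZl _ (measurableTypeR R)).
have iD : cintegrable mu D by exact: (@cintegrableD _ (measurableTypeR R) R mu _ _ iS iN).
have ID : cintegral mu D = \sum_(0 <= k < N) cintegral mu (F k) -
    cintegral mu (fun om => cpow 1 om (-2) * H lam 1 om).
  apply: (etrans (@cintegralD _ (measurableTypeR R) R mu _ _ iS iN)).
  congr (_ + _); first exact: SE.
  apply: (etrans (@cintegralZl _ (measurableTypeR R) R mu _ _ iH)).
  by rewrite mulN1r; congr (- _); exact: (line_shift half0 hH cI I1).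
have -> : \sum_(0 <= k < N) mittag_leffler_term alpha beta (cexpi phi * lam%:C) k -
    ml_line lam = ((2 * pi)^-1)%:C * cintegral mu D.
  rewrite ID mulrBr mulr_sumr /ml_line; congr (_ - _).
  by apply: eq_bigr => k _; have [] := ml_term_line k l0 c1.
rewrite cabsM cabs_real ger0_norm; last by rewrite invr_ge0 mulr_ge0// pi_ge0.
rewrite -[leRHS]mulrA ler_wpM2l ?invr_ge0 ?mulr_ge0 ?pi_ge0//.
have bD om : cabs (D om) <= (2 * S * invS N) * (expR c * (c ^+ 2 + om ^+ 2)^-1).
  by rewrite DE cabsN cabsM mulrC ler_pM ?cabs_ge0.
have iCN := @integrableZl _ (measurableTypeR R) _ mu _ measurableT (2 * S * invS N) _ iC.
have := @cabs_cintegral _ (measurableTypeR R) R mu _ _ (cintegrable_measurable iD) bD iCN.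
have -> : \int[mu]_x (2 * S * invS N * (expR c * (c ^+ 2 + x ^+ 2)^-1)) = 2 * S * invS N * I.
  exact: (@RintegralZl _ (measurableTypeR R)).
have R4 (x y z : R) : 2 * (2 * x * y * z) = 2 * (2 * x * z) * y by ring.
by rewrite R4.
Qed.

Lemma ml_cvg lam : 0 <= lam ->
  series (fun k => Re (mittag_leffler_term alpha beta (cexpi phi * lam%:C) k)) @ \oo
    --> Re (ml_line lam) /\
  series (fun k => Im (mittag_leffler_term alpha beta (cexpi phi * lam%:C) k)) @ \oo
    --> Im (ml_line lam).
Proof.
move=> l0; have [K K0 HK] := ml_partial_cvg l0.
have key (p : R[i] -> R) : (forall z w, p (z - w) = p z - p w) -> (forall z, `|p z| <= cabs z) ->
    (fun N => p (\sum_(0 <= k < N) mittag_leffler_term alpha beta (cexpi phi * lam%:C) k)) @ \oo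
     --> p (ml_line lam).
  move=> pB pc; apply/subr_cvg0; apply: (@cvg0_squeeze _ _ (fun N => K * invS N)).
    by move=> N; rewrite -pB (le_trans (pc _)).
  by rewrite -[X in _ --> X](mulr0 K); apply: cvgMl_tmp; exact: cvg_invS.
pose t k := mittag_leffler_term alpha beta (cexpi phi * lam%:C) k.
have ER : series (fun k => Re (t k)) = (fun N => Re (\sum_(0 <= k < N) t k)).
  by apply/funext => N; rewrite Re_sum.
have EI : series (fun k => Im (t k)) = (fun N => Im (\sum_(0 <= k < N) t k)).
  by apply/funext => N; rewrite Im_sum.
have RB (z w : R[i]) : Re (z - w) = Re z - Re w by rewrite ReD ReN.
have IB (z w : R[i]) : Im (z - w) = Im z - Im w by rewrite ImD ImN.
split; first by rewrite ER; exact: (key (fun z => Re z) RB (@normRe_le R)).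
by rewrite EI; exact: (key (fun z => Im z) IB (@normIm_le R)).
Qed.

Lemma ml_lineE lam : 0 <= lam ->
  mittag_leffler alpha beta (cexpi phi * lam%:C) = ml_line lam.
Proof.
move=> l0; have [hR hI] := ml_cvg l0; rewrite /mittag_leffler.
by apply: eq_c; [exact: (cvg_lim _ hR)|exact: (cvg_lim _ hI)].
Qed.

Lemma ml_measurable d (T : measurableType d) (r : T -> R) :
  measurable_fun setT r -> (forall x, 0 <= r x) ->
  cmeasurable (fun x => mittag_leffler alpha beta (cexpi phi * (r x)%:C)).
Proof.
move=> mr r0.
have mt k : cmeasurable (fun x => mittag_leffler_term alpha beta (cexpi phi * (r x)%:C) k).
  rewrite /mittag_leffler_term; apply: cmeasurableM; last exact: cmeasurable_cst.
  elim: k => [|k IH]; first exact: cmeasurable_cst.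
  under eq_fun do rewrite exprS; apply: cmeasurableM => //.
  by apply: cmeasurableM; [exact: cmeasurable_cst|exact: cmeasurable_real].
split.
- apply: (@measurable_fun_cvg _ _ _ _ (fun N x => \sum_(0 <= k < N)
    Re (mittag_leffler_term alpha beta (cexpi phi * (r x)%:C) k))).
    by move=> N; apply: measurable_sum => k; have [] := mt k.
  by move=> x _; rewrite ml_lineE//; exact: (ml_cvg (r0 x)).1.
- apply: (@measurable_fun_cvg _ _ _ _ (fun N x => \sum_(0 <= k < N)
    Im (mittag_leffler_term alpha beta (cexpi phi * (r x)%:C) k))).
    by move=> N; apply: measurable_sum => k; have [] := mt k.
  by move=> x _; rewrite ml_lineE//; exact: (ml_cvg (r0 x)).2.
Qed.

(** The first bound uses |1 - q| >= kap in the factor (1 - q)^(-1). The second uses |1 - q| >= kap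
    |q| there, which gains |q|^(-1) = |s|^alpha / lam; the growth |s|^alpha is absorbed by s^(- beta
    - 4), leaving at most |s|^(-2) because alpha < 2. *)
Lemma ml_decay : exists2 K, 0 <= K & forall lam, 0 <= lam ->
  cabs (mittag_leffler alpha beta (cexpi phi * lam%:C)) <= K /\
  lam * cabs (mittag_leffler alpha beta (cexpi phi * lam%:C)) <= K.
Proof.
have [kap /andP[k0 k1] Hk] := kap_ex.
pose S := `|P 0%N| + `|dif P 0| + `|dif (dif P) 0| + `|dif (dif (dif P)) 0| +
  `|dif (dif (dif (dif P))) 0|.
have S0 : 0 <= S by rewrite /S !addr_ge0.
pose M := expR 1 * (S * (kap^-1 * kap^-1 ^+ 4)).
have kV : 1 <= kap^-1 by rewrite invf_ge1.
have kV0 : 0 <= kap^-1 by rewrite invr_ge0 ltW.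
have M0 : 0 <= M by rewrite !mulr_ge0 ?expR_ge0 ?exprn_ge0.
pose I := \int[mu]_om (M * (1 ^+ 2 + om ^+ 2)^-1).
have iM := @integrableZl _ (measurableTypeR R) _ mu _ measurableT M _ (invnormsq_integrable (@ltr01 R)).
have I0 : 0 <= I.
  by apply: Rintegral_ge0 => x _; rewrite mulr_ge0// invr_ge0 ltW// normsq_gt0.
have p0 : 0 <= (2 * pi)^-1 :> R by rewrite invr_ge0 mulr_ge0// pi_ge0.
have qV lam om : 0 <= lam -> cabs (qq lam 1 om * (1 - qq lam 1 om)^-1) <= kap^-1.
  move=> l0; have [h1 h2] := Hk lam 1 om l0 ltr01.
  have n0 : 0 < cabs (1 - qq lam 1 om) by exact: lt_le_trans h1.
  by rewrite cabsM cabsV ler_pdivrMr// mulrC ler_pdivlMr// mulrC.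
have mH lam : 0 <= lam -> cmeasurable ((fun om => cpow 1 om (-2) * H lam 1 om) : measurableTypeR R -> R[i]).
  move=> l0; have [H' hH] := holH 2 l0.
  have := @line_integrable _ _ _ half0 _ _ 1 hH.
  by move=> /(_ _)/cintegrable_measurable; apply; rewrite invf_lt1 ?ltr1n//=; lra.
have HE lam om : cpow 1 om (-2) * H lam 1 om =
   cexp (1 +i* om) * cpow 1 om (- (beta + 4)) * difs P 0 (qq lam 1 om).
  rewrite /H; have -> : - (beta + 4) = - 2 + (- (beta + 2)) by ring.
  by rewrite cpowD; ring.
exists ((2 * pi)^-1 * (2 * I)); first by rewrite !mulr_ge0.
move=> lam l0; rewrite ml_lineE// /ml_line cabsM cabs_real (ger0_norm p0); split.
  apply: (ler_wpM2l p0).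
  apply: (@cabs_cintegral _ (measurableTypeR R) R mu _ _ (mH lam l0) _ iM).
  move=> om; rewrite HE.
  have [h1 _] := Hk lam 1 om l0 ltr01.
  have V : cabs (1 - qq lam 1 om)^-1 <= kap^-1.
    by rewrite cabsV lef_pV2 ?posrE//; exact: lt_le_trans h1.
  have T := cabs_tail5 (P 0) (dif P 0) (dif (dif P) 0) (dif (dif (dif P)) 0)
     (dif (dif (dif (dif P))) 0) V (qV lam om l0) kV.
  rewrite cabsM [cabs (cexp _ * _)]cabsM cabs_cexp [Re _]/= /M.
  apply: ler_pM_swap (expR_ge0 _) (cabs_ge0 _) (cabs_ge0 _) _ T.
  by rewrite -cabs_cpowN2//; apply: cabs_cpow_le => //; have := b0; lra.
rewrite mulrCA; apply: (ler_wpM2l p0).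
have -> : lam * cabs (cintegral mu (fun om => cpow 1 om (-2) * H lam 1 om)) =
    cabs (cintegral mu (fun om => lam%:C * (cpow 1 om (-2) * H lam 1 om))).
  have [H' hH] := holH 2 l0.
  have iH : cintegrable mu (fun om => cpow 1 om (-2) * H lam 1 om).
    by apply: (line_integrable half0 hH); rewrite invf_lt1 ?ltr1n//=; lra.
  have -> : cintegral mu (fun om => lam%:C * (cpow 1 om (-2) * H lam 1 om)) =
     lam%:C * cintegral mu (fun om => cpow 1 om (-2) * H lam 1 om).
    exact: (@cintegralZl _ (measurableTypeR R)).
  by rewrite cabsM cabs_real ger0_norm.
have mlH : cmeasurable ((fun om => lam%:C * (cpow 1 om (-2) * H lam 1 om)) : measurableTypeR R -> R[i]).
  by apply: cmeasurableM; [exact: cmeasurable_cst|exact: (mH lam l0)].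
apply: (@cabs_cintegral _ (measurableTypeR R) R mu _ _ mlH _ iM).
(* For lam = 0 one has q = 0, and |q|^(-1) would give no bound; but then the left side vanishes. *)
move=> om; have [l00|ln0] := eqVneq lam 0.
  by rewrite l00 mul0r cabs0 mulr_ge0// invr_ge0 ltW// normsq_gt0.
have lp : 0 < lam by rewrite lt_def ln0.
have [h1 h2] := Hk lam 1 om l0 ltr01.
have cq : cabs (qq lam 1 om) = lam * cabs (cpow 1 om (- alpha)).
  by rewrite /qq cabsM cabsM cabs_expi mul1r cabs_real ger0_norm.
have cp := cabs_cpow_gt0 1 om (- alpha).
have V : cabs (1 - qq lam 1 om)^-1 <= kap^-1 * (lam * cabs (cpow 1 om (- alpha)))^-1.
  rewrite cabsV -invfM lef_pV2 ?posrE ?mulr_gt0//; last exact: lt_le_trans h1.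
  by rewrite -cq.
have T := cabs_tail5 (P 0) (dif P 0) (dif (dif P) 0) (dif (dif (dif P)) 0)
   (dif (dif (dif (dif P))) 0) V (qV lam om l0) kV.
rewrite HE cabsM cabs_real ger0_norm// cabsM [cabs (cexp _ * _)]cabsM cabs_cexp [Re _]/= /M.
have {}T : lam * cabs (difs P 0 (qq lam 1 om)) <=
    S * (kap^-1 * kap^-1 ^+ 4) * cabs (cpow 1 om alpha).
  rewrite (le_trans (ler_wpM2l l0 T))// -/S.
  rewrite -[alpha in leRHS]opprK (cpowN _ _ (- alpha)) cabsV.
  rewrite le_eqVlt; apply/orP; left; apply/eqP; field.
  by rewrite ln0 !gt_eqF.
apply: ler_pM_ratio (expR_ge0 _) (cabs_ge0 _) _ T _.
  by rewrite !mulr_ge0 ?exprn_ge0.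
rewrite -cabsM -cpowD -cabs_cpowN2//; apply: cabs_cpow_le => //.
by have := b0; have := a2; lra.
Qed.

End representation.

(** * Fourier transform on R^n *)

Section product_integrals.
Context {R : realType}.
Local Notation mu := (@lebesgue_measure R).

Lemma cmeasurable_comp d1 d2 (T1 : measurableType d1) (T2 : measurableType d2)
    (F : T2 -> R[i]) (g : T1 -> T2) :
  measurable_fun setT g -> cmeasurable F -> cmeasurable (fun x => F (g x)).
Proof.
move=> mg [mR mI]; split.
  exact: (@measurableT_comp _ _ _ _ _ _ (fun x => Re (F x))).
exact: (@measurableT_comp _ _ _ _ _ _ (fun x => Im (F x))).
Qed.

Lemma cmeasurable_prod d (T : measurableType d) I (r : seq I)
    (F_ : I -> T -> R[i]) :
  (forall i, cmeasurable (F_ i)) -> cmeasurable (fun x => \prod_(i <- r) F_ i x).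
Proof.
move=> mF; elim: r => [|i r IH].
  by under eq_fun do rewrite big_nil; exact: cmeasurable_cst.
by under eq_fun do rewrite big_cons; exact: cmeasurableM.
Qed.

Lemma integral_rV_cons n (f : 'rV[R]_n.+1 -> R) :
  measurable_fun setT f ->
  ((mu \x lebesgue_rV R n)%E).-integrable setT (EFin \o (f \o @rV_cons R n)) ->
  (lebesgue_rV R n.+1).-integrable setT (EFin \o f) /\
  \int[lebesgue_rV R n.+1]_x f x =
  \int[(mu \x lebesgue_rV R n)%E]_x f (rV_cons x).
Proof.
move=> mf fi.
have mc : measurable_fun [set: (measurableTypeR R * 'rV[R]_n)%type] (@rV_cons R n).
  exact: (@measurable_rV_cons _ R n).
have mf' : measurable_fun setT (EFin \o f) by exact/measurable_EFinP.
pose m := [the measure _ _ of (mu \x lebesgue_rV R n)%E].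
have H := @integrable_pushforward _ _ _ _ R _ mc m setT (EFin \o f) mf'.
have H2 := @integral_pushforward _ _ _ _ R _ mc m setT (EFin \o f) mf'.
rewrite preimage_setT in H H2.
split; first exact: (H fi measurableT).
rewrite /Rintegral; congr fine.
exact: (H2 fi measurableT).
Qed.

Lemma cintegral_rV_cons n (F : 'rV[R]_n.+1 -> R[i]) :
  cmeasurable F -> cintegrable ((mu \x lebesgue_rV R n)%E) (F \o @rV_cons R n) ->
  cintegrable (lebesgue_rV R n.+1) F /\
  cintegral (lebesgue_rV R n.+1) F =
  cintegral ((mu \x lebesgue_rV R n)%E) (F \o @rV_cons R n).
Proof.
move=> [mR mI] [iR iI].
have [R1 R2] := @integral_rV_cons n (fun x => Re (F x)) mR iR.
have [I1 I2] := @integral_rV_cons n (fun x => Im (F x)) mI iI.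
by split => //; apply: eq_c; [exact: R2|exact: I2].
Qed.

Lemma cintegral_rV_prod n (h : 'I_n -> R -> R[i]) :
  (forall i, cintegrable mu (h i)) ->
  cintegrable (lebesgue_rV R n) (fun x => \prod_i h i (x ord0 i)) /\
  cintegral (lebesgue_rV R n) (fun x => \prod_i h i (x ord0 i)) =
  \prod_i cintegral mu (h i).
Proof.
elim: n h => [|n IH] h hi.
  have E : (fun x : 'rV[R]_0 => \prod_i h i (x ord0 i)) = (fun=> 1).
    by apply/funext => x; rewrite big_ord0.
  rewrite E big_ord0 /=; split.
    by split; exact: finite_measure_integrable_cst.
  apply: eq_c => /=; rewrite /Rintegral integral_dirac ?diracT ?mul1e//;
    exact: measurable_cst.
pose h' := fun i => h (lift ord0 i).
have [I1 I2] := IH h' (fun i => hi _).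
have mF (i : 'I_n.+1) : cmeasurable (fun x : 'rV[R]_n.+1 => h i (x ord0 i)).
  apply: (@cmeasurable_comp _ _ _ (measurableTypeR R)).
    exact: (@measurable_rV_coord _ R).
  exact: (cintegrable_measurable (hi i)).
have mFp := cmeasurable_prod (index_enum _) mF.
have E (z : R * 'rV[R]_n) : \prod_i h i (rV_cons z ord0 i) =
    h ord0 z.1 * \prod_i h' i (z.2 ord0 i).
  rewrite big_ord_recl mxE unlift_none; congr *%R.
  by apply: eq_bigr => i _; rewrite mxE liftK.
have mF' : cmeasurable (fun z : (measurableTypeR R) * 'rV[R]_n => h ord0 z.1 * \prod_i h' i (z.2 ord0 i)).
  under eq_fun do rewrite -E.
  have mc : measurable_fun [set: (measurableTypeR R * 'rV[R]_n)%type] (@rV_cons R n).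
    exact: (@measurable_rV_cons _ R n).
  exact: (@cmeasurable_comp _ _ (measurableTypeR R * 'rV[R]_n)%type 'rV[R]_n.+1
    (fun x => \prod_i h i (x ord0 i)) _ mc mFp).
have [|||||P1 P2] := @cintegral_prod _ _ (measurableTypeR R) _ R mu (lebesgue_rV R n)
    (fun z => h ord0 z.1 * \prod_i h' i (z.2 ord0 i))
    (fun x => cabs (h ord0 x)) (fun y => cabs (\prod_i h' i (y ord0 i))) mF'.
- by move=> x; exact: cabs_ge0.
- by move=> x; exact: cabs_ge0.
- by move=> x y /=; rewrite cabsM.
- exact: cintegrable_abs (hi ord0).
- exact: cintegrable_abs I1.
have Ef : (fun x : 'rV[R]_n.+1 => \prod_i h i (x ord0 i)) \o @rV_cons R n =
    (fun z => h ord0 z.1 * \prod_i h' i (z.2 ord0 i)).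
  by apply/funext => z; exact: E.
have P1' : cintegrable (mu \x lebesgue_rV R n)%E
    ((fun x : 'rV[R]_n.+1 => \prod_i h i (x ord0 i)) \o @rV_cons R n) by rewrite Ef; exact: P1.
have [J1 J2] := @cintegral_rV_cons n _ mFp P1'.
split => //; apply: (etrans J2); rewrite Ef.
apply: (etrans P2).
rewrite big_ord_recl -I2 -(@cintegralZr _ (measurableTypeR R) _ mu); last exact: hi.
apply: (@eq_cintegral _ (measurableTypeR R) R mu) => x.
exact: (@cintegralZl _ _ R (lebesgue_rV R n) (h ord0 x) _ I1).
Qed.

Lemma integral_rV_prod n (h : 'I_n -> R -> R) :
  (forall i, mu.-integrable setT (EFin \o h i)) ->
  (lebesgue_rV R n).-integrable setT (EFin \o (fun x => \prod_i h i (x ord0 i))) /\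
  \int[lebesgue_rV R n]_x (\prod_i h i (x ord0 i)) = \prod_i \int[mu]_x h i x.
Proof.
move=> hi.
have [|[I1 _] I2] := @cintegral_rV_prod n (fun i x => (h i x)%:C).
  move=> i; apply: (@cintegrable_le _ (measurableTypeR R) R mu _ (fun x => `|h i x|)).
  - by apply: cmeasurable_real; exact: integrable_measurable (hi i).
  - by move=> x; rewrite cabs_real.
  - exact: (integrable_norm (hi i)).
have E (x : 'rV[R]_n) : \prod_i ((h i (x ord0 i))%:C : R[i]) = (\prod_i h i (x ord0 i))%:C.
  by rewrite rmorph_prod.
split.
  apply: eq_integrable I1 => // x _ /=.
  by rewrite E.
have H : (\int[lebesgue_rV R n]_x (\prod_i h i (x ord0 i)))%:C =
    (\prod_i \int[mu]_x h i x)%:C.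
  rewrite -cintegral_real rmorph_prod /=.
  apply: (etrans (@eq_cintegral _ _ R (lebesgue_rV R n) _ _ (fun x => esym (E x)))).
  by apply: (etrans I2); apply: eq_bigr => i _; exact: cintegral_real.
by case: H.
Qed.

End product_integrals.

(** * Measurability on R^n *)

Section rV_measurability.
Context {R : realType} {n : nat}.
Implicit Types (x y : 'rV[R]_n) (u : 'rV[R]_n -> R).

(** The sigma-algebra is generated by the coordinates, so continuity does not give measurability at
    once. Composed with [grid k], any function is constant on each of countably many boxes, hence
    measurable, and a continuous one is the limit of these compositions. *)
Definition grid (k : nat) x : 'rV[R]_n :=
  \row_i ((Num.floor (k.+1%:R * x ord0 i))%:~R / k.+1%:R).

Lemma cvg_grid x : grid ^~ x @ \oo --> x.
Proof.
apply/cvg_ballP => e e0.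
have /cvgrPdist_lt/(_ e e0) : @invS R @ \oo --> (0 : R) by exact: cvg_invS.
apply: filterS => k; rewrite sub0r normrN gtr0_norm ?invS_gt0// => ke; split => // i j.
rewrite /ball/= mxE (ord1 i); apply: le_lt_trans ke.
have k0 : 0 < k.+1%:R :> R by rewrite ltr0n.
have /andP[f1 f2] := floor_itv (k.+1%:R * x ord0 j).
have -> : x ord0 j - (Num.floor (k.+1%:R * x ord0 j))%:~R / k.+1%:R =
   (k.+1%:R * x ord0 j - (Num.floor (k.+1%:R * x ord0 j))%:~R) / k.+1%:R.
  by rewrite mulrBl mulrAC divff ?mul1r// gt_eqF.
rewrite normrM normfV (gtr0_norm k0) /invS -[leRHS]mul1r ler_wpM2r ?invr_ge0 ?ltW//.
move: f1 f2; rewrite rmorphD/=; move: ((Num.floor _)%:~R : R) => f f1 f2.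
by rewrite ger0_norm; lra.
Qed.

Lemma grid_measurable k u : measurable_fun setT (u \o grid k).
Proof.
move=> _ Y mY; rewrite setTI.
pose q (z : 'rV[int]_n) : 'rV[R]_n := \row_i ((z ord0 i)%:~R / k.+1%:R).
pose B (z : 'rV[int]_n) := [set x : 'rV[R]_n | forall i, Num.floor (k.+1%:R * x ord0 i) = z ord0 i].
have -> : (u \o grid k) @^-1` Y = \bigcup_(z in [set z | Y (u (q z))]) B z.
  apply/seteqP; split => [x /= Yx|x [z /= Yz Bz]].
    exists (\row_i Num.floor (k.+1%:R * x ord0 i)) => /=; last by move=> i; rewrite mxE.
    by rewrite (_ : q _ = grid k x)//; apply/rowP => i; rewrite !mxE.
  by rewrite (_ : grid k x = q z)//; apply/rowP => i; rewrite !mxE Bz.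
rewrite bigcup_mkcond; apply: countable_bigcupT_measurable => [|z].
  exact: countableP.
case: ifP => _; last exact: measurable0.
rewrite [X in measurable X](_ : _ = \bigcap_(i in [set: 'I_n])
    ((fun x : 'rV[R]_n => k.+1%:R * x ord0 i) @^-1`
     `[(z ord0 i)%:~R, (z ord0 i + 1)%:~R[)); last first.
  apply/seteqP; split => x /=.
    by move=> Bx i _; rewrite /= in_itv/= -Bx floor_itv.
  by move=> Bx i; apply: floor_def; have := Bx i I; rewrite /= in_itv.
apply: fin_bigcap_measurable => [|i _]; first exact: finite_finset.
rewrite -[X in measurable X]setTI.
have : measurable_fun setT (fun x : 'rV[R]_n => k.+1%:R * x ord0 i).
  by apply: measurable_funM => //; exact: measurable_rV_coord.
by apply => //; exact: measurable_itv.
Qed.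

Lemma continuous_rV_measurable u : continuous u -> measurable_fun setT u.
Proof.
move=> cu; apply: (@measurable_fun_cvg _ _ _ setT (fun k => u \o grid k)).
  by move=> k; exact: grid_measurable.
move=> x _; exact: (@cvg_comp _ _ _ (grid ^~ x) u _ _ _ (@cvg_grid x) (cu x)).
Qed.

Lemma dotp_measurable d (T : measurableType d) (f g : T -> 'rV[R]_n) :
  measurable_fun setT f -> measurable_fun setT g ->
  measurable_fun setT (fun t => dotp (f t) (g t)).
Proof.
move=> mf mg; apply: measurable_sum => i; apply: measurable_funM.
  exact: measurableT_comp (measurable_rV_coord i) mf.
exact: measurableT_comp (measurable_rV_coord i) mg.
Qed.

Lemma dotpl_measurable y : measurable_fun setT (fun x => dotp x y).
Proof. exact: dotp_measurable. Qed.

Lemma enorm_measurable : measurable_fun setT (@enorm R n).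
Proof.
apply: (@measurableT_comp _ _ _ _ _ _ (@Num.sqrt R)).
  by apply: continuous_measurable_fun; exact: sqrt_continuous.
apply: measurable_sum => i; apply: measurable_funM; exact: measurable_rV_coord.
Qed.

End rV_measurability.

(** * An integrable majorant of Schwartz functions *)

Section schwartz_decay.
Context {R : realType} {n : nat}.
Implicit Types (psi : 'rV[R]_n -> R[i]).
Local Notation mu := (@lebesgue_measure R).

(** A product over the coordinates, so that its integral factorizes. The summand [1 ^+ 2] matches
    [invnormsq_integrable] at [c = 1]. *)
Definition wgt (x : 'rV[R]_n) : R := \prod_i (1 ^+ 2 + x ord0 i ^+ 2)^-1.

Lemma wgt_gt0 x : 0 < wgt x.
Proof.
apply: prodr_gt0 => i _.
by rewrite invr_gt0 ltr_pwDl ?sqr_ge0// exprn_gt0.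
Qed.

Lemma wgt_le1 x : wgt x <= 1.
Proof.
rewrite /wgt; apply: prodr_ile1 => i _.
have h : 1 <= 1 ^+ 2 + x ord0 i ^+ 2 :> R by rewrite expr1n lerDl sqr_ge0.
by rewrite invr_ge0 (le_trans ler01 h)/= invf_le1// (lt_le_trans ltr01 h).
Qed.

Lemma wgt_integrable : (lebesgue_rV R n).-integrable setT (EFin \o wgt).
Proof.
exact: (integral_rV_prod (fun=> @invnormsq_integrable R 1 ltr01)).1.
Qed.

(* For the multi-index a equal to 2 where |x_i| >= 1 and to 0 elsewhere,
   the product of the 1 + x_i^2 is at most 2^n |x^a|. *)
Definition wgt_seminorms : seq ({ffun 'I_n -> nat} * seq 'I_n) :=
  [seq ([ffun i => if i \in A then 2%N else 0%N], [::]) | A : {set 'I_n} <- enum {set 'I_n}].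

Definition wgt_norm psi : R := \sum_(l <- wgt_seminorms) schwartz_seminorm l.1 l.2 psi.

Lemma cpartials0 psi x : cpartials [::] psi x = psi x.
Proof. exact: eq_c. Qed.

Lemma seminorm_ge psi a x : schwartz psi ->
  `|monomial a x| * cabs (psi x) <= schwartz_seminorm a [::] psi.
Proof.
move=> [_ _ H]; apply: ub_le_sup; first exact: H.
by exists x => //; rewrite cpartials0.
Qed.

Lemma schwartz_decay psi x : schwartz psi ->
  cabs (psi x) <= 2 ^+ n * wgt_norm psi * wgt x.
Proof.
move=> sp; pose B := [set i | 1 <= `|x ord0 i|]%SET.
pose aS (A : {set 'I_n}) := [ffun i => if i \in A then 2%N else 0%N].
have h0 A : 0 <= schwartz_seminorm (aS A) [::] psi.
  by apply: le_trans (@seminorm_ge psi _ 0 sp); rewrite mulr_ge0 ?cabs_ge0.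
have h1 : `|monomial (aS B) x| * cabs (psi x) <= wgt_norm psi.
  apply: (le_trans (@seminorm_ge psi _ x sp)).
  rewrite /wgt_norm big_map big_enum/= (bigD1 B)//=.
  by rewrite lerDl; apply: sumr_ge0 => A _; exact: h0.
have h2 : (wgt x)^-1 <= 2 ^+ n * `|monomial (aS B) x|.
  rewrite /wgt -prodfV normr_prod -[in X in 2 ^+ X](card_ord n) -prodr_const -big_split/=.
  apply: ler_prod => i _; rewrite invrK addr_ge0 ?sqr_ge0 ?expr1n//=.
  rewrite ffunE inE; case: ifP => [xi|/negbT]; rewrite ?expr0 ?normr1 ?mulr1.
    have : 1 <= x ord0 i ^+ 2 by rewrite -real_normK ?num_real// exprn_ege1.
    by rewrite normrX real_normK ?num_real// mulr2n mulrDl mul1r => h; rewrite lerD2r.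
  rewrite -ltNge => xi.
  have : x ord0 i ^+ 2 <= 1 by rewrite -[X in X <= _]real_normK ?num_real// exprn_ile1 ?normr_ge0 ?(ltW xi).
  by move=> h; rewrite mulr2n lerD2l.
have w0 := wgt_gt0 x; rewrite -ler_pdivrMr//.
apply: (@le_trans _ _ (2 ^+ n * `|monomial (aS B) x| * cabs (psi x))).
  by rewrite mulrC; exact: ler_wpM2r (cabs_ge0 _) _ _ h2.
by rewrite -mulrA; apply: ler_wpM2l h1; rewrite exprn_ge0.
Qed.

Lemma schwartz_measurable psi : schwartz psi -> cmeasurable psi.
Proof.
move=> [s1 s2 _]; split; apply: continuous_rV_measurable.
  exact: (s1 [::]).1.
exact: (s2 [::]).1.
Qed.

End schwartz_decay.

(** * The Fourier transform of integrable functions *)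

Section fourier_basics.
Context {R : realType} {n : nat}.
Implicit Types (u v psi : 'rV[R]_n -> R[i]) (x y xi : 'rV[R]_n).
Local Notation lam := (lebesgue_rV R n).
Local Notation mu := (@lebesgue_measure R).

Lemma dotpC x y : dotp x y = dotp y x.
Proof. by apply: eq_bigr => i _; rewrite mulrC. Qed.

Lemma cmeasurable_kernel u : cmeasurable u ->
  cmeasurable (fun z : 'rV[R]_n * 'rV[R]_n => cexpi (- dotp z.1 z.2) * u z.1).
Proof.
move=> mu; apply: cmeasurableM.
  apply: cmeasurable_expi; apply: measurableT_comp => //.
  exact: dotp_measurable.
exact: (@cmeasurable_comp _ _ _ _ _ u fst).
Qed.

Lemma fourier_bound u xi : cintegrable lam u ->
  cabs (fourier u xi) <= 2 * \int[lam]_x cabs (u x).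
Proof.
move=> ui; apply: cabs_cintegral.
- apply: cmeasurableM; last exact: cintegrable_measurable ui.
  by apply: cmeasurable_expi; apply: measurableT_comp => //; exact: dotpl_measurable.
- by move=> x; rewrite cabsM cabs_expi mul1r.
- exact: cintegrable_abs ui.
Qed.

Lemma kernel_integrable u y : cintegrable lam u ->
  cintegrable lam (fun x => cexpi (- dotp x y) * u x).
Proof.
move=> ui; apply: (@cintegrableMl _ _ R lam u (fun x => cexpi (- dotp x y)) 1) => //.
  by apply: cmeasurable_expi; apply: measurableT_comp => //; exact: dotpl_measurable.
by move=> x; rewrite cabs_expi.
Qed.

Lemma fourier_pairing u v : cintegrable lam u -> cintegrable lam v ->
  [/\ cintegrable lam (fun xi => fourier u xi * v xi),
      cintegrable lam (fun x => u x * fourier v x) &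
      cintegral lam (fun xi => fourier u xi * v xi) =
      cintegral lam (fun x => u x * fourier v x)].
Proof.
move=> ui vi; have mu_ := cintegrable_measurable ui; have mv := cintegrable_measurable vi.
have [||||||I1 I2 I3 I4 I5] := @cFubini _ _ _ _ R lam lam
    (fun z => cexpi (- dotp z.1 z.2) * u z.1 * v z.2)
    (fun x => cabs (u x)) (fun y => cabs (v y)).
- apply: cmeasurableM; first exact: cmeasurable_kernel.
  exact: (@cmeasurable_comp _ _ _ _ _ v snd).
- by move=> x; exact: cabs_ge0.
- by move=> x; exact: cabs_ge0.
- by move=> x y /=; rewrite !cabsM cabs_expi mul1r.
- exact: cintegrable_abs ui.
- exact: cintegrable_abs vi.
have E1 y : cintegral lam (fun x => cexpi (- dotp x y) * u x * v y) =
    fourier u y * v y.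
  exact: (@cintegralZr _ _ R lam (v y) _ (@kernel_integrable u y ui)).
have E2 x : cintegral lam (fun y => cexpi (- dotp x y) * u x * v y) =
    u x * fourier v x.
  apply: (etrans _ (@cintegralZl _ _ R lam (u x) _ (@kernel_integrable v x vi))).
  by apply: eq_cintegral => y; rewrite dotpC mulrCA mulrA.
have F1 : (fun xi => fourier u xi * v xi) =
    (fun y => cintegral lam (fun x => cexpi (- dotp x y) * u x * v y)).
  by apply/funext => y; rewrite E1.
have F2 : (fun x => u x * fourier v x) =
    (fun x => cintegral lam (fun y => cexpi (- dotp x y) * u x * v y)).
  by apply/funext => y; rewrite E2.
split; first exact: (eq_ind_r (cintegrable lam) I4 F1).
  exact: (eq_ind_r (cintegrable lam) I3 F2).
exact: (etrans (congr1 (cintegral lam) F1)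
  (etrans (esym I5) (congr1 (cintegral lam) (esym F2)))).
Qed.

Lemma wgt_cintegrable : cintegrable lam (fun x => (wgt x)%:C).
Proof.
apply: (cintegrable_le _ _ wgt_integrable).
  by apply: cmeasurable_real; exact: integrable_measurable wgt_integrable.
by move=> x; rewrite cabs_real gtr0_norm// wgt_gt0.
Qed.

(** Times the positive integrable weight [wgt], the transform is one side of [fourier_pairing],
    hence integrable; dividing by the weight gives measurability. *)
Lemma fourier_measurable u : cintegrable lam u -> cmeasurable (fourier u).
Proof.
move=> ui; have [I1 _ _] := fourier_pairing ui wgt_cintegrable.
have -> : fourier u = (fun xi => fourier u xi * (wgt xi)%:C * ((wgt xi)^-1)%:C).
  apply/funext => xi; rewrite -mulrA -rmorphM/= divff ?mulr1//.
  by rewrite gt_eqF// wgt_gt0.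
apply: cmeasurableM; first exact: cintegrable_measurable I1.
apply: cmeasurable_real.
have -> : (fun x : 'rV[R]_n => (wgt x)^-1) = (fun x => \prod_i (1 ^+ 2 + x ord0 i ^+ 2)).
  by apply/funext => x; rewrite /wgt -prodfV; apply: eq_bigr => i _; rewrite invrK.
apply: measurable_prod => i _.
apply: measurable_funD => //; apply: measurable_funX; exact: measurable_rV_coord.
Qed.

End fourier_basics.

(** * Product Poisson kernels and the damped transform *)

Section poisson_kernel.
Context {R : realType} {n : nat}.
Implicit Types (u : 'rV[R]_n -> R[i]) (x y z xi : 'rV[R]_n).
Local Notation lam := (lebesgue_rV R n).
Local Notation mu := (@lebesgue_measure R).
Variables (eps : R).
Hypothesis e0 : 0 < eps.

Definition kexp_rV xi : R := \prod_i kexp eps (xi ord0 i).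
Definition poisson_rV z : R := \prod_i poisson eps (z ord0 i).

Lemma kexp_rV_ge0 xi : 0 <= kexp_rV xi.
Proof. by apply: prodr_ge0 => i _; exact: kexp_ge0. Qed.

Lemma kexp_rV_integrable : lam.-integrable setT (EFin \o kexp_rV).
Proof. exact: (integral_rV_prod (fun=> kexp_integrable e0)).1. Qed.

Lemma kexp_rV_measurable : measurable_fun setT kexp_rV.
Proof. exact: integrable_measurable kexp_rV_integrable. Qed.

Lemma poisson_rV_ge0 z : 0 <= poisson_rV z.
Proof. by apply: prodr_ge0 => i _; exact: poisson_ge0. Qed.

Lemma poisson_rV_le z : poisson_rV z <= (2 / eps) ^+ n.
Proof.
rewrite -[in leRHS](card_ord n) -prodr_const; apply: ler_prod => i _.
by rewrite poisson_ge0//= poisson_le.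
Qed.

Lemma poisson_rV_sym x y : poisson_rV (x - y) = poisson_rV (y - x).
Proof. by apply: eq_bigr => i _; rewrite !mxE -poissonN opprB. Qed.

Lemma poisson_rV_integral x :
  lam.-integrable setT (EFin \o (fun y => poisson_rV (x - y))) /\
  \int[lam]_y poisson_rV (x - y) = (2 * pi) ^+ n.
Proof.
have [H1 H2] := integral_rV_prod (fun i => (poisson_integral (x ord0 i) e0).1).
have E y : poisson_rV (x - y) = \prod_i poisson eps (x ord0 i - y ord0 i).
  by apply: eq_bigr => i _; rewrite !mxE.
split; first by apply: eq_integrable H1 => // y _ /=; rewrite E.
rewrite (eq_Rintegral _ (fun y _ => E y)) H2.
rewrite (eq_bigr (fun=> 2 * pi)) ?prodr_const ?card_ord// => i _.
exact: (poisson_integral (x ord0 i) e0).2.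
Qed.

Lemma conjcM (a b : R[i]) : conjc (a * b) = conjc a * conjc b.
Proof. exact: rmorphM. Qed.

Lemma cexpi_sum I (r : seq I) (f : I -> R) :
  cexpi (\sum_(i <- r) f i) = \prod_(i <- r) cexpi (f i).
Proof.
elim: r => [|i r IH]; first by rewrite !big_nil cexpi0.
by rewrite !big_cons cexpiD IH.
Qed.

Lemma kexp_rV_fourier z :
  cintegral lam (fun xi => (kexp_rV xi)%:C * cexpi (dotp z xi)) = (poisson_rV z)%:C.
Proof.
have [_ H] := cintegral_rV_prod (fun i => (kexp_fourier (z ord0 i) e0).1).
apply: etrans (etrans H _).
  apply: eq_cintegral => xi.
  by rewrite /kexp_rV /dotp rmorph_prod cexpi_sum -big_split.
rewrite /poisson_rV rmorph_prod; apply: eq_bigr => i _.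
exact: (kexp_fourier (z ord0 i) e0).2.
Qed.

Section smoothed.
Variable u : 'rV[R]_n -> R[i].
Hypothesis ui : cintegrable lam u.

(* Its transform is the conjugate of u convolved with the Poisson kernel, so
   pairing it with u computes the damped L^2 norm of the transform of u. *)
Definition damped xi : R[i] := (kexp_rV xi)%:C * conjc (fourier u xi).

Lemma damped_integrable : cintegrable lam damped.
Proof.
have mw : cmeasurable damped.
  apply: cmeasurableM; first exact: cmeasurable_real kexp_rV_measurable.
  exact: cmeasurable_conj (fourier_measurable ui).
pose c := 2 * \int[lam]_x cabs (u x).
have iw := @integrableZr _ _ _ lam _ measurableT c _ kexp_rV_integrable.
apply: (cintegrable_le mw _ iw) => xi.
rewrite /damped cabsM cabs_conj cabs_real ger0_norm ?kexp_rV_ge0//.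
by apply: ler_wpM2l; [exact: kexp_rV_ge0|exact: fourier_bound].
Qed.

Lemma fourier_damped x :
  fourier damped x = cintegral lam (fun y => (poisson_rV (y - x))%:C * conjc (u y)) /\
  cintegrable lam (fun y => (poisson_rV (y - x))%:C * conjc (u y)).
Proof.
have mU := cintegrable_measurable ui.
pose F (z : 'rV[R]_n * 'rV[R]_n) : R[i] :=
  (kexp_rV z.1)%:C * cexpi (dotp z.2 z.1 - dotp x z.1) * conjc (u z.2).
have mF : cmeasurable F.
  apply: cmeasurableM.
    apply: cmeasurableM.
      apply: cmeasurable_real; apply: measurableT_comp => //.
      exact: kexp_rV_measurable.
    apply: cmeasurable_expi; apply: measurable_funB.
      exact: dotp_measurable.
    by apply: dotp_measurable => //; exact: measurable_cst.
  apply: cmeasurable_conj.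
  exact: (@cmeasurable_comp _ _ _ _ _ u snd).
have [|||||_ _ _ I4 I5] := @cFubini _ _ _ _ R lam lam F kexp_rV (fun y => cabs (u y)) mF.
- exact: kexp_rV_ge0.
- by move=> y; exact: cabs_ge0.
- move=> xi y; rewrite /F /= cabsM cabs_conj cabsM cabs_expi mulr1 cabs_real.
  by rewrite ger0_norm// kexp_rV_ge0.
- exact: kexp_rV_integrable.
- exact: cintegrable_abs ui.
have E1 xi : cexpi (- dotp xi x) * damped xi = cintegral lam (fun y => F (xi, y)).
  have ci : cintegrable lam (fun y => (cexpi (- dotp y xi) * u y)^*).
    have [a b] := kernel_integrable xi ui; split.
      by under eq_fun do rewrite Re_conj.
    by under eq_fun do rewrite Im_conj; exact: (integrableN b).
  have H1 := cintegral_conj (kernel_integrable xi ui).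
  have H2 := cintegralZl (cexpi (- dotp xi x) * (kexp_rV xi)%:C) ci.
  rewrite /damped mulrA; apply: (etrans (congr1 _ (esym H1))); apply: (etrans (esym H2)).
  apply: eq_cintegral => y.
  rewrite /F /= conjcM -cexpiN opprK cexpiD (dotpC xi x).
  by rewrite -!mulrA mulrCA; congr (_ * _); rewrite mulrCA.
have E2 y : cintegral lam (fun xi => F (xi, y)) = (poisson_rV (y - x))%:C * conjc (u y).
  rewrite -kexp_rV_fourier.
  have D xi : dotp (y - x) xi = dotp y xi - dotp x xi.
    by rewrite /dotp -sumrB; apply: eq_bigr => i _; rewrite !mxE mulrBl.
  have ik : cintegrable lam (fun xi => (kexp_rV xi)%:C * cexpi (dotp (y - x) xi)).
    apply: (@cintegrable_le _ _ R lam _ kexp_rV); last exact: kexp_rV_integrable.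
      apply: cmeasurableM; first exact: cmeasurable_real kexp_rV_measurable.
      apply: cmeasurable_expi.
      exact: (dotp_measurable (measurable_cst (y - x)) (@measurable_id _ _ setT)).
    by move=> xi; rewrite cabsM cabs_expi [leLHS]mulr1 cabs_real (ger0_norm (kexp_rV_ge0 xi)).
  apply: (etrans _ (cintegralZr (conjc (u y)) ik)).
  by apply: eq_cintegral => xi; rewrite /F /= D.
have EE : (fun y => cintegral lam (fun xi => F (xi, y))) =
  (fun y => (poisson_rV (y - x))%:C * conjc (u y)) by apply/funext.
split; last exact: (eq_ind _ (cintegrable lam) I4 _ EE).
apply: etrans (etrans I5 (congr1 (cintegral lam) EE)).
exact: eq_cintegral.
Qed.

End smoothed.
End poisson_kernel.

(** * Plancherel inequality *)

Section plancherel.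
Context {R : realType} {n : nat}.
Implicit Types (x y z xi : 'rV[R]_n).
Local Notation lam := (lebesgue_rV R n).
Variable u : 'rV[R]_n -> R[i].
Hypothesis ui : cintegrable lam u.
Hypothesis u2 : lam.-integrable setT (EFin \o (fun x => cabs (u x) ^+ 2)).

Let s x : R := cabs (u x) ^+ 2.
Let s0 x : 0 <= s x. Proof. exact: sqr_ge0. Qed.
Let cn : R := (2 * pi) ^+ n.

Let smooth_sq eps (e0 : 0 < eps) y :
  lam.-integrable setT (EFin \o (fun x => s y * poisson_rV eps (y - x))) /\
  (\int[lam]_x (s y * poisson_rV eps (y - x))%:E = (cn * s y)%:E)%E.
Proof.
have [I1 I2] := poisson_rV_integral e0 y.
have J := @integrableZl _ _ _ lam _ measurableT (s y) _ I1.
split; first exact: J.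
rewrite -(Rintegral_EFin J); congr EFin.
by rewrite RintegralZl// I2 mulrC.
Qed.

Let diff_measurable : measurable_fun setT (fun z : 'rV[R]_n * 'rV[R]_n => z.2 - z.1).
Proof.
apply: measurable_fun_rV => i; under eq_fun do rewrite !mxE.
apply: measurable_funB.
  exact: measurableT_comp (measurable_rV_coord i) measurable_snd.
exact: measurableT_comp (measurable_rV_coord i) measurable_fst.
Qed.

Let poisson_rV_measurable eps : 0 < eps ->
  measurable_fun setT (@poisson_rV R n eps).
Proof.
move=> e0; have [I1 _] := poisson_rV_integral e0 (0 : 'rV[R]_n).
have := integrable_measurable I1; apply: eq_measurable_fun => x _ /=.
by rewrite poisson_rV_sym subr0.
Qed.

Let sq_measurable : measurable_fun setT s := integrable_measurable u2.

(** The half with [s x] integrates directly in y, by symmetry of the kernel; the half with [s y]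
    needs Tonelli first. Each contributes the mass [cn] times the integral of [s]. *)
Let double_integral eps (e0 : 0 < eps) :
  (\int[lam]_x \int[lam]_y ((s x + s y) * poisson_rV eps (y - x))%:E =
   (2 * cn * \int[lam]_x s x)%:E)%E.
Proof.
pose G (z : 'rV[R]_n * 'rV[R]_n) := (s z.2 * poisson_rV eps (z.2 - z.1))%:E.
have mP : measurable_fun setT (fun z : 'rV[R]_n * 'rV[R]_n => poisson_rV eps (z.2 - z.1)).
  exact: (measurableT_comp (poisson_rV_measurable e0) diff_measurable).
have mG : measurable_fun setT G.
  apply/measurable_EFinP; apply: measurable_funM => //.
  exact: (measurableT_comp sq_measurable measurable_snd).
have G0 (z : 'rV[R]_n * 'rV[R]_n) : (0 <= G z)%E.
  by rewrite lee_fin mulr_ge0// poisson_rV_ge0.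
have H3 : (\int[lam]_y (cn * s y)%:E = (cn * \int[lam]_x s x)%:E)%E.
  have J := integrableZl measurableT cn u2.
  by apply: (etrans (esym (Rintegral_EFin J))); congr EFin; exact: RintegralZl.
have K x : (\int[lam]_y (s x * poisson_rV eps (y - x))%:E)%E = (cn * s x)%:E.
  apply: etrans (smooth_sq e0 x).2; apply: eq_integral => y _.
  by rewrite poisson_rV_sym.
have key : (\int[lam]_x \int[lam]_y (s x * poisson_rV eps (y - x))%:E =
    (cn * \int[lam]_x s x)%:E)%E.
  by apply: etrans H3; apply: eq_integral => x _; exact: K.
have swap : (\int[lam]_x \int[lam]_y G (x, y) = (cn * \int[lam]_x s x)%:E)%E.
  have T := @fubini_tonelli _ _ _ _ R lam lam G mG G0.
  apply: (etrans T); apply: etrans H3; apply: eq_integral => y _.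
  exact: (smooth_sq e0 y).2.
have -> : 2 * cn * \int[lam]_x s x = cn * \int[lam]_x s x + cn * \int[lam]_x s x by ring.
rewrite EFinD -{1}key -swap -ge0_integralD//=.
- apply: eq_integral => x _; rewrite -ge0_integralD//=.
  + by apply: eq_integral => y _; rewrite -EFinD -mulrDl.
  + by move=> y _; rewrite lee_fin mulr_ge0// poisson_rV_ge0.
  + apply/measurable_EFinP; apply: measurable_funM => //.
    exact: (measurableT_comp mP (measurable_pair1 x)).
  + exact: (measurableT_comp mG (measurable_pair1 x)).
- by move=> x _; apply: integral_ge0 => y _; rewrite lee_fin mulr_ge0// poisson_rV_ge0.
- under eq_fun => x do rewrite K.
  by apply/measurable_EFinP; apply: measurable_funM.
- by move=> x _; apply: integral_ge0.
- exact: (measurable_fun_fubini_tonelli_F _ mG G0).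
Qed.

(** The factor 2 of [cabs_cintegral] is used up by 2 |u x| |u y| <= |u x|^2 + |u y|^2, which takes
    the place of Young's inequality for the convolution with the Poisson kernel. *)
Let pointwise eps (e0 : 0 < eps) x :
  ((cabs (u x * fourier (damped eps u) x))%:E <=
   \int[lam]_y ((s x + s y) * poisson_rV eps (y - x))%:E)%E.
Proof.
have [E Ei] := fourier_damped e0 ui x.
have [I1 I2] := poisson_rV_integral e0 x.
have i1 : lam.-integrable setT (EFin \o (fun y => s x * poisson_rV eps (y - x))).
  apply: eq_integrable (integrableZl measurableT (s x) I1) => // y _ /=.
  by rewrite poisson_rV_sym.
have m2 : measurable_fun setT (fun y => poisson_rV eps (y - x)).
  have := integrable_measurable I1; apply: eq_measurable_fun => y _ /=.
  by rewrite poisson_rV_sym.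
have i2 : lam.-integrable setT (EFin \o (fun y => s y * poisson_rV eps (y - x))).
  apply: (@integrable_le _ _ _ _ _ (fun y => s y * (2 / eps) ^+ n)).
  - exact: measurable_funM.
  - move=> y; rewrite normrM !ger0_norm ?poisson_rV_ge0// ler_wpM2l//.
    exact: poisson_rV_le.
  - exact: (integrableZr measurableT _ u2).
have i3 : lam.-integrable setT (EFin \o (fun y => (s x + s y) * poisson_rV eps (y - x))).
  apply: eq_integrable (integrableD measurableT i1 i2) => // y _ /=.
  by rewrite mulrDl.
rewrite -(Rintegral_EFin i3) lee_fin E cabsM.
have i4 := cintegrable_abs Ei.
have B := cabs_cintegral (cintegrable_measurable Ei) (fun y => lexx _) i4.
apply: (le_trans (ler_wpM2l (cabs_ge0 (u x)) B)).
rewrite mulrA -(RintegralZl _ measurableT i4); apply: le_Rintegral => //.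
  exact: (integrableZl measurableT _ i4).
move=> y _; rewrite cabsM cabs_conj cabs_real (ger0_norm (poisson_rV_ge0 e0 _)).
rewrite mulrA [leLHS]mulrAC; apply: ler_wpM2r; first exact: poisson_rV_ge0.
rewrite -subr_ge0 (_ : _ - _ = (cabs (u x) - cabs (u y)) ^+ 2) ?sqr_ge0//.
by rewrite /s; ring.
Qed.

(** In the constant, one factor 2 comes from [cabs_cintegral] and the other from the two halves of
    [double_integral]. No factor depends on [eps]. *)
Lemma damped_plancherel eps : 0 < eps ->
  \int[lam]_xi (kexp_rV eps xi * cabs (fourier u xi) ^+ 2) <=
  4 * cn * \int[lam]_x cabs (u x) ^+ 2 /\
  lam.-integrable setT (EFin \o (fun xi => kexp_rV eps xi * cabs (fourier u xi) ^+ 2)).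
Proof.
move=> e0; have wi := damped_integrable e0 ui.
have [I1 I2 I3] := fourier_pairing ui wi.
have E1 xi : fourier u xi * damped eps u xi =
    (kexp_rV eps xi * cabs (fourier u xi) ^+ 2)%:C.
  by rewrite /damped mulrCA mulc_conj -rmorphM.
have EE : (fun xi => fourier u xi * damped eps u xi) =
    (fun xi => (kexp_rV eps xi * cabs (fourier u xi) ^+ 2)%:C) by apply/funext.
have I1' := eq_ind _ (cintegrable lam) I1 _ EE.
split; last exact: I1'.1.
have H1 := etrans (esym (congr1 (cintegral lam) EE)) I3.
rewrite cintegral_real in H1.
have ai := cintegrable_abs I2.
have B := cabs_cintegral (cintegrable_measurable I2) (fun y => lexx _) ai.
rewrite -H1 cabs_real in B.
apply: (le_trans (ler_norm _)); apply: (le_trans B).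
have -> : 4 * cn * \int[lam]_x cabs (u x) ^+ 2 = 2 * (2 * cn * \int[lam]_x s x).
  by rewrite /s; ring.
apply: ler_wpM2l => //; rewrite -lee_fin (Rintegral_EFin ai) -(double_integral e0).
apply: ge0_le_integral => //.
- by move=> x _; rewrite lee_fin cabs_ge0.
- exact: measurable_int ai.
- have mH : measurable_fun setT (fun z : 'rV[R]_n * 'rV[R]_n =>
      ((s z.1 + s z.2) * poisson_rV eps (z.2 - z.1))%:E).
    apply/measurable_EFinP; apply: measurable_funM; last first.
      exact: (measurableT_comp (poisson_rV_measurable e0) diff_measurable).
    apply: measurable_funD.
      exact: (measurableT_comp sq_measurable measurable_fst).
    exact: (measurableT_comp sq_measurable measurable_snd).
  apply: (measurable_fun_fubini_tonelli_F _ mH) => z.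
  by rewrite lee_fin mulr_ge0 ?addr_ge0// poisson_rV_ge0.
- by move=> x _; exact: pointwise.
Qed.

Let kexp_rVE eps xi : kexp_rV eps xi = expR (- (eps * \sum_i `|xi ord0 i|)).
Proof.
rewrite mulr_sumr -sumrN (big_morph (@expR R) (@expRD R) (@expR0 R)).
by apply: eq_bigr.
Qed.

(** The damped integrands increase as the damping parameter decreases to 0, so monotone convergence
    applies; finiteness of the integral is part of the conclusion. *)
Lemma plancherel_le :
  (\int[lam]_xi (cabs (fourier u xi) ^+ 2)%:E <=
   (4 * (2 * pi) ^+ n * \int[lam]_x cabs (u x) ^+ 2)%:E)%E.
Proof.
pose g (m : nat) xi : \bar R := (kexp_rV (@invS R m) xi * cabs (fourier u xi) ^+ 2)%:E.
have mF : measurable_fun setT (fun xi => cabs (fourier u xi)).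
  exact: cabs_measurable (fourier_measurable ui).
have mg m : measurable_fun setT (g m).
  apply/measurable_EFinP; apply: measurable_funM; last exact: measurable_funX.
  by apply: kexp_rV_measurable; exact: invS_gt0.
have g0 m xi : setT xi -> (0 <= g m xi)%E.
  by move=> _; rewrite lee_fin mulr_ge0 ?sqr_ge0// kexp_rV_ge0.
have gnd xi : setT xi -> nondecreasing_seq (g ^~ xi).
  move=> _; apply/nondecreasing_seqP => m; rewrite lee_fin ler_wpM2r ?sqr_ge0//.
  rewrite !kexp_rVE ler_expR lerN2 ler_wpM2r ?invS_decr//.
  exact: sumr_ge0.
have gcvg xi : g ^~ xi @ \oo --> (cabs (fourier u xi) ^+ 2)%:E.
  apply/fine_cvgP; split; first exact: nearW.
  rewrite -[X in _ --> X]mul1r; apply: cvgM; last exact: cvg_cst.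
  have -> : (1 : R) = expR (- (0 * \sum_i `|xi ord0 i|)) by rewrite mul0r oppr0 expR0.
  under eq_fun do rewrite kexp_rVE.
  apply: continuous_cvg; first exact: continuous_expR.
  by apply: cvgN; apply: cvgM; [exact: cvg_invS|exact: cvg_cst].
rewrite (_ : (fun xi => _) = (fun xi => limn (g ^~ xi))); last first.
  by apply/funext => xi; apply/esym/cvg_lim.
rewrite (monotone_convergence _ measurableT mg g0 gnd).
apply: lime_le.
  apply: ereal_nondecreasing_is_cvgn; apply/nondecreasing_seqP => m.
  apply: ge0_le_integral => //; first exact: g0.
  by move=> xi _; have /nondecreasing_seqP := gnd xi I; exact.
apply: nearW => m.
have [H1 H2] := damped_plancherel (@invS_gt0 R m).
by rewrite -(Rintegral_EFin H2) lee_fin.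
Qed.

End plancherel.

(** * Complex limits and membership in L^p *)

Section complex_convergence.
Context d (T : measurableType d) (R : realType).
Variable mu : {measure set T -> \bar R}.
Implicit Types (F : T -> R[i]).

Definition ccvg (u : nat -> R[i]) (l : R[i]) :=
  (fun N => Re (u N)) @ \oo --> Re l /\ (fun N => Im (u N)) @ \oo --> Im l.

Lemma ccvg_unique u l l' : ccvg u l -> ccvg u l' -> l = l'.
Proof.
move=> [a b] [a' b']; apply: eq_c; first exact: (cvg_unique _ a a').
exact: (cvg_unique _ b b').
Qed.

Lemma ccvgMr u l c : ccvg u l -> ccvg (fun N => u N * c) (l * c).
Proof.
move=> [a b]; split.
  under eq_fun do rewrite ReM; rewrite ReM.
  by apply: cvgB; apply: cvgM => //; exact: cvg_cst.
under eq_fun do rewrite ImM; rewrite ImM.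
by apply: cvgD; apply: cvgM => //; exact: cvg_cst.
Qed.

Lemma ccvg_measurable (F_ : nat -> T -> R[i]) F :
  (forall N, cmeasurable (F_ N)) -> (forall x, ccvg (F_ ^~ x) (F x)) ->
  cmeasurable F.
Proof.
move=> mF FF; split.
- apply: (@measurable_fun_cvg _ _ _ setT (fun N x => Re (F_ N x))) => [N|x _].
    exact: (mF N).1.
  exact: (FF x).1.
- apply: (@measurable_fun_cvg _ _ _ setT (fun N x => Im (F_ N x))) => [N|x _].
    exact: (mF N).2.
  exact: (FF x).2.
Qed.

Lemma ccvg_cabs_le u l M : ccvg u l -> (forall N, cabs (u N) <= M) -> cabs l <= M.
Proof.
move=> [a b] uM.
have M0 : 0 <= M by exact: le_trans (cabs_ge0 _) (uM 0%N).
rewrite -(ler_pXn2r (n:=2))// ?nnegrE ?cabs_ge0// cabs_sqr.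
have c : (fun N => Re (u N) ^+ 2 + Im (u N) ^+ 2) @ \oo --> Re l ^+ 2 + Im l ^+ 2.
  by apply: cvgD; rewrite expr2; under eq_fun do rewrite expr2; exact: cvgM.
rewrite -(cvg_lim _ c)//; apply: limr_le; first by apply/cvg_ex; exists (Re l ^+ 2 + Im l ^+ 2).
by apply: nearW => N; rewrite -cabs_sqr ler_pXn2r ?nnegrE ?cabs_ge0.
Qed.

Lemma cdominated (F_ : nat -> T -> R[i]) F g :
  (forall N, cmeasurable (F_ N)) -> (forall x, ccvg (F_ ^~ x) (F x)) ->
  mu.-integrable setT (EFin \o g) -> (forall N x, cabs (F_ N x) <= g x) ->
  cintegrable mu F /\ ccvg (fun N => cintegral mu (F_ N)) (cintegral mu F).
Proof.
move=> mF FF gi Fg.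
have [a1 a2] := @Rintegral_dominated _ T R mu (fun N x => Re (F_ N x)) (fun x => Re (F x)) g
  (fun N => (mF N).1) (fun x => (FF x).1) gi (fun N x => le_trans (normRe_le _) (Fg N x)).
have [b1 b2] := @Rintegral_dominated _ T R mu (fun N x => Im (F_ N x)) (fun x => Im (F x)) g
  (fun N => (mF N).2) (fun x => (FF x).2) gi (fun N x => le_trans (normIm_le _) (Fg N x)).
by [].
Qed.

Lemma in_Lp_fin r F : 0 < r -> cmeasurable F ->
  (\int[mu]_x (cabs (F x) `^ r)%:E < +oo)%E -> in_Lp mu r%:E F.
Proof.
move=> r0 mF Foo; split => //; rewrite unlock /=.
apply: poweR_lty.
rewrite (eq_integral (fun x => (cabs (F x) `^ r)%:E))// => x _ /=.
by rewrite ger0_norm// cabs_ge0.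
Qed.

Lemma in_Lp_oo M F : cmeasurable F -> (forall x, cabs (F x) <= M) ->
  in_Lp mu +oo%E F.
Proof.
move=> mF FM; split => //; rewrite unlock /=; case: ifP => _ //.
apply: (@le_lt_trans _ _ M%:E); last exact: ltry.
apply/ess_supP; apply: nearW => x /=.
by rewrite lee_fin ger0_norm// cabs_ge0.
Qed.

End complex_convergence.

(** * Pairings with Schwartz functions *)

Section schwartz_integrability.
Context {R : realType} {n : nat}.
Implicit Types (psi f : 'rV[R]_n -> R[i]).
Local Notation lam := (lebesgue_rV R n).

Lemma wgt_norm_ge0 psi : schwartz psi -> 0 <= 2 ^+ n * wgt_norm psi.
Proof.
move=> sp; have := le_trans (cabs_ge0 _) (schwartz_decay 0 sp).
by rewrite pmulr_lge0// wgt_gt0.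
Qed.

Lemma schwartz_bounded psi x : schwartz psi -> cabs (psi x) <= 2 ^+ n * wgt_norm psi.
Proof.
move=> sp; apply: (le_trans (schwartz_decay x sp)).
by rewrite ler_piMr ?wgt_norm_ge0// wgt_le1.
Qed.

Lemma schwartz_integrable psi : schwartz psi -> cintegrable lam psi.
Proof.
move=> sp; apply: (cintegrable_le (schwartz_measurable sp) (fun x => schwartz_decay x sp)).
exact: (integrableZl measurableT _ wgt_integrable).
Qed.

Lemma schwartz_sq_integrable psi : schwartz psi ->
  lam.-integrable setT (EFin \o (fun x => cabs (psi x) ^+ 2)).
Proof.
move=> sp; have mp := cabs_measurable (schwartz_measurable sp).
have ip := cintegrable_abs (schwartz_integrable sp).
apply: (integrable_le _ _ (integrableZl measurableT (2 ^+ n * wgt_norm psi) ip)).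
  exact: measurable_funX.
move=> x; rewrite ger0_norm ?sqr_ge0// expr2.
by apply: ler_wpM2r; [exact: cabs_ge0|exact: schwartz_bounded].
Qed.

Lemma sq_integrable_fourier u : cintegrable lam u ->
  lam.-integrable setT (EFin \o (fun x => cabs (u x) ^+ 2)) ->
  lam.-integrable setT (EFin \o (fun x => cabs (fourier u x) ^+ 2)).
Proof.
move=> ui u2; apply: integrableP_lty.
  by apply: measurable_funX; exact: cabs_measurable (fourier_measurable ui).
under eq_integral => x _ do rewrite (ger0_norm (sqr_ge0 _)).
exact: le_lt_trans (plancherel_le ui u2) (ltry _).
Qed.

(** Continuity comes from [schwartz_decay], which bounds the pairing by the finitely many seminorms
    in [wgt_seminorms]. *)
Lemma tempered_bounded f K : cmeasurable f -> (forall x, cabs (f x) <= K) ->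
  tempered_function f.
Proof.
move=> mf fK.
have K0 : 0 <= K by exact: le_trans (cabs_ge0 _) (fK 0).
have fi psi : schwartz psi -> cintegrable lam (fun x => f x * psi x).
  by move=> sp; apply: (cintegrableMl (schwartz_integrable sp) mf fK).
split => //; split.
  move=> c g h sg sh; rewrite /regular_distr.
  have i1 := cintegrableZl c (fi g sg).
  apply: (etrans _ (etrans (cintegralD i1 (fi h sh)) _)).
    by apply: eq_cintegral => x; rewrite mulrDr mulrCA.
  by congr (_ + _); exact: cintegralZl (fi g sg).
exists (2 * (K * 2 ^+ n * \int[lam]_x wgt x)), wgt_seminorms => psi sp.
have iw := integrableZl measurableT (K * (2 ^+ n * wgt_norm psi)) (@wgt_integrable R n).
have B := cabs_cintegral (cintegrable_measurable (fi psi sp)) _ iw.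
apply: (le_trans (B _)).
  move=> x; rewrite cabsM -mulrA; apply: ler_pM => //; try exact: cabs_ge0.
  exact: schwartz_decay.
rewrite (RintegralZl _ measurableT wgt_integrable) -/(wgt_norm psi).
rewrite le_eqVlt; apply/orP; left; apply/eqP; ring.
Qed.

End schwartz_integrability.

(** * Dyadic decomposition *)

Section geometric_series.
Context {R : realType}.

Lemma sum_geometric_le (C theta : R) N : 0 <= C -> 0 <= theta -> theta < 1 ->
  \sum_(0 <= j < N) C * theta ^+ j <= C / (1 - theta).
Proof.
move=> C0 t0 t1; have h : 0 < 1 - theta by rewrite subr_gt0.
rewrite ler_pdivlMr// -mulr_sumr -mulrA ler_piMr//.
have -> : (\sum_(0 <= j < N) theta ^+ j) * (1 - theta) = 1 - theta ^+ N.
  elim: N => [|N IH]; first by rewrite big_geq// mul0r expr0 subrr.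
  by rewrite big_nat_recr//= mulrDl IH exprS; ring.
by rewrite gerBl exprn_ge0.
Qed.

Lemma gt1_ltr_powR (a x y : R) : 1 < a -> x < y -> a `^ x < a `^ y.
Proof.
move=> a1 xy; rewrite /powR gt_eqF ?(lt_trans ltr01)//.
by rewrite ltr_expR ltr_pM2r// ln_gt0.
Qed.

Lemma nneseries_geometric_lty d (T : measurableType d)
    (mu : {measure set T -> \bar R}) (h : nat -> T -> R) (C theta : R) :
  (forall j, measurable_fun setT (h j)) -> (forall j x, 0 <= h j x) ->
  0 <= C -> 0 <= theta -> theta < 1 ->
  (forall j, (\int[mu]_x (h j x)%:E <= (C * theta ^+ j)%:E)%E) ->
  (\int[mu]_x (\sum_(0 <= j <oo) (h j x)%:E) < +oo)%E.
Proof.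
move=> mh h0 C0 t0 t1 hC.
rewrite integral_nneseries//; last 2 first.
  by move=> j; apply/measurable_EFinP.
  by move=> j x _; rewrite lee_fin.
apply: (@le_lt_trans _ _ (C / (1 - theta))%:E); last exact: ltry.
apply: lime_le.
  by apply: is_cvg_nneseries => j _ _; apply: integral_ge0 => x _; rewrite lee_fin.
apply: nearW => N; apply: (@le_trans _ _ (\sum_(0 <= j < N) (C * theta ^+ j)%:E)%E).
  by apply: lee_sum => j _.
by rewrite sumEFin lee_fin sum_geometric_le.
Qed.

End geometric_series.

Section dyadic.
Context {R : realType} {n : nat}.
Implicit Types (x xi : 'rV[R]_n).
Local Notation lam := (lebesgue_rV R n).
Local Notation mu := (@lebesgue_measure R).
Variables (f : 'rV[R]_n -> R[i]) (K sigma : R).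
Hypothesis mf : cmeasurable f.
Hypothesis fK : forall x, cabs (f x) <= K.
Hypothesis fd : forall x, enorm x `^ sigma * cabs (f x) <= K.
Hypothesis s0 : 0 < sigma.

Definition truncated N x : R[i] := if enorm x < 2 ^+ N then f x else 0.

Definition piece j x : R[i] :=
  if j is i.+1 then (if (2 ^+ i <= enorm x) && (enorm x < 2 ^+ i.+1) then f x else 0)
  else truncated 0 x.

(** Piece 0 is the open unit ball, so N + 1 pieces are needed to fill the ball of radius 2^N; hence
    the upper index [N.+1] in the sums below. *)
Lemma sum_piece N x : \sum_(0 <= j < N.+1) piece j x = truncated N x.
Proof.
elim: N => [|N IH]; first by rewrite big_nat1.
rewrite big_nat_recr// IH /= /truncated; case: ltP => h1 /=; last by rewrite add0r.
by rewrite addr0 (lt_trans h1)// ltr_eXn2l// ltr1n.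
Qed.

Lemma measurable_cond (b : 'rV[R]_n -> bool) :
  measurable_fun setT b -> cmeasurable (fun x => if b x then f x else 0).
Proof.
move=> mb; split.
  rewrite (_ : (fun x => _) = (fun x => if b x then Re (f x) else 0)); last first.
    by apply/funext => x; case: ifP.
  by apply: measurable_fun_ifT => //; exact: mf.1.
rewrite (_ : (fun x => _) = (fun x => if b x then Im (f x) else 0)); last first.
  by apply/funext => x; case: ifP.
by apply: measurable_fun_ifT => //; exact: mf.2.
Qed.

Lemma truncated_measurable N : cmeasurable (truncated N).
Proof.
apply: measurable_cond; apply: measurable_fun_ltr => //; exact: enorm_measurable.
Qed.

Lemma piece_measurable j : cmeasurable (piece j).
Proof.
case: j => [|j]; first exact: truncated_measurable.
apply: measurable_cond; apply: measurable_and.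
  by apply: measurable_fun_ler => //; exact: enorm_measurable.
by apply: measurable_fun_ltr => //; exact: enorm_measurable.
Qed.

Lemma truncated_le N x : cabs (truncated N x) <= cabs (f x).
Proof. by rewrite /truncated; case: ifP => // _; rewrite cabs0 cabs_ge0. Qed.

Lemma truncated_near x : exists N0, forall N, (N0 <= N)%N -> enorm x < 2 ^+ N.
Proof.
exists (Num.truncn (enorm x)).+1 => N hN.
apply: (@lt_le_trans _ _ (Num.truncn (enorm x)).+1%:R).
  exact: truncnS_gt.
by rewrite -natrX ler_nat (leq_trans hN)// ltnW// ltn_expl.
Qed.

Lemma truncated_cvg x : ccvg (truncated ^~ x) (f x).
Proof.
have [N0 H] := truncated_near x.
have E : \forall N \near \oo, truncated N x = f x.
  by exists N0 => // N /= hN; rewrite /truncated H.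
by split; apply: cvg_near_cst; apply: filterS E => N ->.
Qed.

(** Lets |f|^2 be bounded pointwise by the series of the |piece j|^2, which can be integrated term
    by term. *)
Lemma piece_hit x : exists j, piece j x = f x.
Proof.
have [N0 H] := truncated_near x.
have ex : exists N, enorm x < 2 ^+ N by exists N0; exact: H.
case: (ex_minnP ex) => -[|m] hm hmin.
  by exists 0%N; rewrite /= /truncated hm.
exists m.+1; rewrite /= hm andbT leNgt; case: ifP => // /negbT; rewrite negbK => h.
by have := hmin m h; rewrite ltnn.
Qed.

Let r : R := 2 `^ sigma.
Let r_gt0 : 0 < r. Proof. by rewrite powR_gt0. Qed.
Let r_ge1 : 1 <= r.
Proof.
have h : 2 `^ 0 <= 2 `^ sigma :> R by rewrite ler_powR ?ler1n// ltW.
by rewrite powRr0 in h.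
Qed.

(** The cube around the ball of radius 2^j: its indicator is a product, so the volume factorizes,
    and only the order 2^(n j) matters. *)
Definition box j x : R := \prod_i \1_(`[- 2 ^+ j, 2 ^+ j]%classic : set R) (x ord0 i).

Lemma coord_le_enorm x i : `|x ord0 i| <= enorm x.
Proof.
rewrite -sqrtr_sqr ler_wsqrtr// /dotp (bigD1 i)//= -expr2 lerDl.
by apply: sumr_ge0 => k _; rewrite -expr2 sqr_ge0.
Qed.

Lemma box_enorm j x : enorm x < 2 ^+ j -> box j x = 1.
Proof.
move=> h; rewrite /box big1// => i _; rewrite indicE mem_set//=.
by rewrite in_itv/= -ler_norml (le_trans (coord_le_enorm x i))// ltW.
Qed.

Lemma box_ge0 j x : 0 <= box j x.
Proof. by apply: prodr_ge0 => i _; rewrite indicE. Qed.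

Lemma box_integral j : lam.-integrable setT (EFin \o box j) /\
  \int[lam]_x box j x = (2 ^+ n) ^+ j * 2 ^+ n.
Proof.
have p0 : - 2 ^+ j < 2 ^+ j :> R by rewrite gtrN// exprn_gt0.
have i1 : mu.-integrable setT (EFin \o (\1_(`[- 2 ^+ j, 2 ^+ j]%classic : set R) : R -> R)).
  exact: integrable_indic_itv.
have [H1 H2] := integral_rV_prod (fun _ : 'I_n => i1).
split => //; rewrite /box H2 prodr_const card_ord.
have -> : \int[mu]_x \1_(`[- 2 ^+ j, 2 ^+ j]%classic : set R) x = 2 ^+ j * 2 :> R.
  rewrite /Rintegral integral_indic//= setIT lebesgue_measure_itv/= lte_fin p0 -EFinD/=.
  by rewrite opprK mulr2n mulrDr mulr1.
by rewrite exprMn -!exprM mulnC.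
Qed.

Let K0 : 0 <= K. Proof. exact: le_trans (cabs_ge0 _) (fK 0). Qed.

(** On shell j >= 1 one only has |x| >= 2^(j - 1), whence the extra factor r. For j = 0 the uniform
    bound K is used, with r >= 1. *)
Lemma piece_le j x : cabs (piece j x) <= K * r * r^-1 ^+ j * box j x.
Proof.
have h0 : 0 <= K * r * r^-1 ^+ j * box j x.
  rewrite mulr_ge0 ?box_ge0// mulr_ge0 ?mulr_ge0 ?(ltW r_gt0)//.
  by rewrite exprn_ge0// invr_ge0 ltW.
case: j h0 => [|j] h0; rewrite /piece.
  move: h0; rewrite /truncated; case: ifP => [h _|_]; last by rewrite cabs0.
  by rewrite box_enorm// expr0 !mulr1 (le_trans (fK x))// ler_peMr.
move: h0; case: ifP => [/andP[h1 h2] _|_]; last by rewrite cabs0.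
rewrite box_enorm// mulr1 exprS -mulrA (mulrA r) mulfV ?gt_eqF// mul1r.
rewrite exprVn ler_pdivlMr ?exprn_gt0// mulrC (le_trans _ (fd x))//.
apply: ler_wpM2r; first exact: cabs_ge0.
rewrite /r -powR_mulrn ?powR_ge0// -powRrM mulrC powRrM powR_mulrn//.
have q0 : 0 <= 2 ^+ j :> R by rewrite exprn_ge0.
have e0 : 0 <= enorm x by exact: sqrtr_ge0.
by apply: ge0_ler_powR => //; rewrite ?nnegrE// ltW.
Qed.

(** [dratio] and [dratio2] are the rates in j of the L^1 norm and of the squared L^2 norm of
    [piece j]. *)
Definition dratio : R := 2 ^+ n / r.
Definition dratio2 : R := 2 ^+ n / r ^+ 2.

Lemma piece_integral j : cintegrable lam (piece j) /\
  \int[lam]_x cabs (piece j x) <= K * r * 2 ^+ n * dratio ^+ j.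
Proof.
have [b1 b2] := box_integral j.
have ib := integrableZl measurableT (K * r * r^-1 ^+ j) b1.
have pi_ : cintegrable lam (piece j) := cintegrable_le (piece_measurable j) (piece_le j) ib.
split => //.
apply: (@le_trans _ _ (\int[lam]_x (K * r * r^-1 ^+ j * box j x))).
  apply: le_Rintegral => //; first exact: cintegrable_abs.
  by move=> x _; exact: piece_le.
rewrite (RintegralZl _ measurableT b1) b2 /dratio exprMn.
by rewrite le_eqVlt; apply/orP; left; apply/eqP; ring.
Qed.

Lemma piece_sq_integral j :
  lam.-integrable setT (EFin \o (fun x => cabs (piece j x) ^+ 2)) /\
  \int[lam]_x (cabs (piece j x) ^+ 2) <= (K * r) ^+ 2 * 2 ^+ n * dratio2 ^+ j.
Proof.
have [b1 b2] := box_integral j.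
have ib := integrableZl measurableT ((K * r * r^-1 ^+ j) ^+ 2) b1.
have box1 x : box j x ^+ 2 = box j x.
  rewrite /box -prodrXl; apply: eq_bigr => i _; rewrite indicE.
  by case: (_ \in _); rewrite ?expr1n// expr0n.
have le2 x : cabs (piece j x) ^+ 2 <= (K * r * r^-1 ^+ j) ^+ 2 * box j x.
  rewrite -box1 -exprMn ler_pXn2r ?nnegrE ?cabs_ge0 ?piece_le//.
  exact: le_trans (cabs_ge0 _) (piece_le j x).
have i2 : lam.-integrable setT (EFin \o (fun x => cabs (piece j x) ^+ 2)).
  apply: (integrable_le _ _ ib).
    by apply: measurable_funX; exact: cabs_measurable (piece_measurable j).
  by move=> x; rewrite ger0_norm ?sqr_ge0.
split => //.
apply: (@le_trans _ _ (\int[lam]_x ((K * r * r^-1 ^+ j) ^+ 2 * box j x))).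
  by apply: le_Rintegral => // x _; exact: le2.
rewrite (RintegralZl _ measurableT b1) b2 /dratio2 !exprMn -!exprVn -!exprM.
by rewrite (mulnC j 2) le_eqVlt; apply/orP; left; apply/eqP; ring.
Qed.

Lemma dratio_ge0 : 0 <= dratio.
Proof. by rewrite divr_ge0 ?exprn_ge0 ?(ltW r_gt0). Qed.

Lemma dratio2_ge0 : 0 <= dratio2.
Proof. by rewrite divr_ge0 ?exprn_ge0 ?(ltW r_gt0). Qed.

Lemma dratio2_lt1 : n%:R / 2 < sigma -> dratio2 < 1.
Proof.
move=> ns; rewrite /dratio2 ltr_pdivrMr ?exprn_gt0// mul1r.
have -> : 2 ^+ n = 2 `^ n%:R :> R by rewrite powR_mulrn.
have -> : r ^+ 2 = 2 `^ (sigma * 2) by rewrite powRrM powR_mulrn// powR_ge0.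
by apply: gt1_ltr_powR; rewrite ?ltr1n// -ltr_pdivrMr.
Qed.

Lemma sq_integrable : n%:R / 2 < sigma ->
  lam.-integrable setT (EFin \o (fun x => cabs (f x) ^+ 2)).
Proof.
move=> ns; apply: integrableP_lty.
  by apply: measurable_funX; exact: cabs_measurable.
have mp j : measurable_fun setT (fun x => cabs (piece j x) ^+ 2).
  by apply: measurable_funX; exact: cabs_measurable (piece_measurable j).
have p0 j x : 0 <= cabs (piece j x) ^+ 2 by exact: sqr_ge0.
have := @nneseries_geometric_lty _ _ _ lam (fun j x => cabs (piece j x) ^+ 2)
  ((K * r) ^+ 2 * 2 ^+ n) dratio2 mp p0 _ dratio2_ge0 (dratio2_lt1 ns) _.
move=> H; apply: le_lt_trans (H _ _); last 2 first.
- by rewrite mulr_ge0 ?exprn_ge0// mulr_ge0// ltW.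
- move=> j; have [a b] := piece_sq_integral j.
  by rewrite -(Rintegral_EFin a) lee_fin.
apply: ge0_le_integral => //.
- apply/measurable_EFinP; apply: measurableT_comp => //; apply: measurable_funX.
  exact: cabs_measurable.
- apply: ge0_emeasurable_sum => [k x _ _|k _]; first by rewrite lee_fin.
  exact/measurable_EFinP.
- move=> x _; have [j <-] := piece_hit x; rewrite ger0_norm ?sqr_ge0//.
  apply: (@le_trans _ _ (\sum_(0 <= i < j.+1) (cabs (piece i x) ^+ 2)%:E)%E); last first.
    by apply: nneseries_lim_ge => i _; rewrite lee_fin.
  by rewrite big_nat_recr//= leeDr// sume_ge0// => i _; rewrite lee_fin.
Qed.

End dyadic.

Section absolutely_convergent_sums.
Context {R : realType}.
Implicit Types (F : nat -> R[i]).

Lemma abs_bounded_cvg (a : nat -> R) (b : nat -> R) (M : R) :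
  (forall j, `|a j| <= b j) -> (forall N, \sum_(0 <= j < N) b j <= M) ->
  cvgn (series a).
Proof.
move=> ab bM.
have c : cvgn (fun N => \sum_(0 <= j < N) `|a j|).
  apply: nondecreasing_is_cvgn.
    by apply/nondecreasing_seqP => N; rewrite big_nat_recr//= lerDl.
  exists M => _ [N _ <-]; apply: le_trans (bM N).
  by apply: ler_sum => j _.
exact: normed_cvg c.
Qed.

Definition csum F : R[i] :=
  limn (series (fun j => Re (F j))) +i* limn (series (fun j => Im (F j))).

Lemma csum_cvg F M : (forall N, \sum_(0 <= j < N) cabs (F j) <= M) ->
  ccvg (fun N => \sum_(0 <= j < N.+1) F j) (csum F).
Proof.
move=> FM; split.
  have -> : (fun N => Re (\sum_(0 <= j < N.+1) F j)) =
      (fun N => series (fun j => Re (F j)) N.+1) by apply/funext => N; rewrite Re_sum.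
  have c : series (fun j => Re (F j)) @ \oo --> limn (series (fun j => Re (F j))).
    exact: (abs_bounded_cvg (fun j => normRe_le (F j)) FM).
  by move: c; rewrite -cvg_shiftS.
have -> : (fun N => Im (\sum_(0 <= j < N.+1) F j)) =
    (fun N => series (fun j => Im (F j)) N.+1) by apply/funext => N; rewrite Im_sum.
have c : series (fun j => Im (F j)) @ \oo --> limn (series (fun j => Im (F j))).
  exact: (abs_bounded_cvg (fun j => normIm_le (F j)) FM).
by move: c; rewrite -cvg_shiftS.
Qed.

End absolutely_convergent_sums.

(** * The transform as the sum of the transforms of the shells *)

Section transfer.
Context {R : realType} {n : nat}.
Implicit Types (x xi : 'rV[R]_n) (psi : 'rV[R]_n -> R[i]).
Local Notation lam := (lebesgue_rV R n).

Lemma ae_cintegral (F F' : 'rV[R]_n -> R[i]) (D : set 'rV[R]_n) :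
  measurable D -> lam (~` D) = 0 -> cmeasurable F -> cmeasurable F' ->
  (forall x, D x -> F x = F' x) -> cintegral lam F = cintegral lam F'.
Proof.
move=> mD D0 [mR mI] [mR' mI'] FF.
have neg : lam.-negligible (~` D) by exists (~` D); split => //; exact: measurableC.
apply: eq_c; rewrite /= /Rintegral; congr fine; apply: ae_eq_integral => //;
  try exact/measurable_EFinP;
  by apply: negligibleS neg => x /= h Dx; apply: h => _; rewrite FF.
Qed.

Variables (f : 'rV[R]_n -> R[i]) (K sigma : R).
Hypothesis mf : cmeasurable f.
Hypothesis fK : forall x, cabs (f x) <= K.
Hypothesis fd : forall x, enorm x `^ sigma * cabs (f x) <= K.
Hypothesis s0 : 0 < sigma.
Hypothesis ns : n%:R / 2 < sigma.

(** [D] is a conull set on which the sum of the |F_j| is controlled and [G] is the bound there. The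
    instances are [setT] with a constant for p = +oo, and an almost everywhere finite series for
    finite p. *)
Variables (D : set 'rV[R]_n) (G : 'rV[R]_n -> R).
Hypothesis mD : measurable D.
Hypothesis D0 : lam (~` D) = 0.
Hypothesis G0 : forall x, 0 <= G x.
Hypothesis FG : forall N x, D x ->
  \sum_(0 <= j < N) cabs (fourier (piece f j) x) <= G x.
Hypothesis Gpsi : forall psi, schwartz psi ->
  lam.-integrable setT (EFin \o (fun x => G x * cabs (psi x))).

Let F j := fourier (piece f j).
(** The indicator of [D] makes convergence and the bound by [G] hold at every point, which is the
    form that [cdominated] requires. *)
Let S N x : R[i] := (\1_D x)%:C * \sum_(0 <= j < N.+1) F j x.
Let g x : R[i] := (\1_D x)%:C * csum (F ^~ x).

Let pi_ j : cintegrable lam (piece f j).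
Proof. exact: (piece_integral mf fK fd s0 j).1. Qed.

Let S_cvg x : ccvg (S ^~ x) (g x).
Proof.
rewrite /S /g; have [xD|xD] := boolP (x \in D).
  have H := csum_cvg (fun N => FG N (set_mem xD)).
  have := ccvgMr (\1_D x)%:C H; rewrite mulrC.
  by under eq_fun do rewrite mulrC.
rewrite indicE (negbTE xD) mul0r; under eq_fun do rewrite mul0r.
by split; exact: cvg_cst.
Qed.

Let S_le N x : cabs (S N x) <= G x.
Proof.
rewrite /S cabsM cabs_real indicE; have [xD|xD] := boolP (x \in D).
  rewrite normr1 mul1r; apply: le_trans (FG N.+1 (set_mem xD)).
  exact: cabs_sum.
by rewrite normr0 mul0r.
Qed.

Let S_measurable N : cmeasurable (S N).
Proof.
apply: cmeasurableM; first by apply: cmeasurable_real; exact: measurable_indic.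
by apply: cmeasurable_sum => j; exact: fourier_measurable.
Qed.

(** Both pairings are limits of one sequence: for each N, [fourier_pairing] is applied to the
    finitely many shells. The majorants are |f|^2 plus the squared transform of psi on one side,
    which is where sigma > n / 2 enters, and G |psi| on the other. *)
Lemma fourier_transfer : exists g : 'rV[R]_n -> R[i],
  [/\ cmeasurable g, forall x, cabs (g x) <= G x &
      forall psi, schwartz psi -> regular_distr f (fourier psi) = regular_distr g psi].
Proof.
have mg : cmeasurable g by exact: ccvg_measurable S_measurable S_cvg.
exists g; split => //.
  by move=> x; exact: ccvg_cabs_le (S_cvg x) (S_le ^~ x).
move=> psi sp.
have psi_i := schwartz_integrable sp.
have mpsi := schwartz_measurable sp.
have mh := fourier_measurable psi_i.
have f2 := sq_integrable mf fK fd s0 ns.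
have h2 := sq_integrable_fourier psi_i (schwartz_sq_integrable sp).
have dom1 N x : cabs (truncated f N x * fourier psi x) <=
    cabs (f x) ^+ 2 + cabs (fourier psi x) ^+ 2.
  rewrite cabsM.
  have := truncated_le f N x; have := cabs_ge0 (truncated f N x).
  have := cabs_ge0 (fourier psi x).
  move: (cabs (f x)) (cabs (fourier psi x)) (cabs (truncated f N x)) => a b c b0 c0 ca.
  apply: (@le_trans _ _ (a * b)); first by apply: ler_wpM2r.
  by have := sqr_ge0 (a - b); have := sqr_ge0 a; have := sqr_ge0 b; nra.
have dom2 N x : cabs (S N x * psi x) <= G x * cabs (psi x).
  by rewrite cabsM; apply: ler_wpM2r; [exact: cabs_ge0|exact: S_le].
have [_ L1] := @cdominated _ _ R lam (fun N x => truncated f N x * fourier psi x)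
  (fun x => f x * fourier psi x) (fun x => cabs (f x) ^+ 2 + cabs (fourier psi x) ^+ 2)
  (fun N => cmeasurableM (truncated_measurable mf N) mh)
  (fun x => ccvgMr (fourier psi x) (truncated_cvg f x))
  (integrableD measurableT f2 h2) dom1.
have [_ L2] := @cdominated _ _ R lam (fun N x => S N x * psi x)
  (fun x => g x * psi x) (fun x => G x * cabs (psi x))
  (fun N => cmeasurableM (S_measurable N) mpsi)
  (fun x => ccvgMr (psi x) (S_cvg x)) (Gpsi sp) dom2.
have E N : cintegral lam (fun x => truncated f N x * fourier psi x) =
    cintegral lam (fun x => S N x * psi x).
  have P j := fourier_pairing (pi_ j) psi_i.
  have i1 j : cintegrable lam (fun x => piece f j x * fourier psi x) by have [] := P j.
  have i2 j : cintegrable lam (fun x => F j x * psi x) by have [] := P j.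
  have [_ s1] := cintegral_sum N.+1 i1.
  have [j2 s2] := cintegral_sum N.+1 i2.
  apply: (etrans (y := cintegral lam (fun x => \sum_(0 <= j < N.+1) piece f j x * fourier psi x))).
    by apply: eq_cintegral => x; rewrite -sum_piece mulr_suml.
  rewrite s1; apply: (etrans (y := \sum_(0 <= j < N.+1) cintegral lam (fun x => F j x * psi x))).
    by apply: eq_bigr => j _; have [_ _ ->] := P j.
  (* Inserting the indicator of [D] changes the integrand only on a null set. *)
  rewrite -s2; apply: (ae_cintegral mD D0).
  - exact: cintegrable_measurable j2.
  - exact: cmeasurableM.
  - by move=> x Dx; rewrite /S indicE mem_set// mul1r mulr_suml.
apply: ccvg_unique L1 _.
have -> : (fun N => cintegral lam (fun x => truncated f N x * fourier psi x)) =
  (fun N => cintegral lam (fun x => S N x * psi x)) by apply/funext => N; exact: E.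
exact: L2.
Qed.

End transfer.

(** * Bounds in L^p *)

Section fourier_Lp.
Context {R : realType} {n : nat}.
Implicit Types (x xi : 'rV[R]_n) (psi : 'rV[R]_n -> R[i]).
Local Notation lam := (lebesgue_rV R n).
Variables (f : 'rV[R]_n -> R[i]) (K sigma : R).
Hypothesis mf : cmeasurable f.
Hypothesis fK : forall x, cabs (f x) <= K.
Hypothesis fd : forall x, enorm x `^ sigma * cabs (f x) <= K.
Hypothesis s0 : 0 < sigma.
Hypothesis ns : n%:R / 2 < sigma.

Let F j := fourier (piece f j).
Let q : R := @dratio R n sigma.
Let q2 : R := @dratio2 R n sigma.
Let K0 : 0 <= K. Proof. exact: le_trans (cabs_ge0 _) (fK 0). Qed.

(** [C1] combines [fourier_bound] with [piece_integral], and [C2] combines [plancherel_le] with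
    [piece_sq_integral]. *)
Let C1 : R := 2 * (K * 2 `^ sigma * 2 ^+ n).
Let C2 : R := 4 * (2 * pi) ^+ n * ((K * 2 `^ sigma) ^+ 2 * 2 ^+ n).
Let C1_ge0 : 0 <= C1.
Proof. by rewrite mulr_ge0// mulr_ge0 ?exprn_ge0// mulr_ge0 ?powR_ge0. Qed.
Let C2_ge0 : 0 <= C2.
Proof. by rewrite !mulr_ge0 ?exprn_ge0 ?mulr_ge0 ?powR_ge0 ?pi_ge0. Qed.

Let F_measurable j : measurable_fun setT (fun x => cabs (F j x)).
Proof.
apply: cabs_measurable; apply: fourier_measurable.
exact: (piece_integral mf fK fd s0 j).1.
Qed.

Let F_le j x : cabs (F j x) <= C1 * q ^+ j.
Proof.
have [a b] := piece_integral mf fK fd s0 j.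
by apply: (le_trans (fourier_bound x a)); rewrite /C1 -mulrA ler_wpM2l.
Qed.

Let F_sq j : (\int[lam]_x (cabs (F j x) ^+ 2)%:E <= (C2 * q2 ^+ j)%:E)%E.
Proof.
have [a _] := piece_integral mf fK fd s0 j.
have [b c] := piece_sq_integral mf fK fd s0 j.
apply: (le_trans (plancherel_le a b)).
rewrite lee_fin /C2 -[leRHS]mulrA ler_wpM2l// mulr_ge0// exprn_ge0//.
by rewrite mulr_ge0// pi_ge0.
Qed.

(** When q < 1 the sup bounds of the F_j are summable, so the sum of the geometric series serves as
    a constant [G] on the whole space. *)
Lemma fourier_Lp_oo : q < 1 -> fourier_in_Lp +oo%E f.
Proof.
move=> q1; split; first exact: tempered_bounded mf fK.
have q0 : 0 <= q := @dratio_ge0 R n sigma.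
pose M := C1 / (1 - q).
have M0 : 0 <= M by rewrite divr_ge0// subr_ge0 ltW.
have D0 : lam (~` setT) = 0 by rewrite setCT measure0.
have FM N x : setT x -> \sum_(0 <= j < N) cabs (F j x) <= M.
  move=> _; apply: le_trans (sum_geometric_le N C1_ge0 q0 q1).
  by apply: ler_sum => j _; exact: F_le.
have Mpsi psi : schwartz psi -> lam.-integrable setT (EFin \o (fun x => M * cabs (psi x))).
  move=> sp.
  exact: (integrableZl measurableT M (cintegrable_abs (schwartz_integrable sp))).
have [g [mg gM E]] := @fourier_transfer R n f K sigma mf fK fd s0 ns setT (fun=> M)
  measurableT D0 (fun=> M0) FM Mpsi.
by exists g => //; exact: in_Lp_oo mg gM.
Qed.

Section finite_exponent.
Variable p : R.
Hypothesis p2 : 2 <= p.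
Hypothesis qp : q `^ p < 2 ^+ n.

Let p_gt0 : 0 < p. Proof. exact: lt_le_trans p2. Qed.
Let q_gt0 : 0 < q.
Proof. by rewrite /q /dratio divr_gt0 ?exprn_gt0 ?powR_gt0. Qed.

(* theta = dratio `^ p / 2 ^+ n *)
Let theta : R := q `^ (p - 2) * q2.

Let theta_ge0 : 0 <= theta.
Proof. by rewrite mulr_ge0 ?powR_ge0//; exact: dratio2_ge0. Qed.

Let theta_lt1 : theta < 1.
Proof.
have e : q `^ p = q `^ (p - 2) * q ^+ 2.
  rewrite -powR_mulrn ?(ltW q_gt0)// -powRD ?subrK//.
  by apply/implyP => _; rewrite gt_eqF.
have r0 : 0 < 2 `^ sigma :> R by rewrite powR_gt0.
have e2 : q2 = q ^+ 2 / 2 ^+ n.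
  rewrite /q2 /q /dratio2 /dratio; move: (2 `^ sigma) r0 => r r0.
  by field; rewrite expf_neq0 ?pnatr_eq0//= gt_eqF.
by rewrite /theta e2 mulrA -e ltr_pdivrMr ?exprn_gt0// mul1r.
Qed.

(** Chosen so that both [1 < t] and [t * theta < 1]: the weights t^j grow, yet the weighted
    integrals still decay geometrically. *)
Let t : R := 2 / (1 + theta).

Let t_gt1 : 1 < t.
Proof.
have := theta_lt1; have := theta_ge0; rewrite /t; move: theta => th h1 h2.
by rewrite ltr_pdivlMr ?mul1r; lra.
Qed.

Let ttheta_lt1 : t * theta < 1.
Proof.
have := theta_lt1; have := theta_ge0; rewrite /t; move: theta => th h1 h2.
by rewrite mulrAC ltr_pdivrMr; lra.
Qed.

Let h j x : R := t ^+ j * cabs (F j x) `^ p.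

Let h_ge0 j x : 0 <= h j x.
Proof. by rewrite mulr_ge0 ?powR_ge0// exprn_ge0// (le_trans ler01)// ltW. Qed.

Let h_measurable j : measurable_fun setT (h j).
Proof.
apply: measurable_funM => //.
by apply: (@measurableT_comp _ _ _ _ _ _ (fun y : R => y `^ p)) => //; exact: measurable_powR.
Qed.

Let C : R := C1 `^ (p - 2) * C2.

Let powR_exprn (a s : R) j : 0 <= a -> (a ^+ j) `^ s = (a `^ s) ^+ j.
Proof.
by move=> a0; rewrite -powR_mulrn// powRAC powR_mulrn// powR_ge0.
Qed.

Let h_integral j : (\int[lam]_x (h j x)%:E <= (C * (t * theta) ^+ j)%:E)%E.
Proof.
(* Since p >= 2, |F_j|^p splits into |F_j|^(p - 2), bounded by [F_le], and |F_j|^2, integrated by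
   [F_sq]. *)
pose c := t ^+ j * (C1 * q ^+ j) `^ (p - 2).
have c0 : 0 <= c.
  by rewrite mulr_ge0 ?powR_ge0// exprn_ge0// (le_trans ler01)// ltW.
apply: (@le_trans _ _ (\int[lam]_x (c%:E * (cabs (F j x) ^+ 2)%:E))%E).
  apply: ge0_le_integral => //.
  - by move=> x _; rewrite lee_fin.
  - exact/measurable_EFinP.
  - by apply/measurable_EFinP; apply: measurable_funM => //; exact: measurable_funX.
  - move=> x _; rewrite -EFinM lee_fin /h /c -[leRHS]mulrA.
    apply: ler_wpM2l; first by rewrite exprn_ge0// (le_trans ler01)// ltW.
    have -> : cabs (F j x) `^ p = cabs (F j x) `^ (p - 2) * cabs (F j x) ^+ 2.
      rewrite -powR_mulrn ?cabs_ge0// -powRD ?subrK//.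
      by apply/implyP => /eqP e; move: p_gt0; rewrite e ltxx.
    apply: ler_wpM2r; first exact: sqr_ge0.
    apply: ge0_ler_powR; rewrite ?nnegrE ?subr_ge0 ?cabs_ge0 ?F_le//.
    by rewrite mulr_ge0 ?exprn_ge0 ?(ltW q_gt0).
rewrite ge0_integralZl//; last 2 first.
- by apply/measurable_EFinP; exact: measurable_funX.
- by move=> x _; rewrite lee_fin sqr_ge0.
apply: (le_trans (lee_wpmul2l _ (F_sq j))); first by rewrite lee_fin.
rewrite -EFinM lee_fin le_eqVlt; apply/orP; left; apply/eqP.
rewrite /c /C /theta powRM ?exprn_ge0 ?(ltW q_gt0)// powR_exprn ?(ltW q_gt0)//.
rewrite !exprMn; ring.
Qed.

Let H x : \bar R := (\sum_(0 <= j <oo) (h j x)%:E)%E.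

Let H_measurable : measurable_fun setT H.
Proof.
apply: ge0_emeasurable_sum => [k x _ _|k _]; first by rewrite lee_fin.
exact/measurable_EFinP.
Qed.

Let H_ge0 x : (0 <= H x)%E.
Proof. by apply: nneseries_ge0 => k _ _; rewrite lee_fin. Qed.

Let H_integrable : lam.-integrable setT H.
Proof.
apply/integrableP; split => //.
under eq_integral => x _ do rewrite gee0_abs//.
apply: (nneseries_geometric_lty h_measurable h_ge0 _ _ ttheta_lt1 h_integral).
  by rewrite mulr_ge0// powR_ge0.
by rewrite mulr_ge0// (le_trans ler01)// ltW.
Qed.

Let D : set 'rV[R]_n := ~` (H @^-1` [set +oo%E]).

Let D_measurable : measurable D.
Proof.
apply: measurableC; rewrite -[X in measurable X]setTI.
by apply: H_measurable => //; exact: emeasurable_set1.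
Qed.

Let D_conull : lam (~` D) = 0.
Proof.
rewrite /D setCK; apply/negligibleP.
  rewrite -[X in measurable X]setTI.
  by apply: H_measurable => //; exact: emeasurable_set1.
have := integrable_ae measurableT H_integrable.
apply: negligibleS => x /= Hx; rewrite /= => /(_ I).
by rewrite Hx.
Qed.

(** [fine] sends +oo to 0, which happens only off [D]. *)
Let m x : R := fine (H x).

Let m_ge0 x : 0 <= m x. Proof. exact: fine_ge0. Qed.

Let m_measurable : measurable_fun setT m.
Proof. exact: measurableT_comp. Qed.

Let m_integrable : lam.-integrable setT (EFin \o m).
Proof.
apply: (le_integrable measurableT _ _ H_integrable); first exact/measurable_EFinP.
move=> x _ /=; rewrite (ger0_norm (m_ge0 x)) gee0_abs// /m.
by case: (H x) (H_ge0 x) => [r|_|//]; rewrite ?leey.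
Qed.

Let tau : R := t^-1 `^ p^-1.

Let tau_lt1 : tau < 1.
Proof.
have t0 : 0 < t by exact: lt_trans ltr01 t_gt1.
have : t^-1 `^ p^-1 < 1 `^ p^-1.
  apply: gt0_ltr_powR; rewrite ?invr_gt0 ?nnegrE ?invr_ge0 ?(ltW t0)//.
  by rewrite invf_lt1.
by rewrite powR1.
Qed.

(** On [D] one has t^j |F_j|^p <= m, that is, |F_j| <= m^(1 / p) tau^j; the geometric series in tau
    sums to [G]. Moreover G^p is a multiple of the integrable [m], so the sum is in L^p without
    Minkowski's inequality or completeness. *)
Let G x : R := m x `^ p^-1 / (1 - tau).

Let G_ge0 x : 0 <= G x.
Proof. by rewrite divr_ge0 ?powR_ge0// subr_ge0 ltW. Qed.

Let F_sum_le N x : D x -> \sum_(0 <= j < N) cabs (F j x) <= G x.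
Proof.
move=> Dx; have t0 : 0 < t by exact: lt_trans ltr01 t_gt1.
apply: le_trans (sum_geometric_le N (powR_ge0 (m x) p^-1) (powR_ge0 _ _) tau_lt1).
apply: ler_sum => j _.
have hm : h j x <= m x.
  have fH : H x \is a fin_num by rewrite ge0_fin_numE// ltey; apply/eqP.
  rewrite -lee_fin /m fineK//.
  apply: (@le_trans _ _ (\sum_(0 <= i < j.+1) (h i x)%:E)%E); last first.
    by apply: nneseries_lim_ge => i _; rewrite lee_fin.
  by rewrite big_nat_recr//= leeDr// sume_ge0// => i _; rewrite lee_fin.
have h1 : cabs (F j x) `^ p <= m x * t^-1 ^+ j.
  by rewrite exprVn ler_pdivlMr ?exprn_gt0// mulrC.
have -> : cabs (F j x) = (cabs (F j x) `^ p) `^ p^-1.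
  by rewrite -powRrM divff ?powRr1 ?cabs_ge0// gt_eqF.
have -> : m x `^ p^-1 * tau ^+ j = (m x * t^-1 ^+ j) `^ p^-1.
  by rewrite powRM ?exprn_ge0 ?invr_ge0 ?(ltW t0)// powR_exprn// invr_ge0 ltW.
apply: ge0_ler_powR; rewrite ?nnegrE ?powR_ge0 ?invr_ge0 ?(ltW p_gt0)//.
by rewrite mulr_ge0 ?exprn_ge0 ?invr_ge0 ?(ltW t0).
Qed.

Let G_powR x : G x `^ p = (1 - tau)^-1 `^ p * m x.
Proof.
have t1 : 0 <= (1 - tau)^-1 by rewrite invr_ge0 subr_ge0 ltW.
rewrite /G powRM ?powR_ge0// -powRrM mulVf ?gt_eqF// powRr1// mulrC//.
Qed.

Let Gp_integrable : lam.-integrable setT (EFin \o (fun x => G x `^ p)).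
Proof.
apply: eq_integrable (integrableZl measurableT ((1 - tau)^-1 `^ p) m_integrable) => //.
by move=> x _ /=; rewrite G_powR.
Qed.

Let G_measurable : measurable_fun setT G.
Proof.
apply: measurable_funM => //.
by apply: (@measurableT_comp _ _ _ _ _ _ (fun y : R => y `^ p^-1)) => //; exact: measurable_powR.
Qed.

(** From G <= 1 + G^p: the term 1 is paired with the integrability of psi and G^p with its
    boundedness. *)
Let G_schwartz psi : schwartz psi ->
  lam.-integrable setT (EFin \o (fun x => G x * cabs (psi x))).
Proof.
move=> sp; pose B := 2 ^+ n * wgt_norm psi.
have ip := cintegrable_abs (schwartz_integrable sp).
have iG := integrableZl measurableT B Gp_integrable.
apply: (integrable_le _ _ (integrableD measurableT ip iG)).
  by apply: measurable_funM => //; exact: cabs_measurable (schwartz_measurable sp).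
move=> x /=; rewrite ger0_norm; last by apply: mulr_ge0 => //; exact: cabs_ge0.
have h1 : G x <= 1 + G x `^ p.
  have [g1|g1] := leP (G x) 1; first by rewrite (le_trans g1)// lerDl powR_ge0.
  apply: (@le_trans _ _ (G x `^ p)); last by rewrite lerDr.
  by apply: le1r_powR; [exact: ltW|rewrite (le_trans _ p2)// ler1n].
apply: (le_trans (ler_wpM2r (cabs_ge0 _) h1)); rewrite mulrDl mul1r lerD2l mulrC.
by apply: ler_wpM2r; [exact: powR_ge0|exact: schwartz_bounded].
Qed.

Lemma fourier_Lp_fin : fourier_in_Lp p%:E f.
Proof.
split; first exact: tempered_bounded mf fK.
have [g [mg gG E]] := @fourier_transfer R n f K sigma mf fK fd s0 ns D G
  D_measurable D_conull G_ge0 F_sum_le G_schwartz.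
exists g => //; apply: in_Lp_fin => //.
have := Gp_integrable; move=> /integrableP[_].
apply: le_lt_trans; apply: ge0_le_integral => //.
- by move=> x _; rewrite lee_fin powR_ge0.
- apply/measurable_EFinP.
  apply: (@measurableT_comp _ _ _ _ _ _ (fun y : R => y `^ p)); first exact: measurable_powR.
  exact: cabs_measurable.
- by apply: measurableT_comp => //; exact: (measurable_int _ Gp_integrable).
- move=> x _; rewrite /= lee_fin ger0_norm ?powR_ge0//.
  by apply: ge0_ler_powR; rewrite ?nnegrE ?cabs_ge0 ?(ltW p_gt0).
Qed.

End finite_exponent.
End fourier_Lp.

(** * The condition on the exponent *)

Section dratio_exponent.
Context {R : realType}.
Variables (n : nat) (sigma : R).

Lemma dratioE : @dratio R n sigma = 2 `^ (n%:R - sigma).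
Proof.
rewrite /dratio powRB ?powR_mulrn//.
by apply/implyP => _; rewrite pnatr_eq0.
Qed.

Lemma dratio_lt1 : n%:R < sigma -> @dratio R n sigma < 1.
Proof.
move=> ns; have h : 2 `^ (n%:R - sigma) < 2 `^ 0 :> R.
  by apply: gt1_ltr_powR; rewrite ?ltr1n ?subr_lt0.
by rewrite powRr0 in h; rewrite dratioE.
Qed.

Lemma dratio_powR_lt p : (n%:R - sigma) * p < n%:R ->
  @dratio R n sigma `^ p < 2 ^+ n.
Proof.
move=> np; rewrite dratioE -powRrM -powR_mulrn//.
by apply: gt1_ltr_powR; rewrite ?ltr1n.
Qed.

End dratio_exponent.

Unset Implicit Arguments.

Theorem theorem1 (R : realType) (n : nat) (alpha beta phi sigma : R)
    (n_ge1 : (1 <= n)%N)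
    (alpha_gt0 : 0 < alpha) (alpha_lt2 : alpha < 2)
    (beta_gt0 : 0 < beta)
    (phi_gtNpi : - pi < phi) (phi_le_pi : phi <= pi)
    (phi_sector : pi * alpha / 2 < `|phi|) :
  let E : 'rV[R]_n -> R[i] := fun x =>
    mittag_leffler alpha beta (cexpi phi * (enorm x `^ sigma)%:C) in
  [/\ n%:R < sigma ->
        forall p : \bar R, (2%:E <= p)%E -> (p <= +oo)%E -> fourier_in_Lp p E,
      sigma = n%:R ->
        forall p : \bar R, (2%:E <= p)%E -> (p < +oo)%E -> fourier_in_Lp p E
    & n%:R / 2 < sigma -> sigma < n%:R ->
        forall p : \bar R, (2%:E <= p)%E ->
          (p < (n%:R / (n%:R - sigma))%:E)%E -> fourier_in_Lp p E].
Proof.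
have phi_le : `|phi| <= pi by rewrite ler_norml phi_le_pi ltW.
move=> E; have n0 : 0 < n%:R :> R by rewrite ltr0n.
have r0 (x : 'rV[R]_n) : 0 <= enorm x `^ sigma by exact: powR_ge0.
have mr : measurable_fun setT (fun x : 'rV[R]_n => enorm x `^ sigma).
  apply: (@measurableT_comp _ _ _ _ _ _ (fun y : R => y `^ sigma)).
    exact: measurable_powR.
  exact: enorm_measurable.
have mE : cmeasurable E by exact: ml_measurable mr r0.
have [K K0 decay] := ml_decay alpha_gt0 alpha_lt2 beta_gt0 phi_le phi_sector.
have EK x : cabs (E x) <= K by exact: (decay _ (r0 x)).1.
have Ed x : enorm x `^ sigma * cabs (E x) <= K by exact: (decay _ (r0 x)).2.
(* For finite p the three ranges all reduce to (n - sigma) p < n: the left side is negative for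
   sigma > n, zero for sigma = n, and otherwise the condition is p < n / (n - sigma). *)
have fin r : n%:R / 2 < sigma -> (2%:E <= r%:E)%E -> (n%:R - sigma) * r < n%:R ->
    fourier_in_Lp r%:E E.
  move=> ns r2 rn; have s0 : 0 < sigma by rewrite (le_lt_trans _ ns)// divr_ge0.
  exact: (fourier_Lp_fin mE EK Ed s0 ns r2 (dratio_powR_lt rn)).
split.
- move=> sn; have ns : n%:R / 2 < sigma by apply: le_lt_trans sn; lra.
  have s0 : 0 < sigma by exact: lt_trans sn.
  move=> [r r2 _|_ _|//]; last exact: (fourier_Lp_oo mE EK Ed s0 ns (dratio_lt1 sn)).
  apply: fin => //; apply: lt_trans n0; rewrite nmulr_rlt0 ?subr_lt0//.
  by rewrite lee_fin in r2; exact: lt_le_trans r2.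
- move=> sn [r r2 _|//|//]; apply: fin => //; last by rewrite sn subrr mul0r.
  by rewrite sn; lra.
- move=> ns sn [r r2 rn|//|//]; apply: fin => //.
  by move: rn; rewrite lte_fin ltr_pdivlMr ?subr_gt0// mulrC.
Qed.
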